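(* Let $\alpha\ge0$, $\rho_\pm\ge0$, and $\mathfrak p(z)=kz^\gamma$ with $k>0$, $\gamma\ge1$. Let $\hat\rho(y)=\rho_-$ for $y<0$ and $\hat\rho(y)=\rho_+$ for $y\ge0$. Let $(\rho,n)$ be a weak solution of the scaled damped Euler system with initial data $(\rho_0,n_0)\in L^1_{\mathrm{loc}}(\mathbb R)^2$ such that $\mathcal E(0;\rho_0,n_0\,|\,\hat\rho,0)<\infty$, satisfying the following total relative entropy condition: there is $\rho_\infty\in C^1(\mathbb R)$ such that for some $R>0$, $\rho_\infty(y)=\rho_+$ for $y>R$ and $\rho_\infty(y)=\rho_-$ for $y<-R$, and such that for all $0\le\varphi\in C_c^\infty([0,\infty))$ $$\int_0^\infty-\varphi_\tau\mathcal E(\tau;\rho,n|\rho_\infty,0)+\varphi\Big(\tfrac12\mathcal E(\tau;\rho,n|\rho_\infty,0)+\int_{\mathbb R}\alpha\tfrac{n^2}\rho dy\Big)d\tau\le\varphi(0)\mathcal E(0;\rho_0,n_0|\rho_\infty,0)+\int_0^\infty\varphi\int_{\mathbb R}h'(\rho_\infty)_y\big(\tfrac y2(\rho-\rho_\infty)-n\big)dy\,d\tau.$$ Let $(\bar\rho,\bar n)\in C^1((0,\infty)\times\mathbb R)^2\cap C([0,\infty)\times\mathbb R)^2$ be such that $\inf\bar\rho>0$ and $$\bar\rho_y,\ \bar n_y,\ \bar\rho_\tau,\ \bar n_\tau,\ y(\bar\rho-\hat\rho),\ y\,\bar n\ \in\ L^\infty_{\mathrm{loc}}([0,\infty);L^1(\mathbb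 R)\cap L^\infty(\mathbb R)).$$ Then for all $\varphi\in C_c^1([0,\infty))$ with $\varphi\ge0$, $$\int_0^\infty-\varphi'\,\mathcal E(\tau;\rho,n|\bar\rho,\bar n)+\varphi\Big(\tfrac12\mathcal E(\tau;\rho,n|\bar\rho,\bar n)+\alpha\int_{\mathbb R}\rho\Big|\frac n\rho-\frac{\bar n}{\bar\rho}\Big|^2dy\Big)d\tau\le\varphi(0)\,\mathcal E(0;\rho_0,n_0|\bar\rho(0),\bar n(0))+\int_0^\infty\varphi\int_{\mathbb R}\xi\,dy\,d\tau.$$
   Context: Potential: $h(z)=\frac k{\gamma-1}z^\gamma$ if $\gamma>1$, $h(z)=kz\log z$ if $\gamma=1$. $h(\rho|\bar\rho)=h(\rho)-h(\bar\rho)-h'(\bar\rho)(\rho-\bar\rho)$, $\mathfrak p(\rho|\bar\rho)=\mathfrak p(\rho)-\mathfrak p(\bar\rho)-\mathfrak p'(\bar\rho)(\rho-\bar\rho)$. Convention: $\frac00:=0$. Scaled damped Euler system on $(0,\infty)\times\mathbb R$: $$\rho_\tau=\tfrac y2\rho_y-n_y,\qquad n_\tau=\tfrac y2 n_y+\tfrac12 n-\Big(\frac{n^2}\rho\Big)_y-e^\tau\big(\mathfrak p(\rho)_y+\alpha n\big).$$ Weak solution with initial data $(\rho_0,n_0)\in L^1_{\mathrm{loc}}(\mathbb R)^2$, $\rho_0\ge0$ a.e.: a pair $(\rho,n)\in L^1_{\mathrm{loc}}([0,\infty)\times\mathbb R)^2$ with $\frac{n^2}\rho,\mathfrak p(\rho)\in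 L^1_{\mathrm{loc}}([0,\infty)\times\mathbb R)$, $\rho\ge0$ a.e., such that for all $\phi,\psi\in C_c^\infty([0,\infty)\times\mathbb R)$ $$-\int_0^\infty\!\!\int_{\mathbb R}\phi_\tau\rho+\phi_y\big(-\tfrac y2\rho+n\big)-\tfrac12\phi\rho\,dy\,d\tau=\int_{\mathbb R}\phi(0,y)\rho_0\,dy,$$ $$-\int_0^\infty\!\!\int_{\mathbb R}\psi_\tau n+\psi_y\Big(-\tfrac y2 n+\frac{n^2}\rho+e^\tau \mathfrak p(\rho)\Big)-\psi e^\tau\alpha n\,dy\,d\tau=\int_{\mathbb R}\psi(0,y)n_0\,dy.$$ Relative entropy: $$\mathcal E(\tau;\rho,n|\bar\rho,\bar n)=\int_{\mathbb R}\tfrac12e^{-\tau}\rho\Big|\frac n\rho-\frac{\bar n}{\bar\rho}\Big|^2+h(\rho|\bar\rho)\,dy$$ (finiteness implicitly includes $\rho,\bar\rho\ge0$ a.e.). Residuals and error term: $$\bar R_1=\bar\rho_\tau-\tfrac y2\bar\rho_y+\bar n_y,\qquad\bar R_2=\bar n_\tau-\tfrac y2\bar n_y-\tfrac12\bar n+\Big(\frac{\bar n^2}{\bar\rho}\Big)_y+e^\tau\big(\mathfrak p(\bar\rho)_y+\alpha\bar n\big),\qquad\bar R=\frac{\bar n}{\bar\rho}\bar R_1-\bar R_2,$$ $\xi=\xi_1+\xi_2+\xi_3$ with $$\xi_1=-\Big(\frac{\bar n}{\bar\rho}\Big)_y\Big(e^{-\tau}\rho\Big|\frac n\rho-\frac{\bar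 n}{\bar\rho}\Big|^2+\mathfrak p(\rho|\bar\rho)\Big),\quad\xi_2=e^{-\tau}\bar R\,\frac\rho{\bar\rho}\Big(\frac n\rho-\frac{\bar n}{\bar\rho}\Big),\quad\xi_3=-(\rho-\bar\rho)h''(\bar\rho)\bar R_1.$$
   Formalization: Adds that the double integral of φξ exists in [−∞,∞] (the hypotheses do not control yρ̄_y, yn̄_y, so the right-hand side can be undefined), and that ρ_∞≥0 and h'(ρ_∞) is C^1, so that the entropy and h'(ρ_∞)_y make sense. *)

(* Defs.v *)
From HB Require Import structures.
From mathcomp Require Import all_boot all_order all_algebra.
From mathcomp Require Import all_classical all_reals all_analysis.
From mathcomp Require Import measurable_realfun ring lra.

Set Implicit Arguments.
Unset Strict Implicit.
Unset Printing Implicit Defensive.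

Import Order.TTheory GRing.Theory Num.Theory.
Import numFieldNormedType.Exports.

Local Open Scope classical_set_scope.
Local Open Scope ring_scope.

(* Functions of time and space are functions of a pair (tau, y) : R * R. Only
   their values for tau >= 0 matter (tau > 0 for derivatives). *)
Section function_spaces.
Context {R : realType}.
Local Notation mu := (@lebesgue_measure R).

Definition closed_half : set (R * R) := [set p | 0 <= p.1].
Definition open_half : set (R * R) := [set p | 0 < p.1].

Definition Dtau (f : R * R -> R) (p : R * R) : R := 'D_(1, 0) f p.
Definition Dy (f : R * R -> R) (p : R * R) : R := 'D_(0, 1) f p.

Definition compact_support (T : topologicalType) (f : T -> R) :=
  compact (closure [set x | f x != 0]).

Definition partial (b : bool) : (R * R -> R) -> R * R -> R :=
  if b then Dtau else Dy.

Definition smooth2 (f : R * R -> R) := forall s : seq bool,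
  let g := foldr partial f s in
  [/\ continuous g, forall p, derivable g p (1, 0)
    & forall p, derivable g p (0, 1)].

(* The spaces C_c^oo([0,oo) x R), C_c^oo([0,oo)) and C_c^1([0,oo)) consist of
   the restrictions to tau >= 0 of compactly supported functions of the same
   regularity on the whole plane, resp. line; the predicates below describe
   these extensions, and all uses only involve tau >= 0. *)
Definition test_fun2 (f : R * R -> R) := smooth2 f /\ compact_support f.

Definition test_fun (f : R -> R) :=
  (forall m x, derivable (derive1n m f) x 1) /\ compact_support f.

Definition C1 (f : R -> R) :=
  (forall x, derivable f x 1) /\ continuous (derive1 f).

Definition C1_test_fun (f : R -> R) := C1 f /\ compact_support f.

Definition C1_on (U : set (R * R)) (f : R * R -> R) := forall p, U p ->
  [/\ derivable f p (1, 0), derivable f p (0, 1),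
      {for p, continuous (Dtau f)} & {for p, continuous (Dy f)}].

(* The explicit product type carries the measurable structure of mu \x mu. *)
Local Notation plane := (measurableTypeR R * measurableTypeR R)%type.

Definition L1loc_half (f : R * R -> \bar R) :=
  measurable_fun (closed_half : set plane) f /\
  forall K, K `<=` closed_half -> compact K ->
    (\int[(mu \x mu)%E]_(p in K) `|f p| < +oo)%E.

(* L^oo_loc([0,oo); L^1(R) /\ L^oo(R)) *)
Definition Linfloc_L1_Linf (f : R * R -> R) :=
  measurable_fun (open_half : set plane) f /\
  forall T : R, exists C : R, {ae mu, forall t : R, 0 < t <= T ->
    ('N[mu]_1[(fun y => (f (t, y))%:E)] <= C%:E)%E /\
    ('N[mu]_(+oo%E)[(fun y => (f (t, y))%:E)] <= C%:E)%E}.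

(* The Lebesgue integral of f over (0,oo) x R exists in [-oo,+oo]. *)
Definition integral_exists (f : R * R -> R) :=
  (\int[(mu \x mu)%E]_(p in open_half) (Num.max (f p) 0)%:E < +oo)%E \/
  (\int[(mu \x mu)%E]_(p in open_half) (Num.max (- f p) 0)%:E < +oo)%E.

End function_spaces.

(* In the field R, x / 0 = 0, which includes the convention 0 / 0 := 0. *)
Section damped_Euler.
Context {R : realType}.
Variables (alpha k gamma : R).
Local Notation mu := (@lebesgue_measure R).

Definition pressure (z : R) : R := k * z `^ gamma.
Definition dpressure (z : R) : R := k * gamma * z `^ (gamma - 1).

Definition pot (z : R) : R :=
  if gamma == 1 then k * z * ln z else k / (gamma - 1) * z `^ gamma.

(* h' and h'' in closed form, see is_derive_pot and is_derive_dpot for z > 0;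
   for gamma > 1, dpot 0 = 0 is the right derivative of h at 0. *)
Definition dpot (z : R) : R :=
  if gamma == 1 then k * (ln z + 1)
  else k * gamma / (gamma - 1) * z `^ (gamma - 1).
Definition ddpot (z : R) : R := k * gamma * z `^ (gamma - 2).

Definition rel_pressure (r rb : R) : R :=
  pressure r - pressure rb - dpressure rb * (r - rb).

(* h(r | rb). The value is +oo for negative densities, so that finiteness of
   the relative entropy includes their nonnegativity, and also for gamma = 1,
   rb = 0 < r, where h'(0) = -oo. *)
Definition rel_pot (r rb : R) : \bar R :=
  if [|| r < 0, rb < 0 | [&& gamma == 1, rb == 0 & r != 0]] then +oo%E
  else (pot r - pot rb - dpot rb * (r - rb))%:E.

(* n^2 / rho, and rho |n / rho - v|^2, are +oo where rho = 0 and n <> 0: only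
   0 / 0 is 0. *)
Definition kinetic (r m : R) : \bar R :=
  if (r == 0) && (m != 0) then +oo%E else (m ^+ 2 / r)%:E.

Definition rel_kinetic (r m v : R) : \bar R :=
  if (r == 0) && (m != 0) then +oo%E else (r * `|m / r - v| ^+ 2)%:E.

Definition rel_entropy (t : R) (rho n rhob nb : R -> R) : \bar R :=
  (\int[mu]_y ((2^-1 * expR (- t))%:E
                 * rel_kinetic (rho y) (n y) (nb y / rhob y)
               + rel_pot (rho y) (rhob y)))%E.

Record weak_solution (rho0 n0 : R -> R) (rho n : R * R -> R) : Prop := {
  ws_rho0_L1loc : locally_integrable setT rho0;
  ws_n0_L1loc : locally_integrable setT n0;
  ws_rho0_ge0 : {ae mu, forall y, 0 <= rho0 y};
  ws_rho_L1loc : L1loc_half (fun p => (rho p)%:E);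
  ws_n_L1loc : L1loc_half (fun p => (n p)%:E);
  ws_kinetic_L1loc : L1loc_half (fun p => kinetic (rho p) (n p));
  ws_pressure_L1loc : L1loc_half (fun p => (pressure (rho p))%:E);
  ws_rho_ge0 : {ae (mu \x mu)%E, forall p, closed_half p -> 0 <= rho p};
  ws_mass : forall phi, test_fun2 phi ->
    - (\int[(mu \x mu)%E]_(p in open_half)
        (Dtau phi p * rho p
         + Dy phi p * (- (p.2 / 2) * rho p + n p)
         - 2^-1 * phi p * rho p))
    = \int[mu]_y (phi (0, y) * rho0 y);
  ws_momentum : forall psi, test_fun2 psi ->
    - (\int[(mu \x mu)%E]_(p in open_half)
        (Dtau psi p * n p
         + Dy psi p * (- (p.2 / 2) * n p + n p ^+ 2 / rho p
                       + expR p.1 * pressure (rho p))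
         - psi p * expR p.1 * alpha * n p))
    = \int[mu]_y (psi (0, y) * n0 y) }.

Definition rho_hat (rhom rhop y : R) : R := if y < 0 then rhom else rhop.

(* The conditions 0 <= rho_oo and C1 (dpot \o rho_oo) make the terms
   E(.|rho_oo, 0) and h'(rho_oo)_y of the inequality meaningful; both hold for
   every C^1 function rho_oo > 0. *)
Definition total_rel_entropy_condition (rhom rhop : R) (rho0 n0 : R -> R)
    (rho n : R * R -> R) : Prop :=
  exists rho_oo : R -> R,
  [/\ C1 rho_oo,
      forall y, 0 <= rho_oo y,
      C1 (dpot \o rho_oo),
      exists2 L : R, 0 < L &
        (forall y, L < y -> rho_oo y = rhop) /\
        (forall y, y < - L -> rho_oo y = rhom)
    & forall phi : R -> R, test_fun phi -> (forall t, 0 <= t -> 0 <= phi t) ->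
      let E t := rel_entropy t (fun y => rho (t, y)) (fun y => n (t, y))
                   rho_oo (cst 0) in
      (\int[mu]_(t in `]0%R, +oo[)
         ((- derive1 phi t)%:E * E t
          + (phi t)%:E * (2^-1%:E * E t
              + \int[mu]_y (alpha%:E * kinetic (rho (t, y)) (n (t, y)))))
       <= (phi 0)%:E * rel_entropy 0%R rho0 n0 rho_oo (cst 0%R)
          + \int[mu]_(t in `]0%R, +oo[)
              ((phi t)%:E * \int[mu]_y
                 (derive1 (dpot \o rho_oo) y
                  * (y / 2 * (rho (t, y) - rho_oo y) - n (t, y)))%:E))%E].

Section residuals.
Variables (rhob nb : R * R -> R).

Definition velocity (p : R * R) : R := nb p / rhob p.

Definition residual1 (p : R * R) : R :=
  Dtau rhob p - p.2 / 2 * Dy rhob p + Dy nb p.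

Definition residual2 (p : R * R) : R :=
  Dtau nb p - p.2 / 2 * Dy nb p - 2^-1 * nb p
  + Dy (fun q => nb q ^+ 2 / rhob q) p
  + expR p.1 * (Dy (fun q => pressure (rhob q)) p + alpha * nb p).

Definition residual (p : R * R) : R :=
  velocity p * residual1 p - residual2 p.

Variables (rho n : R * R -> R).

Definition xi1 (p : R * R) : R :=
  - Dy velocity p
  * (expR (- p.1) * rho p * `|n p / rho p - velocity p| ^+ 2
     + rel_pressure (rho p) (rhob p)).

Definition xi2 (p : R * R) : R :=
  expR (- p.1) * residual p * (rho p / rhob p) * (n p / rho p - velocity p).

Definition xi3 (p : R * R) : R :=
  - (rho p - rhob p) * ddpot (rhob p) * residual1 p.

Definition xi (p : R * R) : R := xi1 p + xi2 p + xi3 p.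

End residuals.

Lemma is_derive_pressure (z : R) : 0 < z ->
  is_derive z 1 pressure (dpressure z).
Proof.
move=> z0; have d := is_derive1_powR gamma z0.
have := is_deriveZ k d; rewrite /dpressure -mulrA; exact.
Qed.

Lemma is_derive_pot (z : R) : 0 < z -> is_derive z 1 pot (dpot z).
Proof.
move=> z0; rewrite /pot /dpot; have [g1|g1] := eqVneq gamma 1.
  have d := is_deriveZ k (is_deriveM (is_derive_id z 1) (is_derive1_ln z0)).
  have E : (fun x : R => k * x * ln x) = k \*: ((id : R -> R) * @ln R).
    by apply/funext => x; rewrite -mulrA.
  rewrite E; apply: is_derive_eq.
  by rewrite /GRing.scale/= mulr1 divff ?gt_eqF// addrC.
have d := is_deriveZ (k / (gamma - 1)) (is_derive1_powR gamma z0).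
apply: is_derive_eq.
by rewrite /GRing.scale/= mulrA [X in X * _]mulrAC.
Qed.

Lemma is_derive_dpot (z : R) : 0 < z -> is_derive z 1 dpot (ddpot z).
Proof.
move=> z0; rewrite /dpot /ddpot; have [g1|g1] := eqVneq gamma 1.
  have d := is_deriveZ k
    (is_deriveD (is_derive1_ln z0) (is_derive_cst (1 : R) z 1)).
  have E : (fun x : R => k * (ln x + 1)) = k \*: (@ln R + cst 1).
    by apply/funext.
  rewrite E; apply: is_derive_eq.
  rewrite addr0 /GRing.scale/= g1 mulr1 (_ : 1 - 2 = - 1 :> R); last by ring.
  by rewrite powR_inv1 ?ltW.
have d := is_deriveZ (k * gamma / (gamma - 1)) (is_derive1_powR (gamma - 1) z0).
apply: is_derive_eq.
rewrite /GRing.scale/= mulrA divfK ?subr_eq0//.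
by rewrite (_ : gamma - 1 - 1 = gamma - 2); last by ring.
Qed.

End damped_Euler.

(* Main.v *)
(* With v = nb / rhob and w = h'(rho_oo), the relative entropy density with respect
   to (rhob, nb) is the one with respect to (rho_oo, 0) plus a gap that is affine in
   (rho, n) with coefficients depending on (rhob, nb):
     - e^(-tau) v n + (e^(-tau) v^2 / 2 - h'(rhob) + w) rho + p(rhob) - p(rho_oo).
   Testing the weak mass and momentum equations with the coefficients of rho and n in
   the gap, times phi(tau) chi(y), gives the balance of the gap, with equality;
   added to the total relative entropy condition it yields the theorem. This takes

   - testing with C^1 functions, whereas weak solutions are tested with smooth ones:
     C^1 functions are approximated by sums of translated bumps which only sample them
     at later times;
   - letting chi tend to 1: the gap and its flux are dominated by an envelope d, built
     from |y (rhob - rho_hat)|, |y nb| and the indicator of a bounded interval, times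
     1 + h(rho | rho_oo) + n^2 / rho. The envelope is bounded and integrable, and the
     total relative entropy condition, applied with a nonincreasing phi, shows that
     h(rho | rho_oo) and n^2 / rho are integrable on bounded time intervals. *)
Require Import Defs.
From HB Require Import structures.
From mathcomp Require Import all_boot all_order all_algebra.
From mathcomp Require Import all_classical all_reals all_analysis measurable_realfun.
From mathcomp Require Import ess_sup_inf ring lra.

Set Implicit Arguments.
Unset Strict Implicit.
Unset Printing Implicit Defensive.

Import Order.TTheory GRing.Theory Num.Theory.
Import numFieldNormedType.Exports.

Local Open Scope classical_set_scope.
Local Open Scope ring_scope.

(** * Lebesgue measure on the half-plane *)

Section plane_measure.
Context {R : realType}.
Local Notation mu := (@lebesgue_measure R).
Local Notation plane := (measurableTypeR R * measurableTypeR R)%type.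
Local Notation mu2 := (mu \x mu)%E.
Implicit Types (f g : R * R -> R) (F G : R * R -> \bar R).

(** Because the gap is affine in (rho, n), the weak equations give its balance as an equality, while
    the convex parts h(rho) and n^2 / rho are handled by the total relative entropy condition alone.
    This affine form rests on z h'(z) - h(z) = p(z). Two obstacles shape the rest. The background is
    C^1 only for tau > 0 and merely continuous at tau = 0, so its regularization must not look at
    earlier times. The residuals in xi contain y times the y-derivatives of the background, for
    which no decay is assumed, so xi has no integrable majorant. All that is known is that the
    integral of phi xi exists in the extended sense; since every other term of the cut-off balance
    converges, Fatou's lemma then makes phi xi integrable. The flux of the gap contains -(y / 2)
    gap, but y times the derivative of chi(y / (m + 1)) is bounded uniformly in m, so integrability
    of the gap suffices. On the vacuum, local integrability of the extended kinetic density makes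
    the set where rho = 0 and n <> 0 negligible. *)

Lemma measurable_rect (A B : set R) :
  measurable (A : set (measurableTypeR R)) ->
  measurable (B : set (measurableTypeR R)) ->
  measurable ([set p | A p.1 /\ B p.2] : set plane).
Proof. by move=> mA mB; exact: measurableX. Qed.

Lemma measurable_open_half : measurable (open_half : set plane).
Proof.
rewrite (_ : open_half = [set p : plane | `]0, +oo[%classic p.1 /\ setT p.2]).
  by apply: measurable_rect => //; exact: measurable_itv.
by apply/seteqP; split => p /=; rewrite /open_half /= in_itv/= andbT; [split|case].
Qed.

Lemma measurable_closed_half : measurable (closed_half : set plane).
Proof.
rewrite (_ : closed_half = [set p : plane | `[0, +oo[%classic p.1 /\ setT p.2]).
  by apply: measurable_rect => //; exact: measurable_itv.
by apply/seteqP; split => p /=; rewrite /closed_half /= in_itv/= andbT; [split|case].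
Qed.

(* The Borel sets of the plane are generated by rational rectangles. *)
Lemma open_measurable_plane (U : set (R * R)) : open U ->
  measurable (U : set plane).
Proof.
move=> oU.
pose rect (q : (rat * rat) * (rat * rat)) : set (R * R) :=
  [set p | `]ratr q.1.1, ratr q.1.2[%classic p.1 /\
           `]ratr q.2.1, ratr q.2.2[%classic p.2].
have mrect q : measurable (rect q : set plane).
  by apply: measurable_rect; exact: measurable_itv.
rewrite (_ : U = \bigcup_(q in [set q | rect q `<=` U]) rect q).
  rewrite bigcup_mkcond; apply: countable_bigcupT_measurable => [|q].
    exact: countableP.
  by case: ifPn.
apply/seteqP; split=> [[a b] Uab|p [q /= qU qp]]; last exact: qU.
have /nbhs_ballP[e /= e0 eU] : nbhs (a, b) U by exact: open_nbhs_nbhs.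
have [q1 /[!in_itv]/= /andP[q11 q12]] : exists q : rat, ratr q \in `]a - e, a[.
  by apply: rat_in_itvoo; rewrite ltrBlDr ltrDl.
have [q2 /[!in_itv]/= /andP[q21 q22]] : exists q : rat, ratr q \in `]a, a + e[.
  by apply: rat_in_itvoo; rewrite ltrDl.
have [q3 /[!in_itv]/= /andP[q31 q32]] : exists q : rat, ratr q \in `]b - e, b[.
  by apply: rat_in_itvoo; rewrite ltrBlDr ltrDl.
have [q4 /[!in_itv]/= /andP[q41 q42]] : exists q : rat, ratr q \in `]b, b + e[.
  by apply: rat_in_itvoo; rewrite ltrDl.
exists ((q1, q2), (q3, q4)); last by rewrite /rect /= !in_itv/= q12 q21 q32 q41.
move=> [x y]; rewrite /rect /= !in_itv/= => -[/andP[h1 h2] /andP[h3 h4]].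
apply: eU; split => /=; rewrite /ball/= ltr_norml; apply/andP; split; lra.
Qed.

(** Preimages of open intervals have open traces on [U]. Continuity is asked only at the points of
    [U], so that [f] may be arbitrary elsewhere. *)
Lemma continuous_measurable_plane (U : set (R * R)) f : open U ->
  (forall p, U p -> {for p, continuous f}) ->
  measurable_fun (U : set plane) f.
Proof.
move=> oU cf mU; apply: (measurability _ (RGenOpens.measurableE R)) => //.
move=> _ [_ [a [b ->] <-]].
apply: open_measurable_plane.
rewrite openE => p [Up /= fp]; rewrite /interior.
apply: filterI; first exact: open_nbhs_nbhs.
by apply: (cf p Up); apply: open_nbhs_nbhs; split => //; exact: interval_open.
Qed.

Lemma open_open_half : open (@open_half R).
Proof.
rewrite /open_half (_ : [set p : R * R | _] = fst @^-1` [set t : R | 0 < t]) //.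
by apply: open_comp => [p _|]; [exact: cvg_fst|exact: open_gt].
Qed.

Lemma measurable_half_section d (U : measurableType d) (F : plane -> U) (t : R) :
  measurable_fun (open_half : set plane) F -> 0 < t ->
  measurable_fun setT (fun y : measurableTypeR R => F (t, y)).
Proof.
move=> mF t0; rewrite (_ : (fun y => F (t, y)) = (F \_ open_half) \o pair t).
  apply: measurableT_comp => //.
  by apply/(measurable_restrictT F) => //; exact: measurable_open_half.
by apply/funext => y /=; rewrite patchE mem_set.
Qed.

(** The measures of the sections of a null set integrate to zero, hence vanish for almost every
    t. *)
Lemma ae_section (P : plane -> Prop) : {ae mu2, forall p, P p} ->
  {ae mu, forall t, {ae mu, forall y, P (t, y)}}.
Proof.
move=> [N [mN N0 PN]].
have mx : measurable_fun setT (mu \o xsection N).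
  exact: measurable_fun_xsection.
have : ae_eq mu setT (mu \o xsection N) (cst 0%E).
  apply/(ae_eq_integral_abs mu measurableT mx).
  by rewrite -[RHS]N0; apply: eq_integral => x _; rewrite gee0_abs.
apply: filterS => t /(_ I)/= tN0.
exists (xsection N t); split => //; first exact: measurable_xsection.
by move=> y /= ny; apply/xsectionP/PN.
Qed.

Lemma integral_half_iter0 F : 
  (\int[mu]_t \int[mu]_y (F \_ open_half) (t, y) =
   \int[mu]_(t in `]0%R, +oo[) \int[mu]_y F (t, y))%E.
Proof.
rewrite [RHS]integral_mkcond; apply: eq_integral => t _.
rewrite patchE; case: ifPn => [|/negP t0].
  rewrite inE/= in_itv/= andbT => t0.
  by apply: eq_integral => y _; rewrite patchE mem_set.
apply: integral0_eq => y _; rewrite patchE memNset// => t0'.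
by apply: t0; rewrite inE/= in_itv/= andbT.
Qed.

Lemma tonelli_half F : measurable_fun (open_half : set plane) F ->
  (forall p, open_half p -> 0 <= F p)%E ->
  (\int[mu2]_(p in open_half) F p =
   \int[mu]_(t in `]0%R, +oo[) \int[mu]_y F (t, y))%E.
Proof.
move=> mF F0; rewrite -integral_half_iter0 integral_mkcond.
rewrite (fubini_tonelli1 (F \_ (open_half : set plane)))//.
  by apply/(measurable_restrictT F) => //; exact: measurable_open_half.
by move=> p; apply: erestrict_ge0.
Qed.

(** No integrability is required: the inner integral is the difference of those of the positive and
    negative parts, each of which is measurable in t by Tonelli. *)
Lemma measurable_half_iter F : measurable_fun (open_half : set plane) F ->
  measurable_fun (`]0%R, +oo[%classic : set (measurableTypeR R)) (fun t => \int[mu]_y F (t, y))%E.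
Proof.
move=> mF; have mo := measurable_open_half.
have mr : measurable_fun setT (F \_ (open_half : set plane)).
  exact/(measurable_restrictT F).
have := emeasurable_funB
  (measurable_fun_fubini_tonelli_F (m2 := mu) _ (measurable_funepos mr) (fun p => funepos_ge0 _ p))
  (measurable_fun_fubini_tonelli_F (m2 := mu) _ (measurable_funeneg mr) (fun p => funeneg_ge0 _ p)).
move=> /(measurable_funS measurableT (@subsetT _ (`]0, +oo[%classic : set (measurableTypeR R)))).
apply: eq_measurable_fun => t; rewrite inE/= in_itv/= andbT => t0.
rewrite /fubini_F [RHS]integralE; congr (_ - _)%E; apply: eq_integral => y _.
  by rewrite !funeposE patchE mem_set.
by rewrite !funenegE patchE mem_set.
Qed.

Lemma fubini_half f : mu2.-integrable open_half (EFin \o f) ->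
  [/\ {ae mu, forall t, 0 < t -> mu.-integrable setT (fun y => (f (t, y))%:E)},
      mu.-integrable `]0%R, +oo[ (fun t => \int[mu]_y (f (t, y))%:E)%E &
      (\int[mu2]_(p in open_half) (f p)%:E =
       \int[mu]_(t in `]0%R, +oo[) \int[mu]_y (f (t, y))%:E)%E].
Proof.
move=> fi; have mo := measurable_open_half.
have fi' : mu2.-integrable setT ((EFin \o f) \_ (open_half : set plane)).
  exact/(integrable_mkcond _ mo).
split.
- have := ae_integrable1 fi'; apply: filterS => t + t0.
  apply: eq_integrable => // y _; rewrite patchE mem_set//.
- have := integrable_fubini_F fi'.
  have mI : measurable (`]0, +oo[%classic : set (measurableTypeR R)).
    exact: measurable_itv.
  move=> h; have := integrableS measurableT mI (@subsetT _ _) h.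
  apply: eq_integrable; first exact: measurable_itv.
  move=> t; rewrite inE/= in_itv/= andbT => t0.
  by apply: eq_integral => y _; rewrite patchE mem_set.
- rewrite integral_mkcond -(integral12_prod_meas1 fi').
  exact: integral_half_iter0.
Qed.

End plane_measure.

(** * Smooth functions and steps *)

Section smooth_functions.
Context {R : realType}.
Implicit Types (f g : R -> R).

(** Differentiability of order m, with the derivatives as existential witnesses, so that the product
    and affine substitution rules pass to higher order by plain induction. The last derivative may
    be discontinuous; this disappears in [smooth]. *)
Fixpoint Ck (m : nat) f : Prop := if m is m'.+1 then
  exists f', (forall x : R, is_derive x 1 f (f' x)) /\ Ck m' f' else True.

Definition smooth f := forall m, Ck m f.

Lemma is_derive_derive1 f f' : (forall x : R, is_derive x 1 f (f' x)) ->
  derive1 f = f'.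
Proof. by move=> df; apply/funext => x; rewrite derive1E; case: (df x). Qed.

Lemma CkS m f : Ck m.+1 f -> Ck m f.
Proof.
elim: m f => [//|m IH] f /= [f' [df Cf']].
by exists f'; split => //; exact: IH.
Qed.

Lemma Ck_derivable1n m f : Ck m.+1 f -> forall x, derivable (derive1n m f) x 1.
Proof.
elim: m f => [|m IH] f [f' [df Cf']] x; first by case: (df x).
by rewrite derive1Sn (is_derive_derive1 df); exact: IH.
Qed.

Lemma smooth_derive f : smooth f ->
  (forall x : R, is_derive x 1 f (derive1 f x)) /\ smooth (derive1 f).
Proof.
move=> sf; have [f' [df _]] := sf 1; rewrite (is_derive_derive1 df).
by split=> // m; have [f'' [df' +]] := sf m.+1;
   rewrite -(is_derive_derive1 df') (is_derive_derive1 df).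
Qed.

Lemma smooth_continuous f : smooth f -> continuous f.
Proof.
move=> /smooth_derive[df _] x; apply: differentiable_continuous.
by apply/derivable1_diffP; case: (df x).
Qed.

Lemma Ck_cst m (c : R) : Ck m (cst c).
Proof.
elim: m c => [//|m IH] c /=; exists (cst 0); split => [x|]; last exact: IH.
exact: is_derive_cst.
Qed.

Lemma CkD m f g : Ck m f -> Ck m g -> Ck m (fun x => f x + g x).
Proof.
elim: m f g => [//|m IH] f g /= [f' [df cf]] [g' [dg cg]].
by exists (fun x => f' x + g' x); split=> [x|]; [exact: is_deriveD|exact: IH].
Qed.

Lemma CkM m f g : Ck m f -> Ck m g -> Ck m (fun x => f x * g x).
Proof.
elim: m f g => [//|m IH] f g Cf Cg; move: (CkS Cf) (CkS Cg) => Cf0 Cg0.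
case: Cf => f' [df cf]; case: Cg => g' [dg cg].
exists (fun x => f x * g' x + g x * f' x); split=> [x|].
  exact: is_deriveM.
by apply: CkD; exact: IH.
Qed.

Lemma Ck_affine m f (a b : R) : Ck m f -> Ck m (fun x => f (a * x + b)).
Proof.
elim: m f => [//|m IH] f /= [f' [df cf]].
exists (fun x => f' (a * x + b) * a); split => [x|].
  apply: (@is_derive1_comp _ f (fun x => a * x + b)) => //.
  have := is_deriveD (is_deriveZ a (is_derive_id x 1)) (is_derive_cst b x 1).
  by move=> h; apply: is_derive_eq; rewrite addr0 /GRing.scale/= mulr1.
by apply: CkM; [exact: IH|exact: Ck_cst].
Qed.

Lemma Ck_primitive f f' : (forall x : R, is_derive x 1 f (f' x)) ->
  smooth f' -> smooth f.
Proof. by move=> df sf' [//|m]; exists f'. Qed.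

Lemma mvt f f' (a b : R) : (forall x : R, is_derive x 1 f (f' x)) -> a < b ->
  exists2 c, a < c < b & f b - f a = f' c * (b - a).
Proof.
move=> df ab; have cf x : {for x, continuous f}.
  by apply: differentiable_continuous; apply/derivable1_diffP; case: (df x).
have [c] := MVT ab (fun x _ => df x) (continuous_subspaceT cf).
by rewrite in_itv/= => cab E; exists c.
Qed.

Lemma derive_ge0_mono f f' : (forall x : R, is_derive x 1 f (f' x)) ->
  (forall x, 0 <= f' x) -> forall x y, x <= y -> f x <= f y.
Proof.
move=> df f'0 x y; rewrite le_eqVlt => /predU1P[->//|xy].
have [c _ E] := mvt df xy; rewrite -subr_ge0 E mulr_ge0// subr_ge0 ltW//.
Qed.

Lemma derive_eq0_const f f' (a : R) : (forall x : R, is_derive x 1 f (f' x)) ->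
  (forall x, a < x -> f' x = 0) -> forall x, a <= x -> f x = f a.
Proof.
move=> df f'0 x; rewrite le_eqVlt => /predU1P[->//|ax].
have [c /andP[ac _] E] := mvt df ax.
by apply/eqP; rewrite -subr_eq0 E f'0// mul0r.
Qed.

(** The classical flat function exp(-1/x), with a polynomial factor in 1/x that makes the family
    closed under differentiation. *)
Definition flat (P : {poly R}) (x : R) : R :=
  if 0 < x then P.[x^-1] * expR (- x^-1) else 0.

Lemma poly_bound (P : {poly R}) : exists2 C : R, 0 <= C & 
  forall u : R, 1 <= u -> `|P.[u]| <= C * u ^+ (size P).
Proof.
elim/poly_ind: P => [|P c [C C0 IH]].
  by exists 0 => // u u1; rewrite horner0 normr0 mul0r.
exists (C + `|c|) => [|u u1]; first by rewrite addr_ge0.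
rewrite hornerMXaddC (le_trans (ler_normD _ _))// mulrDl.
have u0 : 0 <= u by exact: le_trans u1.
have [->|P0] := eqVneq P 0.
  rewrite horner0 !mul0r !add0r size_polyC.
  have un : 1 <= u ^+ (c != 0) by rewrite exprn_ege1.
  apply: ler_wpDl; first by rewrite mulr_ge0// (le_trans ler01 un).
  by rewrite normr0 add0r; exact: ler_peMr.
rewrite size_MXaddC (negbTE P0)/= lerD//; last first.
  by rewrite ler_peMr// exprn_ege1.
by rewrite normrM (ger0_norm u0) exprSr mulrA ler_wpM2r// IH.
Qed.

Lemma flat_bound (P : {poly R}) : exists C : R, forall x : R, `|x| <= 1 ->
  `|flat P x| <= C * x ^+ 2.
Proof.
have [C C0 hC] := poly_bound P; set n := size P.
exists (C * (n.+2)`!%:R) => x; rewrite /flat; case: ifPn => [x0|_ _]; last first.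
  by rewrite normr0 mulr_ge0 ?sqr_ge0// mulr_ge0.
rewrite (ger0_norm (ltW x0)) => x1.
have u1 : 1 <= x^-1 by rewrite invf_ge1.
have u0 : 0 < x^-1 by rewrite invr_gt0.
rewrite normrM (ger0_norm (expR_ge0 _)) expRN.
(* A single term of the exponential series: n powers of x absorb the growth of P(1/x), and the two
   extra ones leave x^2. *)
have e1 : x^-1 ^+ n.+2 / (n.+2)`!%:R <= expR x^-1.
  by rewrite (le_trans _ (expR_ge1Dxn n.+1 (ltW u0)))// lerDr.
have fact0 : 0 < (n.+2)`!%:R :> R by rewrite ltr0n fact_gt0.
have {}e1 : (expR x^-1)^-1 <= (n.+2)`!%:R * x ^+ n.+2.
  rewrite -[leRHS]invrK lef_pV2 ?posrE ?expR_gt0//; last first.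
    by rewrite invr_gt0 mulr_gt0// exprn_gt0.
  by rewrite invfM mulrC -exprVn.
apply: (le_trans (ler_pM (normr_ge0 _) _ (hC _ u1) e1)).
  by rewrite invr_ge0 expR_ge0.
rewrite -/n (_ : x ^+ n.+2 = x ^+ n * x ^+ 2); last by rewrite -exprD addn2.
rewrite exprVn mulrACA mulrA -[in leLHS]mulrA [x ^- n * _]mulrA.
rewrite mulVf ?expf_neq0 ?gt_eqF// mul1r.
by [].
Qed.

Lemma is_derive0_quadratic f (C : R) : (forall x : R, `|x| <= 1 ->
  `|f x| <= C * x ^+ 2) -> is_derive (0 : R) 1 f 0.
Proof.
move=> fC.
have f0 : f 0 = 0.
  by have := fC 0; rewrite normr0 ler01 expr0n/= mulr0 normr_le0 => /(_ isT)/eqP.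
have : (fun h : R => h^-1 *: ((f \o shift 0) (h *: (1 : R)) - f 0)) @ 0^' --> (0 : R).
  apply/cvgrPdist_le => e e0; near=> h.
  have h0 : h != 0 by near: h; exact: nbhs_dnbhs_neq.
  have h1 : `|h| <= 1 by near: h; apply: dnbhs0_le.
  have h2 : `|h| <= e / (`|C| + 1).
    by near: h; apply: dnbhs0_le; rewrite divr_gt0// ltr_wpDl.
  rewrite sub0r normrN /= f0 subr0 addr0 /GRing.scale/= mulr1 normrM normfV.
  rewrite ler_pdivrMl ?normr_gt0// (le_trans (fC _ h1))//.
  rewrite -real_normK ?num_real// expr2 mulrA mulrC.
  rewrite ler_wpM2l// (le_trans (ler_wpM2r _ (ler_norm C)))//.
  rewrite mulrC (le_trans (ler_wpM2r _ h2))//.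
  rewrite -mulrA ler_piMr ?(ltW e0)// ler_pdivrMl ?ltr_wpDl// mulr1.
  by rewrite lerDl.
move=> h; apply: DeriveDef; first by apply/cvg_ex; exists 0.
exact/cvg_lim.
Unshelve. all: by end_near. Qed.

(** With u = 1/x one has d/dx = - u^2 d/du, and d/du of P(u) exp(-u) is (P' - P)(u) exp(-u). At x =
    0 the derivative is 0 by the quadratic bound. *)
Lemma is_derive_flat (P : {poly R}) (x : R) :
  is_derive x 1 (flat P) (flat ('X ^+ 2 * (P - P^`())) x).
Proof.
have [x0|x0|<-] := ltgtP 0 x.
- suff h : is_derive x (1 : R) (fun z : R => P.[z^-1] * expR (- z^-1))
      (flat ('X ^+ 2 * (P - P^`())) x).
    apply: near_eq_is_derive h.
    by near=> z; rewrite /flat ifT//; near: z; exact: lt_nbhsr.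
  have dV := is_deriveV (lt0r_neq0 x0) (is_derive_id x (1 : R)).
  have d1 := is_derive1_comp (is_derive_poly P x^-1) dV.
  have d2 := is_derive1_comp (g := fun z : R => - z^-1)
    (is_derive_expR (- x^-1)) (is_deriveN dV).
  apply: (is_derive_eq (is_deriveM d1 d2)).
  rewrite /flat x0 /GRing.scale /= hornerM hornerXn hornerD hornerN.
  by rewrite -exprVn; ring.
- rewrite {2}/flat ltNge (ltW x0)/=.
  apply: near_eq_is_derive (is_derive_cst (0 : R) x (1 : R)).
  near=> z; rewrite /flat ifF//; apply/negbTE; rewrite -leNgt ltW//.
  by near: z; exact: lt_nbhsl.
- rewrite [X in is_derive _ _ _ X]/flat ltxx.
  by have [C] := flat_bound P; exact: is_derive0_quadratic.
Unshelve. all: by end_near. Qed.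

Lemma smooth_flat P : smooth (flat P).
Proof.
move=> m; elim: m P => [//|m IH] P.
by exists (flat ('X ^+ 2 * (P - P^`()))); split; [exact: is_derive_flat|exact: IH].
Qed.

(** Integrating from -oo instead of 0 yields the vanishing for x <= 0 and the derivative at every
    point from one formula. Integrability near -oo holds because [b] vanishes there. *)
Lemma primitive (b : R -> R) : continuous b -> (forall x : R, x <= 0 -> b x = 0) ->
  exists F : R -> R,
    (forall x : R, is_derive x 1 F (b x)) /\ (forall x : R, x <= 0 -> F x = 0).
Proof.
move=> cb b0.
exists (fun x => \int[lebesgue_measure]_(t in `]-oo, x]) b t).
split=> [x|x x0]; last first.
  rewrite (@eq_Rintegral _ _ _ _ _ (cst 0)); last first.
    by move=> t; rewrite inE/= in_itv/= => tx; rewrite b0// (le_trans tx).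
  by rewrite Rintegral_cst ?mul0r//; exact: measurable_itv.
have ib : lebesgue_measure.-integrable [set` `]-oo, x + 1]] (EFin \o b).
  have : lebesgue_measure.-integrable `[0, x + 1] (EFin \o b).
    apply: continuous_compact_integrable; first exact: segment_compact.
    exact: continuous_subspaceT.
  rewrite (_ : `[0, x + 1]%classic = `]-oo, x + 1] `&` `[0, x + 1]); last first.
    by rewrite setIidr// => t /=; rewrite !in_itv/= => /andP[].
  have mI : measurable (`]-oo, x + 1]%classic : set (measurableTypeR R)).
    exact: measurable_itv.
  have mJ : measurable (`[0, x + 1]%classic : set (measurableTypeR R)).
    exact: measurable_itv.
  move=> /(integrable_restrict _ mJ mI).
  apply: eq_integrable; first exact: measurable_itv.
  move=> t; rewrite inE/= in_itv/= patchE => tx.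
  case: ifPn => // /negP; rewrite inE/= in_itv/= tx andbT => /negP; rewrite -ltNge.
  by move=> t0; rewrite b0// ltW.
have [||d E] := @continuous_FTC1 R b -oo%O x (x + 1) _ ib _ (cb x).
- lra.
- exact: ltNyr.
rewrite derive1E in E; exact: DeriveDef.
Qed.

(* [T] is a smooth step and [A x = T x - T (x - 1)] a bump whose integer
   translates add up to 1; the same holds for [S x - S (x - 1)], the derivative
   of which is the difference quotient [A x - A (x - 1)]. *)
Lemma smooth_step : exists T S : R -> R,
  [/\ (forall m, Ck m S), forall x : R, is_derive x 1 S (T x - T (x - 1)),
    [/\ forall x y, x <= y -> T x <= T y, forall x, x <= 0 -> T x = 0 &
        forall x, 1 <= x -> T x = 1] &
    [/\ forall x y, x <= y -> S x <= S y, forall x, x <= 0 -> S x = 0 &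
        forall x, 2 <= x -> S x = 1]].
Proof.
(* The product of exp(-1/x) and exp(-1/(1 - x)), positive exactly on (0, 1); [T] is its normalized
   primitive. *)
pose b x := flat 1 x * flat 1 (- 1 * x + 1).
have sb : smooth b.
  by move=> m; apply: CkM; [|apply: (Ck_affine (-1) 1)]; exact: smooth_flat.
have b_ge0 x : 0 <= b x.
  by rewrite /b /flat mulr_ge0//; case: ifP => // _;
     rewrite mulr_ge0 ?expR_ge0// hornerE.
have b0 x : x <= 0 -> b x = 0.
  by move=> x0; rewrite /b /flat ltNge x0/= mul0r.
have b1 x : 1 <= x -> b x = 0.
  move=> x1; rewrite /b {2}/flat ifF ?mulr0//.
  by apply/negbTE; rewrite -leNgt; lra.
have [F [dF F0]] := primitive (smooth_continuous sb) b0.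
have F1 : 0 < F 1.
  have [c /andP[c0 c1]] := mvt dF ltr01.
  rewrite (F0 0)// !subr0 => ->; rewrite mulr1 /b /flat c0 ifT; last lra.
  by rewrite !hornerC !mul1r mulr_gt0 ?expR_gt0.
pose T x := (F 1)^-1 * F x.
have dT (x : R) : is_derive x 1 T ((F 1)^-1 * b x) by exact: is_deriveZ.
have sT : smooth T.
  apply: Ck_primitive dT _ => m.
  by apply: (@CkM m (cst (F 1)^-1) b); [exact: Ck_cst|exact: sb].
have Tmono x y : x <= y -> T x <= T y.
  by apply: (derive_ge0_mono dT) => z; rewrite mulr_ge0// invr_ge0 ltW.
have T0 x : x <= 0 -> T x = 0 by move=> x0; rewrite /T (F0 x) ?mulr0.
have T1 x : 1 <= x -> T x = 1.
  move=> x1; rewrite (derive_eq0_const dT _ x1) ?/T ?mulVf ?gt_eqF//.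
  by move=> z z1; rewrite b1 ?mulr0 ?ltW.
have sA : smooth (fun x => T x - T (x - 1)).
  move=> m; apply: CkD; first exact: sT.
  rewrite (_ : (fun x => _) = (fun x => (cst (-1)) x * T (1 * x + (-1)))); last first.
    by apply/funext => x /=; rewrite mulN1r mul1r.
  by apply: CkM; [exact: Ck_cst|apply: Ck_affine; exact: sT].
have [|S [dS S0]] := primitive (smooth_continuous sA).
  by move=> x x0; rewrite !T0 ?subr0//; lra.
have dS1 (x : R) : is_derive x 1 (fun x => S (x - 1)) (T (x - 1) - T (x - 1 - 1)).
  have d1 := is_deriveB (is_derive_id x (1 : R)) (is_derive_cst (1 : R) x (1 : R)).
  have d2 := is_derive1_comp (g := fun x : R => x - 1) (dS (x - 1)) d1.
  by apply: (is_derive_eq d2); rewrite subr0 mulr1.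
(* On [1, 2] the function S(x) + S(x - 1) has derivative T(x) - T(x - 2) = 1, and it equals S(1) at
   x = 1 and S(2) + S(1) at x = 2. *)
have S2 : S 2 = 1.
  have [|c /andP[c1 c2]] := @mvt (fun x => S x + S (x - 1)) _ 1 2
    (fun x => is_deriveD (dS x) (dS1 x)); first lra.
  rewrite (_ : 2 - 1 = 1); last by ring.
  rewrite mulr1 subrr (S0 0)// addr0 addrK => ->.
  by rewrite (T1 c) ?(T0 (c - 1 - 1)); [ring|lra|lra].
exists T, S; split => //; last split => //.
- exact: Ck_primitive dS sA.
- by apply: (derive_ge0_mono dS) => x; rewrite subr_ge0 Tmono// gerBl.
- move=> x x2; rewrite (derive_eq0_const dS _ x2)// => z z2.
  by rewrite !T1 ?subrr//; lra.
Qed.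

End smooth_functions.

(** * Quasi-interpolation by smooth bumps *)

(* [Q m f] samples [f] at the nodes [i / (m + 1) - M] lying in
   [t, t + 3 / (m + 1)]: only values to the right of [t] are used, so that
   functions defined for positive times only can be regularized up to time 0. *)
Section quasi_interpolation.
Context {R : realType}.
Variables (T S : R -> R).
Hypothesis T_mono : forall x y, x <= y -> T x <= T y.
Hypothesis T0 : forall x, x <= 0 -> T x = 0.
Hypothesis T1 : forall x, 1 <= x -> T x = 1.
Hypothesis S_smooth : smooth S.
Hypothesis S_derive : forall x : R, is_derive x 1 S (T x - T (x - 1)).
Hypothesis S_mono : forall x y, x <= y -> S x <= S y.
Hypothesis S0 : forall x, x <= 0 -> S x = 0.
Hypothesis S1 : forall x, 2 <= x -> S x = 1.
Variable M : nat.
Implicit Types (m i : nat) (f : R -> R) (t : R).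

Definition bump i (z : R) : R := S (i%:R - z) - S (i%:R - z - 1).
Definition dbump i (z : R) : R := T (i%:R - z) - T (i%:R - z - 1).
Definition node m i : R := i%:R / m.+1%:R - M%:R.
(** The grid coordinate: it sends [node m i] to the integer i. *)
Definition zoom m t : R := m.+1%:R * (M%:R + t).
Definition size_grid m := (2 * (m.+1 * M))%N.
Definition Q m f t : R := \sum_(i < size_grid m) f (node m i) * bump i (zoom m t).
(** The t-derivative of [bump i (zoom m t)]. Since S' is a difference of values of [T], it is a
    difference of two neighbouring [dbump], ready for summation by parts. *)
Definition dbump2 m i t : R :=
  - m.+1%:R * (dbump i (zoom m t) - dbump i (zoom m t + 1)).
Definition Qd m f t : R := \sum_(i < size_grid m) f (node m i) * dbump2 m i t.

Lemma sum_shift (F : R -> R) (z : R) n :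
  \sum_(i < n) (F (i%:R - z) - F (i%:R - z - 1)) = F (n%:R - 1 - z) - F (- 1 - z).
Proof.
elim: n => [|n IH]; first by rewrite big_ord0 sub0r subrr.
rewrite big_ord_recr/= IH -(natr1 n).
rewrite (_ : n%:R - z - 1 = n%:R - 1 - z); last by ring.
by rewrite (_ : n%:R + 1 - 1 - z = n%:R - z); ring.
Qed.

Lemma T_ge0 x : 0 <= T x.
Proof. by have [x0|x0] := leP x 0; [rewrite T0|rewrite -(T0 (lexx 0)) T_mono ?ltW]. Qed.

Lemma T_le1 x : T x <= 1.
Proof. by have [x0|x0] := leP 1 x; [rewrite T1|rewrite -(T1 (lexx 1)) T_mono ?ltW]. Qed.

Lemma S_ge0 x : 0 <= S x.
Proof. by have [x0|x0] := leP x 0; [rewrite S0|rewrite -(S0 (lexx 0)) S_mono ?ltW]. Qed.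

Lemma S_le1 x : S x <= 1.
Proof. by have [x0|x0] := leP 2 x; [rewrite S1|rewrite -(S1 (lexx 2)) S_mono ?ltW]. Qed.

Lemma bump_ge0 i z : 0 <= bump i z.
Proof. by rewrite subr_ge0 S_mono// gerBl. Qed.

Lemma dbump_ge0 i z : 0 <= dbump i z.
Proof. by rewrite subr_ge0 T_mono// gerBl. Qed.

Lemma sum_bump_le1 n z : \sum_(i < n) bump i z <= 1.
Proof. by rewrite (sum_shift S) lerBlDr (le_trans (S_le1 _))// lerDl S_ge0. Qed.

Lemma sum_dbump_le1 n z : \sum_(i < n) dbump i z <= 1.
Proof. by rewrite (sum_shift T) lerBlDr (le_trans (T_le1 _))// lerDl T_ge0. Qed.

Lemma bump_supp i z : ~~ (0 < i%:R - z < 3) -> bump i z = 0.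
Proof.
rewrite negb_and -!leNgt /bump => /orP[h|h]; first by rewrite !S0 ?subrr//; lra.
by rewrite !S1 ?subrr//; lra.
Qed.

Lemma dbump_supp i z : ~~ (0 < i%:R - z < 2) -> dbump i z = 0.
Proof.
rewrite negb_and -!leNgt /dbump => /orP[h|h]; first by rewrite !T0 ?subrr//; lra.
by rewrite !T1 ?subrr//; lra.
Qed.

Lemma ltS0 m : 0 < m.+1%:R :> R. Proof. by rewrite ltr0n. Qed.

Lemma node_zoom m i t : node m i = t + (i%:R - zoom m t) / m.+1%:R.
Proof.
rewrite /node /zoom mulrBl [_ * (_ + _)]mulrC mulfK ?gt_eqF ?ltS0//.
by ring.
Qed.

Lemma node_next m i : node m i.+1 = node m i + m.+1%:R^-1.
Proof. by rewrite /node -(natr1 i); ring. Qed.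

Lemma node_in m i t (b : R) : 0 < i%:R - zoom m t < b ->
  t < node m i < t + b / m.+1%:R.
Proof.
move=> /andP[h1 h2]; rewrite (node_zoom m i t) ltrDl ltrD2l.
by rewrite divr_gt0 ?ltS0// ltr_pM2r// invr_gt0 ltS0.
Qed.

(** Three grid cells to the right of t still lie inside the grid, so that the telescoping sums of
    bumps see both plateaus of [S] and [T]. *)
Lemma zoom_room m t : - M%:R <= t -> t + 3 <= M%:R ->
  0 <= zoom m t /\ 3 <= (size_grid m)%:R - zoom m t.
Proof.
move=> t1 t2; have m0 := ltS0 m.
have m1 : 1 <= m.+1%:R :> R by rewrite ler1n.
rewrite /zoom /size_grid; split; first by rewrite mulr_ge0//; lra.
have h : 1 * 3 <= m.+1%:R * (M%:R - t) by rewrite ler_pM//; lra.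
by rewrite !natrM; lra.
Qed.

Lemma sum_bump m t : - M%:R <= t -> t + 3 <= M%:R ->
  \sum_(i < size_grid m) bump i (zoom m t) = 1.
Proof.
move=> t1 t2; have [h1 h2] := zoom_room m t1 t2.
by rewrite (sum_shift S) [X in _ - X]S0 ?subr0 ?S1//; lra.
Qed.

Lemma sum_dbump m t : - M%:R <= t -> t + 3 <= M%:R ->
  \sum_(i < size_grid m) dbump i (zoom m t) = 1.
Proof.
move=> t1 t2; have [h1 h2] := zoom_room m t1 t2.
by rewrite (sum_shift T) [X in _ - X]T0 ?subr0 ?T1//; lra.
Qed.

Lemma weighted_sum_bound n (w a : nat -> R) (C : R) :
  (forall i, 0 <= w i) -> \sum_(i < n) w i <= 1 -> 0 <= C ->
  (forall i, w i != 0 -> `|a i| <= C) -> `|\sum_(i < n) a i * w i| <= C.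
Proof.
move=> w0 w1 C0 aC.
apply: (le_trans (ler_norm_sum _ _ _)).
apply: (@le_trans _ _ (\sum_(i < n) C * w i)).
  apply: ler_sum => i _; rewrite normrM (ger0_norm (w0 _)).
  have [->|wi] := eqVneq (w i) 0; first by rewrite !mulr0.
  by rewrite ler_wpM2r// aC.
by rewrite -mulr_sumr ler_piMr.
Qed.

Lemma weighted_sum_dist n (w a : nat -> R) (c C : R) :
  (forall i, 0 <= w i) -> \sum_(i < n) w i = 1 -> 0 <= C ->
  (forall i, w i != 0 -> `|a i - c| <= C) -> `|\sum_(i < n) a i * w i - c| <= C.
Proof.
move=> w0 w1 C0 aC.
rewrite (_ : _ - c = \sum_(i < n) (a i - c) * w i); last first.
  rewrite -[in LHS](mulr1 c) -w1 mulr_sumr -sumrB.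
  by apply: eq_bigr => i _; rewrite mulrBl.
by apply: (@weighted_sum_bound n w (fun i => a i - c)) => //; rewrite w1.
Qed.

Definition slope m f i : R := (f (node m i.+1) - f (node m i)) * m.+1%:R.

(** Summation by parts moves the difference from the bumps to the samples of [f]; the boundary terms
    vanish with [f] at the end nodes. The derivative of the quasi-interpolant thus becomes a
    weighted mean of difference quotients of [f]. *)
Lemma QdE m f t : f (node m 0) = 0 -> f (node m (size_grid m)) = 0 ->
  Qd m f t = \sum_(i < size_grid m) slope m f i * dbump i (zoom m t).
Proof.
move=> f0 fn; rewrite /Qd /slope /dbump2.
set n := size_grid m in fn *; set z := zoom m t.
have dbumpS i : dbump i.+1 (z + 1) = dbump i z.
  by rewrite /dbump -(natr1 i); congr (T _ - T _); ring.
pose D i := f (node m i) * m.+1%:R * dbump i (z + 1).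
apply/eqP; rewrite -subr_eq0 -sumrB.
rewrite (eq_bigr (fun i : 'I_n => - (D i.+1 - D i))); last first.
  by move=> i _; rewrite /D dbumpS; ring.
rewrite sumrN -(big_mkord predT (fun i => D i.+1 - D i)) telescope_sumr//.
by rewrite /D f0 fn !mul0r subrr oppr0.
Qed.

Lemma Q_bound m f t (C : R) : 0 <= C ->
  (forall i, t < node m i -> `|f (node m i)| <= C) -> `|Q m f t| <= C.
Proof.
move=> C0 fC; apply: (@weighted_sum_bound _ (fun i => bump i (zoom m t)) (fun i => f (node m i))) => //.
- by move=> i; exact: bump_ge0.
- exact: sum_bump_le1.
- move=> i bi; apply: fC.
  have : 0 < i%:R - zoom m t < 3 by apply: contraNT bi => /bump_supp/eqP.
  by move=> /(node_in (m := m))/andP[].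
Qed.

Lemma Qd_bound m f t (C : R) : 0 <= C ->
  f (node m 0) = 0 -> f (node m (size_grid m)) = 0 ->
  (forall i, t < node m i -> `|slope m f i| <= C) -> `|Qd m f t| <= C.
Proof.
move=> C0 f0 fn fC; rewrite QdE//; apply: (@weighted_sum_bound _ (fun i => dbump i (zoom m t)) (slope m f)) => //.
- by move=> i; exact: dbump_ge0.
- exact: sum_dbump_le1.
- move=> i bi; apply: fC.
  have : 0 < i%:R - zoom m t < 2 by apply: contraNT bi => /dbump_supp/eqP.
  by move=> /(node_in (m := m))/andP[].
Qed.

Lemma Q_supp m f t : (forall x, t < x -> x < t + 3 -> f x = 0) -> Q m f t = 0.
Proof.
move=> f0; apply: big1 => i _.
have [/(node_in (m := m))/andP[h1 h2]|/bump_supp ->] :=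
  boolP (0 < (nat_of_ord i)%:R - zoom m t < 3); last by rewrite mulr0.
rewrite f0 ?mul0r// (lt_le_trans h2)// lerD2l ler_pdivrMr ?ltS0//.
by rewrite ler_peMr// ler1n.
Qed.

Lemma Qd_supp m f t : f (node m 0) = 0 -> f (node m (size_grid m)) = 0 ->
  (forall x, t < x -> x < t + 3 -> f x = 0) -> Qd m f t = 0.
Proof.
move=> f0 fn f3; rewrite QdE//; apply: big1 => i _.
have [/(node_in (m := m))/andP[h1 h2]|/dbump_supp ->] :=
  boolP (0 < (nat_of_ord i)%:R - zoom m t < 2); last by rewrite mulr0.
have m1 : m.+1%:R^-1 <= 1 :> R by rewrite invf_le1 ?ltS0// ler1n.
have m0 : 0 < m.+1%:R^-1 :> R by rewrite invr_gt0 ltS0.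
rewrite /slope node_next; move: (m.+1%:R^-1) m1 m0 h2 => u m1 m0 h2.
by rewrite !f3 ?subrr ?mul0r//; lra.
Qed.

Lemma eventually_small (b e : R) : 0 < b -> 0 < e ->
  \forall m \near \oo, b / m.+1%:R < e.
Proof.
move=> b0 e0; have eb : 0 < e / b by rewrite divr_gt0.
near=> m; rewrite mulrC -ltr_pdivlMr//; near: m.
exact: (near_infty_natSinv_lt (PosNum eb)).
Unshelve. all: by end_near. Qed.

Hypothesis M3 : (3 <= M)%N.

Lemma node_size m : node m (size_grid m) = M%:R.
Proof.
rewrite /node /size_grid !natrM mulrCA mulrAC divff ?gt_eqF ?ltS0// mul1r.
by ring.
Qed.

Lemma node0 m : node m 0 = - M%:R.
Proof. by rewrite /node mul0r sub0r. Qed.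

(** [Q m f t] is a convex combination of values of [f] at points in (t, t + 3 / (m + 1)), so a right
    limit at t is enough. Where t is too close to the ends of the grid, or beyond them, all samples
    vanish. *)
Lemma Q_cvg f t : (forall x, M%:R - 3 <= `|x| -> f x = 0) ->
  f x @[x --> t^'+] --> f t -> Q m f t @[m --> \oo] --> f t.
Proof.
move=> f0 ft.
have M3' : 3 <= M%:R :> R by rewrite (ler_nat _ 3).
have [t1|t1] := ltP t (- M%:R).
  rewrite (_ : (fun m => _) = cst 0).
    rewrite f0; first exact: cvg_cst.
    by rewrite ler_normr; apply/orP; right; lra.
  apply/funext => m; apply: Q_supp => x tx x3; apply: f0.
  by rewrite ler_normr; apply/orP; right; lra.
have [t2|t2] := ltP M%:R (t + 3).
  rewrite (_ : (fun m => _) = cst 0).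
    rewrite f0; first exact: cvg_cst.
    by rewrite ler_normr; apply/orP; left; lra.
  apply/funext => m; apply: Q_supp => x tx x3; apply: f0.
  by rewrite ler_normr; apply/orP; left; lra.
apply/cvgrPdist_le => e e0.
move/cvgrPdist_le : ft => /(_ e e0); rewrite /at_right near_withinE.
move=> /nbhs_ballP[d /= d0 fd].
have : \forall m \near \oo, 3 / m.+1%:R < d by exact: eventually_small.
apply: filterS => m md; rewrite distrC.
apply: (@weighted_sum_dist _ (fun i => bump i (zoom m t)) (fun i => f (node m i))) => //; last 2 first.
- exact: ltW.
- move=> i bi.
  have : 0 < i%:R - zoom m t < 3 by apply: contraNT bi => /bump_supp/eqP.
  move=> /(node_in (m := m))/andP[h1 h2]; rewrite distrC; apply: fd => //.
  rewrite /ball /= distrC ger0_norm ?subr_ge0 ?(ltW h1)// ltrBlDl.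
  by apply: (lt_trans h2); rewrite ltrD2l.
- by move=> i; exact: bump_ge0.
- exact: sum_bump.
Qed.

(** By [QdE] this is a convex combination of slopes over cells lying strictly to the right of t. The
    slopes do not start at t, whence the hypothesis on all pairs a < b near t rather than on a
    one-sided derivative. *)
Lemma Qd_cvg f t (d : R) : (forall x, M%:R - 3 <= `|x| -> f x = 0) ->
  (M%:R - 3 <= `|t| -> d = 0) ->
  (forall e, 0 < e -> exists2 r, 0 < r & forall a b, t < a -> a < b ->
     b < t + r -> `|(f b - f a) / (b - a) - d| <= e) ->
  Qd m f t @[m --> \oo] --> d.
Proof.
move=> f0 d0 ft.
have M3' : 3 <= M%:R :> R by rewrite (ler_nat _ 3).
have fn0 m : f (node m 0) = 0 by rewrite node0 f0// normrN ger0_norm//; lra.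
have fn m : f (node m (size_grid m)) = 0.
  by rewrite node_size f0// ger0_norm//; lra.
have [t1|t1] := ltP t (- M%:R).
  rewrite (_ : (fun m => _) = cst 0).
    rewrite d0; first exact: cvg_cst.
    by rewrite ler_normr; apply/orP; right; lra.
  apply/funext => m; apply: Qd_supp => // x tx x3; apply: f0.
  by rewrite ler_normr; apply/orP; right; lra.
have [t2|t2] := ltP M%:R (t + 3).
  rewrite (_ : (fun m => _) = cst 0).
    rewrite d0; first exact: cvg_cst.
    by rewrite ler_normr; apply/orP; left; lra.
  apply/funext => m; apply: Qd_supp => // x tx x3; apply: f0.
  by rewrite ler_normr; apply/orP; left; lra.
apply/cvgrPdist_le => e e0; have [r r0 fr] := ft e e0.
have : \forall m \near \oo, 3 / m.+1%:R < r by exact: eventually_small.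
apply: filterS => m md; rewrite distrC QdE//.
apply: (@weighted_sum_dist _ (fun i => dbump i (zoom m t)) (slope m f)) => //; last 2 first.
- exact: ltW.
- move=> i bi.
  have : 0 < i%:R - zoom m t < 2 by apply: contraNT bi => /dbump_supp/eqP.
  move=> /(node_in (m := m))/andP[h1 h2].
  have m0 : 0 < m.+1%:R^-1 :> R by rewrite invr_gt0 ltS0.
  rewrite /slope node_next.
  have := fr (node m i) (node m i + m.+1%:R^-1).
  rewrite [_ + _ - node m i]addrAC subrr add0r invrK.
  by move: (m.+1%:R^-1) m0 h2 md => u m0 h2 md; apply => //; lra.
- by move=> i; exact: dbump_ge0.
- exact: sum_dbump.
Qed.

Lemma Ck_bump m i k : Ck k (fun t => bump i (zoom m t)).
Proof.
rewrite (_ : (fun t => _) = (fun t =>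
  S (- m.+1%:R * t + (i%:R - m.+1%:R * M%:R)) + cst (-1) t *
  S (- m.+1%:R * t + (i%:R - m.+1%:R * M%:R - 1)))).
  apply: CkD; first exact: Ck_affine.
  by apply: CkM; [exact: Ck_cst|exact: Ck_affine].
by apply/funext => t; rewrite /bump /zoom/= mulN1r; congr (S _ - S _); ring.
Qed.

Lemma is_derive_bump m i (t : R) :
  is_derive t 1 (fun t => bump i (zoom m t)) (dbump2 m i t).
Proof.
have d0 (c : R) : is_derive t (1 : R) (fun t : R => c - zoom m t) (- m.+1%:R).
  have d := is_deriveB (is_derive_cst c t (1 : R)) (is_deriveZ (m.+1%:R : R)
    (is_deriveD (is_derive_cst (M%:R : R) t (1 : R)) (is_derive_id t (1 : R)))).
  by apply: (is_derive_eq d); rewrite sub0r add0r /GRing.scale/= mulr1.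
have d1 := is_derive1_comp (g := fun t => i%:R - zoom m t)
    (S_derive (i%:R - zoom m t)) (d0 i%:R).
have d2 := is_derive1_comp (g := fun t => i%:R - 1 - zoom m t)
    (S_derive (i%:R - 1 - zoom m t)) (d0 (i%:R - 1)).
have d3 := is_deriveB d1 d2.
have E : (fun t => bump i (zoom m t)) = (S \o (fun t => i%:R - zoom m t)) -
    (S \o (fun t => i%:R - 1 - zoom m t)).
  by apply/funext => s; rewrite /bump/= fctE/=; congr (_ - S _); ring.
rewrite E; apply: (is_derive_eq d3); rewrite /dbump2 /dbump.
rewrite (_ : i%:R - 1 - zoom m t = i%:R - zoom m t - 1); last by ring.
rewrite (_ : i%:R - (zoom m t + 1) = i%:R - zoom m t - 1); last by ring.
by ring.
Qed.

Lemma bump_compact m i : exists N : R, forall t, N <= `|t| ->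
  bump i (zoom m t) = 0.
Proof.
exists (M%:R + (i%:R + 3) / m.+1%:R) => t Nt; apply: bump_supp.
have m0 := ltS0 m.
have i0 : 0 <= i%:R :> R by [].
have M0 : 0 <= M%:R :> R by [].
have q0 : 0 <= (i%:R + 3) / m.+1%:R :> R by rewrite divr_ge0// addr_ge0.
apply/negP => /andP[h1 h2].
have q : (i%:R + 3) / m.+1%:R * m.+1%:R = i%:R + 3 :> R.
  by rewrite divfK ?gt_eqF.
have KM : 0 <= m.+1%:R * M%:R :> R by rewrite mulr_ge0.
move: h1 h2 Nt; rewrite /zoom.
move: (_ / _) q q0 => r q q0; move: (m.+1%:R) m0 q KM => K m0 q KM h1 h2.
rewrite ler_normr => /orP[Nt|Nt].
  have : 0 <= K * (t - M%:R - r) by rewrite mulr_ge0 ?(ltW m0)//; lra.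
  lra.
have : 0 <= K * (- t - M%:R - r) by rewrite mulr_ge0 ?(ltW m0)//; lra.
lra.
Qed.

End quasi_interpolation.

(** * Real analysis: mean value theorem, slopes, dominated convergence *)

Section real_tools.
Context {R : realType}.
Implicit Types f : R -> R.

Lemma derivable_cvg f (x d : R) : is_derive x 1 f d -> f z @[z --> x] --> f x.
Proof.
by move=> df; apply: differentiable_continuous; apply/derivable1_diffP; case: df.
Qed.

Lemma mvt_on f f' (a b : R) :
  (forall x : R, a <= x <= b -> is_derive x 1 f (f' x)) -> a < b ->
  exists2 c, a < c < b & f b - f a = f' c * (b - a).
Proof.
move=> df ab.
have df' (x : R) : x \in `]a, b[ -> is_derive x 1 f (f' x).
  by rewrite in_itv/= => /andP[ax xb]; apply: df; rewrite !ltW.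
have cf : {within `[a, b], continuous f}.
  apply: derivable_within_continuous => x; rewrite in_itv/= => xab.
  by case: (df x xab).
by have [c] := MVT ab df' cf; rewrite in_itv/= => cab E; exists c.
Qed.

(** By the mean value theorem a slope over (a, b) is a value of [f'] in between. Differentiability
    is used only to the right of t; this is the form in which [Qd_cvg] consumes it. *)
Lemma slope_cvg f f' (t : R) :
  (\forall x \near t^'+, is_derive (x : R) 1 f (f' x)) ->
  f' x @[x --> t^'+] --> f' t ->
  forall e, 0 < e -> exists2 r, 0 < r & forall a b, t < a -> a < b ->
     b < t + r -> `|(f b - f a) / (b - a) - f' t| <= e.
Proof.
move=> df cf e e0.
move/cvgrPdist_le : cf => /(_ e e0) /(filterI df); rewrite /at_right /within/=.
move=> /nbhs_ballP[r /= r0 fr]; exists r => // a b ta ab br.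
have dx x : t < x -> x < t + r -> ball t r x.
  move=> h1 h2; rewrite /ball /= distrC ger0_norm ?subr_ge0 ?ltW//; lra.
have [x /andP[ax xb]|c /andP[ac cb] ->//] := @mvt_on f f' a b _ ab.
  by have [] // := fr x (dx x (lt_le_trans ta ax) (le_lt_trans xb br)) (lt_le_trans ta ax).
rewrite mulfK ?subr_eq0 ?gt_eqF// distrC.
have tc := lt_trans ta ac.
by have [] := fr c (dx c tc (lt_trans cb br)) tc.
Qed.

Lemma slope_bound f f' (C a b : R) : a < b ->
  (forall x : R, a <= x <= b -> is_derive x 1 f (f' x)) ->
  (forall x, a <= x <= b -> `|f' x| <= C) ->
  `|(f b - f a) / (b - a)| <= C.
Proof.
move=> ab df fC; have [c /andP[ac cb] ->] := mvt_on df ab.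
by rewrite mulfK ?subr_eq0 ?gt_eqF// fC// !ltW.
Qed.

Lemma is_derive_eq0 f (t d : R) : (\forall x \near t, f x = 0) ->
  is_derive t 1 f d -> d = 0.
Proof.
move=> f0 df; have h : is_derive t 1 f 0.
  apply: near_eq_is_derive (is_derive_cst (0 : R) t (1 : R)).
  by apply: filterS f0 => x ->.
by rewrite -(@derive_val _ _ _ _ _ _ _ df) (@derive_val _ _ _ _ _ _ _ h).
Qed.

Lemma continuous_bounded f (N : R) : continuous f ->
  exists2 C : R, 0 <= C & forall x, `|x| <= N -> `|f x| <= C.
Proof.
move=> cf; have [N0|N0] := ltP N 0.
  by exists 0 => // x xN; have := le_lt_trans xN N0; rewrite normr_lt0.
have NN : - N <= N by rewrite ge0_cp.
have cf' : {within `[- N, N], continuous (fun x => `|f x|)}.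
  apply: continuous_subspaceT => x.
  by apply: (continuous_comp (cf x)); exact: norm_continuous.
have [c _ hc] := EVT_max NN cf'.
by exists `|f c| => // x xN; apply: hc; rewrite in_itv/= -ler_norml.
Qed.

End real_tools.

Section Rdominated.
Local Open Scope ereal_scope.
Context d (T : measurableType d) (R : realType) (mu : {measure set T -> \bar R}).

Lemma Rdominated_convergence (D : set T) (mD : measurable D)
    (F_ : nat -> T -> R) (F G : T -> R) :
  (forall n, measurable_fun D (F_ n)) ->
  mu.-integrable D (EFin \o G) ->
  (forall n x, D x -> (`|F_ n x| <= G x)%R) ->
  (forall x, D x -> F_ n x @[n --> \oo] --> F x) ->
  mu.-integrable D (EFin \o F) /\
  (\int[mu]_(x in D) F_ n x)%R @[n --> \oo] --> (\int[mu]_(x in D) F x)%R.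
Proof.
move=> mF iG FG cF.
have mF' : measurable_fun D F by exact: measurable_fun_cvg mF cF.
have [] := @dominated_convergence _ _ _ mu D mD (fun n => EFin \o F_ n)
  (EFin \o F) (EFin \o G).
- by move=> n; exact/measurable_EFinP.
- exact/measurable_EFinP.
- by apply/aeW => x Dx; apply: cvg_EFin; [exact: nearW|exact: cF].
- exact: iG.
- by apply/aeW => x n Dx /=; rewrite lee_fin; exact: FG.
move=> iF _ cI; split => //; apply: fine_cvg.
rewrite /Rintegral fineK//; exact: integrable_fin_num.
Qed.

End Rdominated.

Section Rintegrable.
Context d (T : measurableType d) (R : realType) (mu : {measure set T -> \bar R}).
Variables (D : set T) (mD : measurable D).
Implicit Types F G : T -> R.

Lemma integrable_RZ (c : R) F : mu.-integrable D (EFin \o F) ->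
  mu.-integrable D (EFin \o (fun x => c * F x)).
Proof. by move/(integrableZl mD c); apply: eq_integrable => // x _. Qed.

Lemma integrable_RD F G : mu.-integrable D (EFin \o F) ->
  mu.-integrable D (EFin \o G) -> mu.-integrable D (EFin \o (fun x => F x + G x)).
Proof. by move=> iF iG; have := integrableD mD iF iG; apply: eq_integrable => // x _. Qed.

Lemma integrable_RB F G : mu.-integrable D (EFin \o F) ->
  mu.-integrable D (EFin \o G) -> mu.-integrable D (EFin \o (fun x => F x - G x)).
Proof. by move=> iF iG; have := integrableB mD iF iG; apply: eq_integrable => // x _. Qed.

Lemma integrable_Rle F G : measurable_fun D F ->
  mu.-integrable D (EFin \o G) -> (forall x, D x -> `|F x| <= G x) ->
  mu.-integrable D (EFin \o F).
Proof.
move=> mF iG FG; apply: (le_integrable mD _ _ iG); first exact/measurable_EFinP.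
by move=> x Dx /=; rewrite lee_fin (le_trans (FG x Dx))// ler_norm.
Qed.

Lemma integrable_Rmeasurable F : mu.-integrable D (EFin \o F) -> measurable_fun D F.
Proof. by move=> /measurable_int/measurable_EFinP. Qed.

Lemma ae_Rintegral F G : measurable_fun D F -> {ae mu, forall x, D x -> F x = G x} ->
  mu.-integrable D (EFin \o G) ->
  mu.-integrable D (EFin \o F) /\
  (\int[mu]_(x in D) F x = \int[mu]_(x in D) G x)%R.
Proof.
move=> mF FG iG.
have mG := integrable_Rmeasurable iG.
split; last first.
  rewrite /Rintegral; congr fine; apply: ae_eq_integral => //.
  - exact/measurable_EFinP.
  - exact/measurable_EFinP.
  - by apply: filterS FG => x h /h ->.
apply/integrableP; split; first exact/measurable_EFinP.
have /integrableP[_] := iG; apply: le_lt_trans.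
rewrite (ae_eq_integral (fun x => `|(G x)%:E|)%E)//.
- by apply: measurableT_comp => //; exact/measurable_EFinP.
- by apply: measurableT_comp => //; exact/measurable_EFinP.
- by apply: filterS FG => x h /h /= ->.
Qed.

End Rintegrable.

(** * Weak forms tested against C^1 functions *)

(* [weak_form] is the difference of the two sides of a first-order weak formulation
   with coefficients [f], [g], [q] and initial datum [f0], for the test function [u]
   with partial derivatives [ut] and [uy]. *)
Section weak_form.
Context {R : realType}.
Local Notation mu := (@lebesgue_measure R).
Local Notation plane := (measurableTypeR R * measurableTypeR R)%type.
Local Notation mu2 := (mu \x mu)%E.
Implicit Types (u ut uy : R * R -> R) (a b : R -> R).

Definition box (T M : R) : set (R * R) :=
  [set p | 0 < p.1 /\ p.1 <= T /\ `|p.2| <= M].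

Lemma measurable_box T M : measurable (box T M : set plane).
Proof.
rewrite (_ : box T M = [set p : plane | `]0, T]%classic p.1 /\ `[- M, M]%classic p.2]).
  by apply: measurable_rect; exact: measurable_itv.
apply/seteqP; split => p; rewrite /box /= !in_itv/= -ler_norml.
  by case=> -> [-> ->].
by case=> /andP[-> ->] ->.
Qed.

Variables (f g q : R * R -> R) (f0 : R -> R).
Hypothesis mf : measurable_fun (open_half : set plane) f.
Hypothesis mg : measurable_fun (open_half : set plane) g.
Hypothesis mq : measurable_fun (open_half : set plane) q.
Hypothesis mf0 : measurable_fun (setT : set (measurableTypeR R)) f0.
Hypothesis fi : forall T M, mu2.-integrable (box T M) (EFin \o f).
Hypothesis gi : forall T M, mu2.-integrable (box T M) (EFin \o g).
Hypothesis qi : forall T M, mu2.-integrable (box T M) (EFin \o q).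
Hypothesis f0i : forall M, mu.-integrable `[- M, M] (EFin \o f0).

Definition wint u ut uy (p : R * R) : R := ut p * f p + uy p * g p + u p * q p.
Definition wini u (y : R) : R := u (0, y) * f0 y.

Definition weak_form u ut uy : R :=
  \int[mu2]_(p in open_half) wint u ut uy p + \int[mu]_y wini u y.

(** Integrability is bundled in because linearity of the real-valued integrals relies on it. *)
Definition weak_null u ut uy :=
  [/\ mu2.-integrable open_half (EFin \o wint u ut uy),
      mu.-integrable setT (EFin \o wini u) & weak_form u ut uy = 0].

Let mo := @measurable_open_half R.

Lemma weak_null0 : weak_null (cst 0) (cst 0) (cst 0).
Proof.
have E : wint (cst 0) (cst 0) (cst 0) = cst 0.
  by apply/funext => p; rewrite /wint /= !mul0r !addr0.
have E0 : wini (cst 0) = cst 0 by apply/funext => y; rewrite /wini mul0r.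
rewrite /weak_null /weak_form E E0; split.
- by apply: (eq_integrable mo (cst 0%E)) => //; exact: integrable0.
- by apply: (eq_integrable measurableT (cst 0%E)) => //; exact: integrable0.
- by rewrite !Rintegral_cst// !mul0r addr0.
Qed.

Lemma weak_nullD u ut uy v vt vy (c : R) :
  weak_null u ut uy -> weak_null v vt vy ->
  weak_null (fun p => u p + c * v p) (fun p => ut p + c * vt p)
            (fun p => uy p + c * vy p).
Proof.
move=> [iu iu0 Lu] [iv iv0 Lv].
have E : wint (fun p => u p + c * v p) (fun p => ut p + c * vt p)
    (fun p => uy p + c * vy p) = (fun p => wint u ut uy p + c * wint v vt vy p).
  by apply/funext => p; rewrite /wint; ring.
have E0 : wini (fun p => u p + c * v p) = (fun y => wini u y + c * wini v y).
  by apply/funext => y; rewrite /wini; ring.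
have ic : mu2.-integrable open_half (EFin \o (fun p => c * wint v vt vy p)).
  exact: integrable_RZ.
have ic0 : mu.-integrable setT (EFin \o (fun p => c * wini v p)).
  exact: integrable_RZ.
rewrite /weak_null /weak_form E E0; split.
- exact: integrable_RD.
- exact: integrable_RD.
- have Z1 : \int[mu2]_(p in open_half) (c * wint v vt vy p) =
      c * \int[mu2]_(p in open_half) wint v vt vy p by exact: RintegralZl.
  have Z2 : \int[mu]_y (c * wini v y) = c * \int[mu]_y wini v y.
    exact: RintegralZl.
  rewrite (RintegralD mo iu ic) (RintegralD measurableT iu0 ic0) Z1 Z2.
  rewrite addrACA -mulrDr.
  by move: Lu Lv; rewrite /weak_form => -> ->; rewrite mulr0 addr0.
Qed.

Lemma weak_null_sum n (c : nat -> R) (u ut uy : nat -> R * R -> R) :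
  (forall i, weak_null (u i) (ut i) (uy i)) ->
  weak_null (fun p => \sum_(i < n) c i * u i p) (fun p => \sum_(i < n) c i * ut i p)
            (fun p => \sum_(i < n) c i * uy i p).
Proof.
move=> ui; elim: n => [|n IH].
  rewrite (_ : (fun p => _) = cst 0); last by apply/funext => p; rewrite big_ord0.
  rewrite (_ : (fun p => _) = cst 0); last by apply/funext => p; rewrite big_ord0.
  rewrite (_ : (fun p => _) = cst 0); last by apply/funext => p; rewrite big_ord0.
  exact: weak_null0.
have := weak_nullD (c n) IH (ui n).
by congr weak_null; apply/funext => p; rewrite big_ord_recr.
Qed.

Definition dominated (C T M : R) u ut uy :=
  [/\ forall p, open_half p -> [/\ `|u p| <= C, `|ut p| <= C & `|uy p| <= C],
      forall y, `|u (0, y)| <= C,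
      forall p, open_half p -> ~ box T M p -> [/\ u p = 0, ut p = 0 & uy p = 0] &
      forall y, M < `|y| -> u (0, y) = 0].

Definition wmeas u ut uy :=
  [/\ measurable_fun (open_half : set plane) u,
      measurable_fun (open_half : set plane) ut,
      measurable_fun (open_half : set plane) uy &
      measurable_fun (setT : set (measurableTypeR R)) (fun y => u (0, y))].

Let wdom (C T M : R) (p : R * R) : R :=
  C * ((fun p => `|f p| + `|g p| + `|q p|) \_ (box T M)) p.
Let wdom0 (C M : R) (y : R) : R := C * ((fun y => `|f0 y|) \_ `[- M, M]) y.

Let wdom_int C T M : mu2.-integrable open_half (EFin \o wdom C T M).
Proof.
apply: integrable_RZ => //.
have mb := @measurable_box T M.
have : mu2.-integrable (box T M) (EFin \o (fun p => `|f p| + `|g p| + `|q p|)).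
  apply: integrable_RD => //; last exact: integrable_norm.
  by apply: integrable_RD => //; exact: integrable_norm.
rewrite {1}(_ : box T M = open_half `&` box T M); last first.
  by apply/esym/setIidr => p [].
move=> /(integrable_restrict _ mb mo).
by apply: eq_integrable => // p _; rewrite /= !patchE; case: ifP.
Qed.

Let wdom0_int C M : mu.-integrable setT (EFin \o wdom0 C M).
Proof.
apply: integrable_RZ => //.
have mb : measurable (`[- M, M]%classic : set (measurableTypeR R)).
  exact: measurable_itv.
have := integrable_norm (f0i M).
rewrite -{1}(setTI `[- M, M]%classic).
move=> /(integrable_restrict _ mb measurableT).
by apply: eq_integrable => // p _; rewrite /= !patchE; case: ifP.
Qed.

Let wdomP C T M u ut uy : 0 <= C -> dominated C T M u ut uy ->
  (forall p, open_half p -> `|wint u ut uy p| <= wdom C T M p) /\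
  (forall y, `|wini u y| <= wdom0 C M y).
Proof.
move=> C0 [bC bC0 bs bs0]; split => [p hp|y].
  rewrite /wdom /wint patchE; case: ifPn => [|/negP pb].
    move=> _; have [c1 c2 c3] := bC p hp.
    rewrite (le_trans (ler_normD _ _))// (le_trans (lerD (ler_normD _ _) (lexx _)))//.
    by rewrite !normrM !mulrDr !lerD// ler_wpM2r.
  have [| -> -> ->] := bs p hp; first by move=> h; apply: pb; rewrite inE.
  by rewrite !mul0r !addr0 normr0 mulr0.
rewrite /wdom0 /wini patchE; case: ifPn => [_|/negP yM].
  by rewrite normrM ler_wpM2r.
rewrite bs0 ?mul0r ?normr0 ?mulr0// ltNge; apply/negP => h; apply: yM.
by rewrite inE/= in_itv/= -ler_norml.
Qed.

Lemma weak_int C T M u ut uy : 0 <= C -> wmeas u ut uy -> dominated C T M u ut uy ->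
  mu2.-integrable open_half (EFin \o wint u ut uy) /\
  mu.-integrable setT (EFin \o wini u).
Proof.
move=> C0 [mu0 mut muy mui] /(wdomP C0)[d1 d2]; split.
- apply: (integrable_Rle mo _ (wdom_int C T M)) => //.
  by apply: measurable_funD; [apply: measurable_funD|]; exact: measurable_funM.
- apply: (integrable_Rle measurableT _ (wdom0_int C M)) => //.
  exact: measurable_funM.
Qed.

(** Dominated convergence: a common bound and a common bounded support, together with pointwise
    convergence of the test functions, of their derivatives and of their initial traces, replace any
    uniform convergence. *)
Lemma weak_null_limit C T M (u_ ut_ uy_ : nat -> R * R -> R) u ut uy : 0 <= C ->
  (forall m, weak_null (u_ m) (ut_ m) (uy_ m)) ->
  (forall m, dominated C T M (u_ m) (ut_ m) (uy_ m)) ->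
  (forall p, open_half p -> [/\ u_ m p @[m --> \oo] --> u p,
     ut_ m p @[m --> \oo] --> ut p & uy_ m p @[m --> \oo] --> uy p]) ->
  (forall y, u_ m (0, y) @[m --> \oo] --> u (0, y)) ->
  weak_null u ut uy.
Proof.
move=> C0 nu du cu cu0.
have [|||iI cI] := @Rdominated_convergence _ _ _ mu2 _ mo
    (fun m => wint (u_ m) (ut_ m) (uy_ m)) (wint u ut uy) (wdom C T M) _ (wdom_int C T M).
- by move=> m; have [/measurable_int/measurable_EFinP] := nu m.
- by move=> m p hp; have [+ _] := wdomP C0 (du m); exact.
- move=> p hp; have [c1 c2 c3] := cu p hp.
  by apply: cvgD; [apply: cvgD|]; apply: cvgM => //; exact: cvg_cst.
have [|||iJ cJ] := @Rdominated_convergence _ _ _ mu _ measurableT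
    (fun m => wini (u_ m)) (wini u) (wdom0 C M) _ (wdom0_int C M).
- by move=> m; have [_ /measurable_int/measurable_EFinP] := nu m.
- by move=> m y _; have [_] := wdomP C0 (du m); exact.
- by move=> y _; apply: cvgM => //; exact: cvg_cst.
split=> //.
have cL : weak_form (u_ m) (ut_ m) (uy_ m) @[m --> \oo] --> weak_form u ut uy.
  exact: cvgD cI cJ.
have c0 : weak_form (u_ m) (ut_ m) (uy_ m) @[m --> \oo] --> (0 : R).
  rewrite (_ : (fun m => _) = cst 0); first exact: cvg_cst.
  by apply/funext => m /=; have [_ _] := nu m.
exact: (cvg_unique (@Rhausdorff R) cL c0).
Qed.

Lemma measurable_tensor a b : measurable_fun (setT : set (measurableTypeR R)) a ->
  measurable_fun (setT : set (measurableTypeR R)) b ->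
  measurable_fun (open_half : set plane) (fun p => a p.1 * b p.2).
Proof.
move=> ma mb; apply: measurable_funM; apply: measurable_funTS.
  exact: (measurableT_comp ma (@measurable_fst _ _ (measurableTypeR R) (measurableTypeR R))).
exact: (measurableT_comp mb (@measurable_snd _ _ (measurableTypeR R) (measurableTypeR R))).
Qed.

(** Products a(tau) b(y) are enough, since the quasi-interpolants are finite sums of such
    products. *)
Hypothesis null_smooth : forall a b, smooth a -> smooth b ->
  (exists N : R, forall t, N <= `|t| -> a t = 0 /\ b t = 0) ->
  weak_form (fun p => a p.1 * b p.2) (fun p => derive1 a p.1 * b p.2)
            (fun p => a p.1 * derive1 b p.2) = 0.

Lemma derive1_supp a (N x : R) : smooth a -> (forall t, N <= `|t| -> a t = 0) ->
  N < `|x| -> derive1 a x = 0.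
Proof.
move=> /smooth_derive[da _] aN Nx; apply: (is_derive_eq0 _ (da x)).
apply: (@filterS _ _ _ (fun t => N < `|t|)) => [t Nt|]; first by rewrite aN ?ltW.
have h : nbhs `|x| [set y | N < y] by exact: lt_nbhsr.
exact: (norm_continuous h).
Qed.

Lemma smooth_bounded a (N : R) : smooth a -> (forall t, N <= `|t| -> a t = 0) ->
  exists2 C : R, 0 <= C & forall x, `|a x| <= C.
Proof.
move=> sa aN; have [C C0 aC] := continuous_bounded N (smooth_continuous sa).
exists C => // x; have [/aC//|/ltW Nx] := leP `|x| N.
by rewrite aN// normr0.
Qed.

Lemma weak_int_smooth a b (N : R) : smooth a -> smooth b ->
  (forall t, N <= `|t| -> a t = 0) -> (forall t, N <= `|t| -> b t = 0) ->
  mu2.-integrable open_half (EFin \o wint (fun p => a p.1 * b p.2)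
    (fun p => derive1 a p.1 * b p.2) (fun p => a p.1 * derive1 b p.2)) /\
  mu.-integrable setT (EFin \o wini (fun p => a p.1 * b p.2)).
Proof.
move=> sa sb aN bN.
have [da sa'] := smooth_derive sa; have [db sb'] := smooth_derive sb.
have a'N t : N + 1 <= `|t| -> derive1 a t = 0.
  by move=> Nt; apply: (derive1_supp sa aN); lra.
have b'N t : N + 1 <= `|t| -> derive1 b t = 0.
  by move=> Nt; apply: (derive1_supp sb bN); lra.
have [C1 C10 aC] := smooth_bounded sa aN.
have [C2 C20 bC] := smooth_bounded sb bN.
have [C3 C30 a'C] := smooth_bounded sa' a'N.
have [C4 C40 b'C] := smooth_bounded sb' b'N.
have mc c : smooth c -> measurable_fun (setT : set (measurableTypeR R)) c.
  by move=> sc; exact: continuous_measurable_fun (smooth_continuous sc).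
pose C := (C1 + C3) * (C2 + C4).
have mulC (x y : R) : `|x| <= C1 + C3 -> `|y| <= C2 + C4 -> `|x * y| <= C.
  by move=> xC yC; rewrite normrM ler_pM.
have aC' x : `|a x| <= C1 + C3 by rewrite (le_trans (aC x))// lerDl.
have a'C' x : `|derive1 a x| <= C1 + C3 by rewrite (le_trans (a'C x))// lerDr.
have bC' x : `|b x| <= C2 + C4 by rewrite (le_trans (bC x))// lerDl.
have b'C' x : `|derive1 b x| <= C2 + C4 by rewrite (le_trans (b'C x))// lerDr.
have C0 : 0 <= C by rewrite mulr_ge0 ?addr_ge0.
apply: (@weak_int C (N + 1) (N + 1) (fun p => a p.1 * b p.2)
  (fun p => derive1 a p.1 * b p.2) (fun p => a p.1 * derive1 b p.2) C0).
- split; try by apply: measurable_tensor; exact: mc.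
  exact: (measurable_funM (measurable_cst (a 0)) (mc _ sb)).
- split.
  + by move=> p _; split; exact: mulC.
  + by move=> y; exact: mulC.
  + move=> p p0 pb.
    have [h|h] : N + 1 <= `|p.1| \/ N + 1 <= `|p.2|.
      have [h1|h1] := leP (N + 1) `|p.2|; [by right|left].
      have [//|h2] := leP (N + 1) `|p.1|.
      exfalso; apply: pb; split => //; split; last exact: ltW.
      by rewrite (le_trans (ler_norm _))// ltW.
    * by rewrite (aN p.1) ?a'N ?mul0r//; lra.
    * by rewrite (bN p.2) ?b'N ?mulr0//; lra.
  + by move=> y Ny; rewrite (bN y) ?mulr0//; lra.
Qed.

Lemma weak_null_smooth a b (N : R) : smooth a -> smooth b ->
  (forall t, N <= `|t| -> a t = 0) -> (forall t, N <= `|t| -> b t = 0) ->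
  weak_null (fun p => a p.1 * b p.2) (fun p => derive1 a p.1 * b p.2)
            (fun p => a p.1 * derive1 b p.2).
Proof.
move=> sa sb aN bN; have [i1 i2] := weak_int_smooth sa sb aN bN.
split=> //; apply: null_smooth => //.
by exists N => t Nt; rewrite aN ?bN.
Qed.

Lemma ex_nat_above (N : R) : exists2 M : nat, (3 <= M)%N & N <= M%:R.
Proof.
exists (`|Num.ceil N|%N + 3)%N; first by rewrite leq_addl.
rewrite natrD (le_trans (ceil_ge _))// natr_absz.
by rewrite (le_trans (_ : _ <= (`|Num.ceil N|)%:~R))// ?lerDl// ler_int ler_norm.
Qed.

Lemma supp_derive (psi psi' : R -> R) (N x : R) :
  (forall x : R, is_derive x 1 psi (psi' x)) ->
  (forall y, N <= `|y| -> psi y = 0) -> N < `|x| -> psi' x = 0.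
Proof.
move=> dpsi psiN Nx; apply: (is_derive_eq0 _ (dpsi x)).
apply: (@filterS _ _ _ (fun t => N < `|t|)) => [t Nt|]; first by rewrite psiN ?ltW.
have h : nbhs `|x| [set y | N < y] by exact: lt_nbhsr.
exact: (norm_continuous h).
Qed.

Lemma supp_bounded (psi : R -> R) (N : R) : continuous psi ->
  (forall t, N < `|t| -> psi t = 0) ->
  exists2 C : R, 0 <= C & forall x, `|psi x| <= C.
Proof.
move=> cpsi psiN; have [C C0 hC] := continuous_bounded N cpsi.
exists C => // x; have [/hC//|Nx] := leP `|x| N.
by rewrite psiN// normr0.
Qed.

(** Quasi-interpolation in y turns [psi] into finite sums of smooth bumps, for which the weak form
    vanishes by linearity; the mean value theorem bounds the derivatives of these sums by the
    supremum of |psi'|. *)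
Lemma weak_null_tensor a (psi psi' : R -> R) (N : R) : smooth a ->
  (forall t, N <= `|t| -> a t = 0) ->
  (forall x : R, is_derive x 1 psi (psi' x)) -> continuous psi' ->
  (forall y, N <= `|y| -> psi y = 0) ->
  weak_null (fun p => a p.1 * psi p.2) (fun p => derive1 a p.1 * psi p.2)
            (fun p => a p.1 * psi' p.2).
Proof.
move=> sa aN dpsi cpsi' psiN.
have [T [S [sS dS [Tm T0 T1] [Sm S0 S1]]]] := @smooth_step R.
(* Beyond M - 3 >= N + 1 both [psi] and [psi'] vanish, which leaves the three cells that a bump
   reaches. *)
have [M M3 MN] := ex_nat_above (N + 4).
have psi'N t : N < `|t| -> psi' t = 0 by exact: supp_derive dpsi psiN.
have cpsi : continuous psi by move=> x; exact: derivable_cvg (dpsi x).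
have sa' := (smooth_derive sa).2.
have a'N t : N + 1 <= `|t| -> derive1 a t = 0.
  by move=> Nt; apply: (derive1_supp sa aN); lra.
have [C1 C10 aC] := smooth_bounded sa aN.
have [C2 C20 a'C] := smooth_bounded sa' a'N.
have [C3 C30 psiC] := supp_bounded cpsi (fun t h => psiN t (ltW h)).
have [C4 C40 psi'C] := supp_bounded cpsi' psi'N.
have psiM x : M%:R - 3 <= `|x| -> psi x = 0 by move=> h; apply: psiN; lra.
have M3' : 3 <= M%:R :> R by rewrite (ler_nat _ 3).
have psi0 m : psi (node M m 0) = 0.
  by rewrite node0 psiM// normrN ger0_norm//; lra.
have psin m : psi (node M m (size_grid M m)) = 0.
  by rewrite node_size// psiM// ger0_norm//; lra.
have psiout y x : M%:R < `|y| -> y < x -> x < y + 3 -> psi x = 0.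
  rewrite lter_normr => /orP[h|h] yx xy; apply: psiN; rewrite ler_normr; apply/orP.
    by left; lra.
  by right; lra.
have mulC (x y : R) : `|x| <= C1 + C2 -> `|y| <= C3 + C4 ->
    `|x * y| <= (C1 + C2) * (C3 + C4) by move=> ? ?; rewrite normrM ler_pM.
have aC' x : `|a x| <= C1 + C2 by rewrite (le_trans (aC x))// lerDl.
have a'C' x : `|derive1 a x| <= C1 + C2 by rewrite (le_trans (a'C x))// lerDr.
have QC m y : `|Q S M m psi y| <= C3 + C4.
  by rewrite (le_trans (Q_bound Sm S0 S1 C30 _))// ?lerDl.
have QdC m y : `|Qd T M m psi y| <= C3 + C4.
  rewrite (le_trans (Qd_bound Tm T0 T1 C40 _ _ _))// ?lerDr// => i _.
  have m0 : 0 < m.+1%:R^-1 :> R by rewrite invr_gt0.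
  have := @slope_bound _ psi psi' C4 (node M m i) (node M m i.+1).
  rewrite node_next ltrDl m0 [_ + _ - node M m i]addrAC subrr add0r invrK.
  by rewrite -node_next; apply.
apply: (@weak_null_limit ((C1 + C2) * (C3 + C4)) (N + 1) M%:R
  (fun m p => a p.1 * Q S M m psi p.2)
  (fun m p => derive1 a p.1 * Q S M m psi p.2)
  (fun m p => a p.1 * Qd T M m psi p.2)).
- by rewrite mulr_ge0 ?addr_ge0.
- move=> m.
  have nb i : weak_null (fun p => a p.1 * bump S i (zoom M m p.2))
      (fun p => derive1 a p.1 * bump S i (zoom M m p.2))
      (fun p => a p.1 * dbump2 T M m i p.2).
    have [N' bN'] := bump_compact S0 S1 M m i.
    rewrite -(is_derive_derive1 (is_derive_bump dS M m i)).
    apply: (@weak_null_smooth a (fun y => bump S i (zoom M m y)) (Num.max N N')) => //.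
    + by move=> k; exact: Ck_bump.
    + by move=> t; rewrite ge_max => /andP[/aN].
    + by move=> t; rewrite ge_max => /andP[_ /bN'].
  have := weak_null_sum (size_grid M m) (fun i => psi (node M m i)) nb.
  congr weak_null; apply/funext => p; rewrite mulr_sumr; apply: eq_bigr => i _;
    exact: mulrCA.
- move=> m; split.
  + by move=> p _; split; exact: mulC.
  + by move=> y; exact: mulC.
  + move=> p p0 pb.
    have [h|h] : N + 1 <= `|p.1| \/ M%:R < `|p.2|.
      have [h1|h1] := ltP M%:R `|p.2|; [by right|left].
      have [//|h2] := leP (N + 1) `|p.1|.
      exfalso; apply: pb; split => //; split => //.
      by rewrite (le_trans (ler_norm _))// ltW.
    * by rewrite (aN p.1) ?a'N ?mul0r//; lra.
    * by rewrite (Q_supp S0 S1) ?(Qd_supp T0 T1) ?mulr0// => x; exact: psiout.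
  + by move=> y yM; rewrite (Q_supp S0 S1) ?mulr0// => x; exact: psiout.
- move=> p _.
  have c1 : Q S M m psi p.2 @[m --> \oo] --> psi p.2.
    by apply: (Q_cvg Sm S0 S1) => //; exact: cvg_at_right_filter (cpsi _).
  have c2 : Qd T M m psi p.2 @[m --> \oo] --> psi' p.2.
    apply: (Qd_cvg Tm T0 T1) => //; first by move=> h; apply: psi'N; lra.
    apply: slope_cvg; last exact: cvg_at_right_filter (cpsi' _).
    exact: nearW.
  by split; apply: cvgM => //; exact: cvg_cst.
- move=> y; apply: cvgM; first exact: cvg_cst.
  by apply: (Q_cvg Sm S0 S1) => //; exact: cvg_at_right_filter (cpsi _).
Qed.

Lemma Q_ext (S : R -> R) M m h1 h2 t :
  (forall x : R, x <= 0 -> S x = 0) -> (forall x : R, 2 <= x -> S x = 1) ->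
  (forall x, t < x -> h1 x = h2 x) -> Q S M m h1 t = Q S M m h2 t.
Proof.
move=> S0 S1 hh; apply: eq_bigr => i _.
have [/(node_in (m := m))/andP[h _]|/(bump_supp S0 S1) ->] :=
  boolP (0 < (nat_of_ord i)%:R - zoom M m t < 3); last by rewrite !mulr0.
by rewrite hh.
Qed.

(** Quasi-interpolation in time alone: the approximant is a sum of a smooth bump in tau times a
    slice u(node, y), which is only C^1 in y, and each product is covered by [weak_null_tensor].
    One-sided sampling keeps all relevant slices at positive times, so nothing is asked of the
    derivatives at tau = 0. *)
Lemma weak_null_C1 u ut uy (C N : R) : 0 <= C ->
  (forall t y : R, 0 < t ->
    [/\ is_derive t 1 (fun s => u (s, y)) (ut (t, y)),
        is_derive y 1 (fun z => u (t, z)) (uy (t, y)),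
        ut (s, y) @[s --> t] --> ut (t, y),
        uy (s, y) @[s --> t] --> uy (t, y) &
        uy (t, z) @[z --> y] --> uy (t, y)]) ->
  (forall y, u (s, y) @[s --> 0^'+] --> u (0, y)) ->
  (forall p, open_half p -> [/\ `|u p| <= C, `|ut p| <= C & `|uy p| <= C]) ->
  (forall p, open_half p -> N <= p.1 \/ N <= `|p.2| -> u p = 0) ->
  weak_null u ut uy.
Proof.
move=> C0 du u0 uC uN.
have [T [S [sS dS [Tm T0 T1] [Sm S0 S1]]]] := @smooth_step R.
have [M M3 MN'] := ex_nat_above (Num.max N 0 + 4).
have MN : N + 4 <= M%:R by rewrite (le_trans _ MN')// lerD2r le_max lexx.
have M3' : 3 < M%:R :> R.
  by rewrite (lt_le_trans _ MN')// (@lt_le_trans _ _ (0 + 4))// ?lerD2r ?le_max ?lexx ?orbT//; lra.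
(* The extension by 0 is arbitrary: at times t >= 0 only nodes beyond t carry a nonzero bump. *)
pose v y s : R := if 0 < s then u (s, y) else 0.
pose vy y s : R := if 0 < s then uy (s, y) else 0.
have nv (y t : R) : 0 < t -> \forall s \near t, u (s, y) = v y s.
  by move=> t0; near=> s; rewrite /v ifT//; near: s; exact: lt_nbhsr.
have nvy (y t : R) : 0 < t -> \forall s \near t, uy (s, y) = vy y s.
  by move=> t0; near=> s; rewrite /vy ifT//; near: s; exact: lt_nbhsr.
have dv (y t : R) : 0 < t -> is_derive t 1 (v y) (ut (t, y)).
  by move=> t0; have [d _ _ _ _] := du t y t0; apply: near_eq_is_derive d; exact: nv.
have uyN (t y : R) : 0 < t -> N < t \/ N < `|y| -> uy (t, y) = 0.
  move=> t0 h; have [_ d _ _ _] := du t y t0; apply: (is_derive_eq0 _ d).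
  case: h => h; first by near=> z; apply: uN => //; left; exact: ltW.
  apply: (@filterS _ _ _ (fun z => N < `|z|)) => [z Nz|].
    by apply: uN => //; right; exact: ltW.
  have h' : nbhs `|y| [set y | N < y] by exact: lt_nbhsr.
  exact: (norm_continuous h').
have utN (t y : R) : 0 < t -> N < t -> ut (t, y) = 0.
  move=> t0 h; apply: (is_derive_eq0 _ (dv y t t0)).
  near=> s; rewrite /v; case: ifPn => // s0; apply: uN => //; left => /=.
  by apply: ltW; near: s; exact: lt_nbhsr.
have vN y x : M%:R - 3 <= `|x| -> v y x = 0.
  move=> h; rewrite /v; case: ifPn => // x0; apply: uN => //; left => /=.
  by move: h; rewrite (gtr0_norm x0); lra.
have vyN y x : M%:R - 3 <= `|x| -> vy y x = 0.
  move=> h; rewrite /vy; case: ifPn => // x0; apply: uyN => //; left => /=.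
  by move: h; rewrite (gtr0_norm x0); lra.
have v0 y m : v y (node M m 0) = 0.
  by rewrite node0 vN// normrN ger0_norm//; lra.
have vn y m : v y (node M m (size_grid M m)) = 0.
  by rewrite node_size// vN// ger0_norm//; lra.
have vC y s : `|v y s| <= C.
  rewrite /v; case: ifPn => s0; last by rewrite normr0.
  by have [] := uC (s, y) s0.
have vyC y s : `|vy y s| <= C.
  rewrite /vy; case: ifPn => s0; last by rewrite normr0.
  by have [] := uC (s, y) s0.
apply: (@weak_null_limit C M%:R M%:R
  (fun m p => Q S M m (v p.2) p.1) (fun m p => Qd T M m (v p.2) p.1)
  (fun m p => Q S M m (vy p.2) p.1)) => //.
- move=> m.
  have nb i : weak_null
      (fun p => bump S i (zoom M m p.1) * v p.2 (node M m i))
      (fun p => dbump2 T M m i p.1 * v p.2 (node M m i))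
      (fun p => bump S i (zoom M m p.1) * vy p.2 (node M m i)).
    have [N' bN'] := bump_compact S0 S1 M m i.
    rewrite -(is_derive_derive1 (is_derive_bump dS M m i)).
    apply: (@weak_null_tensor (fun y => bump S i (zoom M m y))
      (fun y => v y (node M m i)) (fun y => vy y (node M m i)) (Num.max N N')) => //.
    + by move=> k; exact: Ck_bump.
    + by move=> t; rewrite ge_max => /andP[_ /bN'].
    + move=> y; rewrite /v /vy; case: ifPn => s0; last exact: is_derive_cst.
      by have [_ d _ _ _] := du _ y s0.
    + move=> y; rewrite /vy; have [s0|s0] := ltP 0 (node M m i).
        by have [_ _ _ _] := du _ y s0.
      exact: cvg_cst.
    + move=> t; rewrite ge_max => /andP[Nt _].
      by rewrite /v; case: ifPn => // s0; apply: uN => //; right.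
  have := weak_null_sum (size_grid M m) (fun _ => 1) nb.
  congr weak_null; apply/funext => p; apply: eq_bigr => i _; rewrite mul1r;
    exact: mulrC.
- move=> m; split.
  + move=> [t y] /= t0; split.
    * by apply: (Q_bound Sm S0 S1).
    * apply: (Qd_bound Tm T0 T1) => // i ti.
      have m0 : 0 < m.+1%:R^-1 :> R by rewrite invr_gt0.
      have := @slope_bound _ (v y) (fun s => ut (s, y)) C (node M m i) (node M m i.+1).
      rewrite node_next ltrDl m0 [_ + _ - node M m i]addrAC subrr add0r invrK.
      rewrite -node_next; apply => // x /andP[xi _].
        by apply: dv; apply: lt_le_trans xi; exact: lt_trans ti.
      have x0 : 0 < x by apply: lt_le_trans xi; exact: lt_trans ti.
      by have [] := uC (x, y) x0.
    * by apply: (Q_bound Sm S0 S1).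
  + by move=> y; apply: (Q_bound Sm S0 S1).
  + move=> [t y] /= t0 pb.
    have [h|h] : M%:R < t \/ M%:R < `|y|.
      have [h1|h1] := ltP M%:R `|y|; [by right|left].
      have [//|h2] := ltP M%:R t.
      by exfalso; apply: pb.
    * have hv x : t < x -> x < t + 3 -> v y x = 0.
        by move=> tx _; apply: vN; rewrite gtr0_norm; lra.
      have hvy x : t < x -> x < t + 3 -> vy y x = 0.
        by move=> tx _; apply: vyN; rewrite gtr0_norm; lra.
      by rewrite (Q_supp S0 S1 _ _ hv) (Q_supp S0 S1 _ _ hvy) (Qd_supp T0 T1).
    * have hv x : v y x = 0.
        by rewrite /v; case: ifPn => // x0; apply: uN => //; right => /=; lra.
      have hvy x : vy y x = 0.
        by rewrite /vy; case: ifPn => // x0; apply: uyN => //; right => /=; lra.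
      by rewrite !(Q_supp S0 S1) ?(Qd_supp T0 T1).
  + move=> y yM /=; rewrite (Q_supp S0 S1)// => x _ _.
    by rewrite /v; case: ifPn => // x0; apply: uN => //; right => /=; lra.
- move=> [t y] /= t0; have [d1 d2 c1 c2 c3] := du t y t0; split.
  + have -> : u (t, y) = v y t by rewrite /v ifT.
    apply: (Q_cvg Sm S0 S1) => //; first exact: vN.
    exact: cvg_at_right_filter (derivable_cvg (dv y t t0)).
  + apply: (Qd_cvg Tm T0 T1) => //; first exact: vN.
      by move=> h; apply: utN => //; move: h; rewrite gtr0_norm//; lra.
    apply: (slope_cvg (f' := fun s => ut (s, y))); last exact: cvg_at_right_filter c1.
    by apply: filterS (nbhs_right_gt t) => s ts; apply: dv; exact: lt_trans ts.
  + have -> : uy (t, y) = vy y t by rewrite /vy ifT.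
    apply: (Q_cvg Sm S0 S1) => //; first exact: vyN.
    apply: cvg_at_right_filter; rewrite /vy t0.
    by apply: cvg_trans c2; apply: near_eq_cvg; exact: nvy.
- move=> y /=.
  (* [v] has the wrong value at s = 0. The quasi-interpolant at 0 samples positive times only, so
     [v] may be replaced by this right-continuous function without changing it. *)
  pose w s : R := if s == 0 then u (0, y) else v y s.
  have -> : u (0, y) = w 0 by rewrite /w eqxx.
  rewrite (_ : (fun m => _) = (fun m => Q S M m w 0)); last first.
    by apply/funext => m; apply: Q_ext => // x x0; rewrite /w gt_eqF.
  apply: (Q_cvg Sm S0 S1) => //.
    move=> x xM; rewrite /w vN//; case: eqP xM => // ->; rewrite normr0; lra.
  rewrite [X in _ --> X]/w eqxx; apply: cvg_trans (u0 y).
  apply: near_eq_cvg; near=> s.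
  have s0 : 0 < s by near: s; exact: nbhs_right_gt.
  by rewrite /w /v gt_eqF// s0.
Unshelve. all: by end_near. Qed.

End weak_form.

(** * Partial derivatives and tensor products of smooth functions *)

Section partial_derivatives.
Context {R : realType}.
Implicit Types (u : R * R -> R) (a b : R -> R).

Lemma derive_tau_quot u (p : R * R) :
  (fun h : R => h^-1 *: ((u \o shift p) (h *: (1, 0)) - u p)) =
  (fun h : R => h^-1 *: (((fun s => u (s, p.2)) \o shift p.1) (h *: 1) - u p)).
Proof.
apply/funext => h /=; congr (_ *: (u _ - _)).
by case: p => t y; congr pair; rewrite /= scaler0 add0r.
Qed.

Lemma derive_y_quot u (p : R * R) :
  (fun h : R => h^-1 *: ((u \o shift p) (h *: (0, 1)) - u p)) =
  (fun h : R => h^-1 *: (((fun s => u (p.1, s)) \o shift p.2) (h *: 1) - u p)).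
Proof.
apply/funext => h /=; congr (_ *: (u _ - _)).
by case: p => t y; congr pair; rewrite /= scaler0 add0r.
Qed.

Lemma is_derive_tau u (t y d : R) : is_derive t 1 (fun s => u (s, y)) d ->
  derivable u (t, y) (1, 0) /\ Dtau u (t, y) = d.
Proof.
move=> [du dE]; split; first by rewrite /derivable derive_tau_quot.
by rewrite /Dtau /derive derive_tau_quot.
Qed.

Lemma is_derive_y u (t y d : R) : is_derive y 1 (fun z => u (t, z)) d ->
  derivable u (t, y) (0, 1) /\ Dy u (t, y) = d.
Proof.
move=> [du dE]; split; first by rewrite /derivable derive_y_quot.
by rewrite /Dy /derive derive_y_quot.
Qed.

Lemma tau_is_derive u (t y : R) : derivable u (t, y) (1, 0) ->
  is_derive t 1 (fun s => u (s, y)) (Dtau u (t, y)).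
Proof.
rewrite /derivable derive_tau_quot => du; apply: DeriveDef => //.
by rewrite /Dtau /derive derive_tau_quot.
Qed.

Lemma y_is_derive u (t y : R) : derivable u (t, y) (0, 1) ->
  is_derive y 1 (fun z => u (t, z)) (Dy u (t, y)).
Proof.
rewrite /derivable derive_y_quot => du; apply: DeriveDef; first exact: du.
by rewrite /Dy /derive derive_y_quot.
Qed.

Lemma is_deriveZr a (x c d : R) : is_derive x 1 a d ->
  is_derive x 1 (fun s => a s * c) (d * c).
Proof.
move=> da; have := is_deriveZ c da; rewrite [d * c]mulrC.
by congr is_derive; apply/funext => s; rewrite mulrC.
Qed.

Lemma is_deriveZl a (x c d : R) : is_derive x 1 a d ->
  is_derive x 1 (fun s => c * a s) (c * d).
Proof. by move=> da; exact: is_deriveZ. Qed.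

Lemma tensor_tau a b : smooth a ->
  Dtau (fun p : R * R => a p.1 * b p.2) = (fun p => derive1 a p.1 * b p.2) /\
  forall p, derivable (fun p : R * R => a p.1 * b p.2) p (1, 0).
Proof.
move=> /smooth_derive[da _]; split.
  by apply/funext => -[t y]; apply: (is_derive_tau (is_deriveZr (b y) (da t))).2.
by move=> [t y]; apply: (is_derive_tau (is_deriveZr (b y) (da t))).1.
Qed.

Lemma tensor_y a b : smooth b ->
  Dy (fun p : R * R => a p.1 * b p.2) = (fun p => a p.1 * derive1 b p.2) /\
  forall p, derivable (fun p : R * R => a p.1 * b p.2) p (0, 1).
Proof.
move=> /smooth_derive[db _]; split.
  by apply/funext => -[t y]; apply: (is_derive_y (is_deriveZl (a t) (db y))).2.
by move=> [t y]; apply: (is_derive_y (is_deriveZl (a t) (db y))).1.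
Qed.

Lemma continuous_fst a (p : R * R) : {for p.1, continuous a} ->
  {for p, continuous (fun p : R * R => a p.1)}.
Proof.
move=> ca; apply: (@cvg_comp _ _ _ fst a _ (nbhs p.1) _ _ ca).
exact: (@cvg_fst _ _ (nbhs p.1) (nbhs p.2)).
Qed.

Lemma continuous_snd a (p : R * R) : {for p.2, continuous a} ->
  {for p, continuous (fun p : R * R => a p.2)}.
Proof.
move=> ca; apply: (@cvg_comp _ _ _ snd a _ (nbhs p.2) _ _ ca).
exact: (@cvg_snd _ _ (nbhs p.1) (nbhs p.2)).
Qed.

(** Every iterated partial derivative of a tensor product is again a tensor product of smooth
    functions; this stronger claim is what the induction on the list of derivatives proves. *)
Lemma smooth2_tensor a b : smooth a -> smooth b ->
  smooth2 (fun p : R * R => a p.1 * b p.2).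
Proof.
move=> sa sb s /=.
suff [c [d [sc sd ->]]] : exists c d, [/\ smooth c, smooth d &
    foldr partial (fun p : R * R => a p.1 * b p.2) s = (fun p => c p.1 * d p.2)].
  split; [|exact: (tensor_tau d sc).2|exact: (tensor_y c sd).2].
  move=> p; apply: cvgM.
    by apply: continuous_fst; exact: smooth_continuous.
  by apply: continuous_snd; exact: smooth_continuous.
elim: s => [|[] s [c [d [sc sd E]]]] /=; first by exists a, b.
  exists (derive1 c), d; split=> //; first exact: (smooth_derive sc).2.
  by rewrite E; exact: (tensor_tau d sc).1.
exists c, (derive1 d); split=> //; first exact: (smooth_derive sd).2.
by rewrite E; exact: (tensor_y c sd).1.
Qed.

Lemma compact_rectangle (a b c d : R) :
  compact [set p : R * R | a <= p.1 <= b /\ c <= p.2 <= d].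
Proof.
rewrite (_ : [set p | _] = `[a, b]%classic `*` `[c, d]%classic).
  by apply: compact_setX; exact: segment_compact.
by apply/seteqP; split => p /=; rewrite !in_itv.
Qed.

Lemma test_fun2_tensor a b (N : R) : smooth a -> smooth b ->
  (forall t, N <= `|t| -> a t = 0 /\ b t = 0) ->
  test_fun2 (fun p : R * R => a p.1 * b p.2).
Proof.
move=> sa sb abN; split; first exact: smooth2_tensor.
pose K := [set p : R * R | - N <= p.1 <= N /\ - N <= p.2 <= N].
have cK : compact K by exact: compact_rectangle.
apply: (subclosed_compact _ cK); first exact: closed_closure.
have /closure_id -> : closed K.
  by apply: compact_closed cK; exact: norm_hausdorff.
apply: closureS => -[t y] /= p0; rewrite /K /= -!ler_norml.
split; rewrite leNgt; apply: contra_neqN p0 => /ltW/abN[h1 h2].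
  by rewrite h1 mul0r.
by rewrite h2 mulr0.
Qed.

Lemma test_fun_smooth a (N : R) : smooth a -> (forall t, N <= `|t| -> a t = 0) ->
  test_fun a.
Proof.
move=> sa aN; split; first by move=> m x; apply: Ck_derivable1n; exact: sa.
have cK : compact `[- N, N] by exact: segment_compact.
apply: (subclosed_compact _ cK); first exact: closed_closure.
have /closure_id -> : closed `[- N, N]%classic by exact: interval_closed.
apply: closureS => t /= p0; rewrite in_itv/= -ler_norml.
by rewrite leNgt; apply: contra_neqN p0 => /ltW/aN.
Qed.

End partial_derivatives.

Section measurability.
Context {R : realType} d (T : measurableType d).

(** 1 / f = f (f^2)^(-1), with a power of a nonnegative number; the identity persists at zeros of
    [f] since 1 / 0 = 0. *)
Lemma measurable_inv (D : set T) (f : T -> R) : measurable_fun D f ->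
  measurable_fun D (fun x => (f x)^-1).
Proof.
move=> mf; rewrite (_ : (fun x => _) = (fun x => f x * (f x ^+ 2) `^ (-1))).
  apply: measurable_funM => //.
  rewrite (_ : (fun x => (f x ^+ 2) `^ _) = (@powR R ^~ (-1)) \o (fun x => f x ^+ 2))//.
  apply: measurableT_comp; first exact: measurable_powR.
  exact: measurable_funX.
apply/funext => x; have [->|f0] := eqVneq (f x) 0; first by rewrite invr0 mul0r.
by rewrite powR_inv1 ?sqr_ge0// expr2 invfM mulrA divff// mul1r.
Qed.

End measurability.

(** * Test functions for the damped Euler system *)

Section weak_solutions.
Context {R : realType}.
Local Notation mu := (@lebesgue_measure R).
Local Notation plane := (measurableTypeR R * measurableTypeR R)%type.
Local Notation mu2 := (mu \x mu)%E.
Implicit Types (u ut uy : R * R -> R) (a b : R -> R).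

Let mo := @measurable_open_half R.

Lemma L1loc_measurable (F : R * R -> \bar R) : L1loc_half F ->
  measurable_fun (open_half : set plane) F.
Proof.
move=> [mF _]; apply: measurable_funS mF; first exact: measurable_closed_half.
by move=> p; rewrite /open_half /closed_half /= => /ltW.
Qed.

Lemma L1loc_box (F : R * R -> \bar R) T M : L1loc_half F ->
  mu2.-integrable (box T M) F.
Proof.
move=> [mF iF].
pose K := [set p : R * R | 0 <= p.1 <= T /\ - M <= p.2 <= M].
have cK : compact K by exact: compact_rectangle.
have K0 : K `<=` closed_half by move=> p [/andP[]].
have bK : box T M `<=` K.
  by move=> p [p0 [pT pM]]; rewrite /K /= (ltW p0) pT -ler_norml.
have mK : measurable (K : set plane).
  rewrite (_ : K = [set p : plane | `[0, T]%classic p.1 /\ `[- M, M]%classic p.2]).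
    by apply: measurable_rect; exact: measurable_itv.
  by apply/seteqP; split => p; rewrite /K /= !in_itv/=.
apply: (integrableS mK) => //; first exact: measurable_box.
apply/integrableP; split; last exact: iF.
by apply: measurable_funS mF => //; exact: measurable_closed_half.
Qed.

Lemma box_open T M : box T M `<=` @open_half R. Proof. by move=> p []. Qed.

Lemma measurable_fst_fun a : measurable_fun (setT : set (measurableTypeR R)) a ->
  measurable_fun (open_half : set plane) (fun p => a p.1).
Proof.
move=> ma; apply: measurable_funTS.
exact: (measurableT_comp ma (@measurable_fst _ _ (measurableTypeR R) (measurableTypeR R))).
Qed.

Lemma measurable_snd_fun a : measurable_fun (setT : set (measurableTypeR R)) a ->
  measurable_fun (open_half : set plane) (fun p => a p.2).
Proof.
move=> ma; apply: measurable_funTS.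
exact: (measurableT_comp ma (@measurable_snd _ _ (measurableTypeR R) (measurableTypeR R))).
Qed.

Lemma integrable_bounded_mul (h f : R * R -> R) (D : set (R * R)) (C : R) :
  measurable (D : set plane) -> measurable_fun (D : set plane) h ->
  (forall p, D p -> `|h p| <= C) -> mu2.-integrable D (EFin \o f) ->
  mu2.-integrable D (EFin \o (fun p => h p * f p)).
Proof.
move=> mD mh hC fi.
apply: (@integrable_Rle _ _ _ mu2 D mD (fun p => h p * f p) (fun p => C * `|f p|)).
- by apply: measurable_funM => //; exact: integrable_Rmeasurable fi.
- by apply: integrable_RZ => //; exact: integrable_norm.
- by move=> p Dp; rewrite normrM ler_wpM2r// hC.
Qed.

Lemma measurable_snd_half : measurable_fun (open_half : set plane) (fun p => - (p.2 / 2)).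
Proof.
apply: (@measurable_snd_fun (fun y => - (y / 2))).
apply: continuous_measurable_fun => y; apply: cvgN; apply: cvgM; first exact: cvg_id.
exact: cvg_cst.
Qed.

Lemma measurable_snd_half_box T M (p : R * R) : box T M p -> `|- (p.2 / 2)| <= M / 2.
Proof. by move=> [_ [_ pM]]; rewrite normrN normrM [`|2^-1|]ger0_norm// ler_pM2r. Qed.

(** The test functions accepted by [weak_null_C1]: differentiable for tau > 0, with partial
    derivatives continuous along the lines listed, bounded together with them, supported in a
    bounded region, and right-continuous at tau = 0 along each line. *)
Definition admissible u ut uy := exists C N : R,
  [/\ 0 <= C,
      (forall t y : R, 0 < t ->
    [/\ is_derive t 1 (fun s => u (s, y)) (ut (t, y)),
        is_derive y 1 (fun z => u (t, z)) (uy (t, y)),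
        ut (s, y) @[s --> t] --> ut (t, y),
        uy (s, y) @[s --> t] --> uy (t, y) &
        uy (t, z) @[z --> y] --> uy (t, y)]),
      (forall y, u (s, y) @[s --> 0^'+] --> u (0, y)),
      (forall p, open_half p -> [/\ `|u p| <= C, `|ut p| <= C & `|uy p| <= C]) &
      (forall p, open_half p -> N <= p.1 \/ N <= `|p.2| -> u p = 0)].

Section mass_momentum.
Variables (alpha k gamma : R) (rho0 n0 : R -> R) (rho n : R * R -> R).
Hypothesis sol : weak_solution alpha k gamma rho0 n0 rho n.

Lemma measurable_rho : measurable_fun (open_half : set plane) rho.
Proof. by have /L1loc_measurable/measurable_EFinP := ws_rho_L1loc sol. Qed.

Lemma measurable_n : measurable_fun (open_half : set plane) n.
Proof. by have /L1loc_measurable/measurable_EFinP := ws_n_L1loc sol. Qed.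

Lemma measurable_kin : measurable_fun (open_half : set plane) (fun p => n p ^+ 2 / rho p).
Proof.
apply: measurable_funM; first by apply: measurable_funX; exact: measurable_n.
by apply: measurable_inv; exact: measurable_rho.
Qed.

Lemma measurable_pr : measurable_fun (open_half : set plane) (fun p => pressure k gamma (rho p)).
Proof. by have /L1loc_measurable/measurable_EFinP := ws_pressure_L1loc sol. Qed.

(** The real quotient, which is 0 on the vacuum, is dominated by [kinetic], which may be +oo
    there. *)
Lemma kin_box T M : mu2.-integrable (box T M) (EFin \o (fun p => n p ^+ 2 / rho p)).
Proof.
have mb := @measurable_box R T M.
have := L1loc_box T M (ws_kinetic_L1loc sol).
apply: (le_integrable mb) => [|p _].
  apply/measurable_EFinP; apply: measurable_funS measurable_kin => //.
  exact: box_open.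
by rewrite /kinetic /=; case: ifPn => // _; rewrite leey.
Qed.

Lemma integrable_rho0 M : mu.-integrable `[- M, M] (EFin \o rho0).
Proof.
have [m0 _ i0] := ws_rho0_L1loc sol.
apply/integrableP; split; last by apply: i0 => //; exact: segment_compact.
exact/measurable_EFinP/measurable_funTS.
Qed.

Lemma integrable_n0 M : mu.-integrable `[- M, M] (EFin \o n0).
Proof.
have [m0 _ i0] := ws_n0_L1loc sol.
apply/integrableP; split; last by apply: i0 => //; exact: segment_compact.
exact/measurable_EFinP/measurable_funTS.
Qed.

Lemma rho_box T M : mu2.-integrable (box T M) (EFin \o rho).
Proof. exact: L1loc_box (ws_rho_L1loc sol). Qed.

Lemma n_box T M : mu2.-integrable (box T M) (EFin \o n).
Proof. exact: L1loc_box (ws_n_L1loc sol). Qed.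

Lemma pr_box T M : mu2.-integrable (box T M) (EFin \o (fun p => pressure k gamma (rho p))).
Proof. exact: L1loc_box (ws_pressure_L1loc sol). Qed.

Lemma y_box T M (F : R * R -> R) : mu2.-integrable (box T M) (EFin \o F) ->
  mu2.-integrable (box T M) (EFin \o (fun p => - (p.2 / 2) * F p)).
Proof.
have mb := @measurable_box R T M.
apply: (integrable_bounded_mul mb _ (@measurable_snd_half_box T M)).
by apply: measurable_funS measurable_snd_half => //; exact: box_open.
Qed.

Lemma exp_box T M (F : R * R -> R) : mu2.-integrable (box T M) (EFin \o F) ->
  mu2.-integrable (box T M) (EFin \o (fun p => expR p.1 * F p)).
Proof.
have mb := @measurable_box R T M.
apply: (@integrable_bounded_mul _ _ _ (expR T) mb) => [|p [_ [pT _]]].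
  apply: measurable_funS (measurable_fst_fun (@measurable_expR R)) => //.
  exact: box_open.
by rewrite ger0_norm ?expR_ge0// ler_expR.
Qed.

Definition mass_flux p : R := - (p.2 / 2) * rho p + n p.
Definition momentum_flux p : R :=
  - (p.2 / 2) * n p + n p ^+ 2 / rho p + expR p.1 * pressure k gamma (rho p).

Lemma mass_test u ut uy : admissible u ut uy ->
  weak_null rho mass_flux (fun p => - 2^-1 * rho p) rho0 u ut uy.
Proof.
move=> [C [N [C0 du u0 uC uN]]].
have mr := measurable_rho; have mn := measurable_n; have my := measurable_snd_half.
have [m0 _ _] := ws_rho0_L1loc sol.
apply: (weak_null_C1 _ _ _ _ _ _ _ _ _ C0 du u0 uC uN) => //.
- by apply: measurable_funD => //; exact: measurable_funM.
- exact: measurable_funM.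
- by move=> T M; exact: rho_box.
- move=> T M; apply: integrable_RD; first exact: measurable_box.
    by apply: y_box; exact: rho_box.
  exact: n_box.
- by move=> T M; apply: integrable_RZ; [exact: measurable_box|exact: rho_box].
- exact: integrable_rho0.
- move=> a b sa sb [N' abN].
  have := ws_mass sol (test_fun2_tensor sa sb abN).
  rewrite (tensor_tau b sa).1 (tensor_y a sb).1 => E.
  rewrite /weak_form /wini -E; apply/eqP; rewrite subr_eq0; apply/eqP.
  by apply: eq_Rintegral => p _; rewrite /wint /mass_flux; ring.
Qed.

Lemma momentum_test u ut uy : admissible u ut uy ->
  weak_null n momentum_flux (fun p => - alpha * (expR p.1 * n p)) n0 u ut uy.
Proof.
move=> [C [N [C0 du u0 uC uN]]].
have mr := measurable_rho; have mn := measurable_n; have my := measurable_snd_half.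
have me := measurable_fst_fun (@measurable_expR R).
have [m0 _ _] := ws_n0_L1loc sol.
apply: (weak_null_C1 _ _ _ _ _ _ _ _ _ C0 du u0 uC uN) => //.
- apply: measurable_funD; last by apply: measurable_funM => //; exact: measurable_pr.
  by apply: measurable_funD; [exact: measurable_funM|exact: measurable_kin].
- by apply: measurable_funM => //; exact: measurable_funM.
- by move=> T M; exact: n_box.
- move=> T M; apply: integrable_RD; first exact: measurable_box.
    apply: integrable_RD; first exact: measurable_box.
      by apply: y_box; exact: n_box.
    exact: kin_box.
  by apply: exp_box; exact: pr_box.
- move=> T M; apply: integrable_RZ; first exact: measurable_box.
  by apply: exp_box; exact: n_box.
- exact: integrable_n0.
- move=> a b sa sb [N' abN].
  have := ws_momentum sol (test_fun2_tensor sa sb abN).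
  rewrite (tensor_tau b sa).1 (tensor_y a sb).1 => E.
  rewrite /weak_form /wini -E; apply/eqP; rewrite subr_eq0; apply/eqP.
  by apply: eq_Rintegral => p _; rewrite /wint /momentum_flux; ring.
Qed.

End mass_momentum.

End weak_solutions.

(** * Integration by parts against admissible test functions *)

Section identities.
Context {R : realType}.
Local Notation mu := (@lebesgue_measure R).
Local Notation plane := (measurableTypeR R * measurableTypeR R)%type.
Local Notation mu2 := (mu \x mu)%E.
Implicit Types (u ut uy : R * R -> R) (a b : R -> R).

Let mo := @measurable_open_half R.

Lemma FTC_smooth a (x y : R) : smooth a -> x < y ->
  (\int[mu]_(t in `[x, y]) (derive1 a t)%:E = (a y - a x)%:E)%E.
Proof.
move=> sa xy; have [da sa'] := smooth_derive sa.
have ca : continuous a by exact: smooth_continuous.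
rewrite (continuous_FTC2 (F := a)) ?EFinB//.
- exact/continuous_subspaceT/smooth_continuous.
- split.
  + by move=> z _; case: (da z).
  + exact: cvg_at_right_filter (ca x).
  + exact: cvg_at_left_filter (ca y).
Qed.

Lemma integral_supp (f : R -> R) (D E : set R) :
  E `<=` D -> (forall t, D t -> ~ E t -> f t = 0) ->
  (\int[mu]_(t in D) (f t)%:E = \int[mu]_(t in E) (f t)%:E)%E.
Proof.
move=> ED fE; rewrite integral_mkcond [RHS]integral_mkcond.
apply: eq_integral => t _; rewrite !patchE; case: ifPn => [/set_mem Dt|/negP Dt].
  by case: ifPn => // /negP Et; rewrite fE// => ?; apply: Et; rewrite inE.
rewrite ifF//; apply/negP => /set_mem /ED ?; apply: Dt; exact/mem_set.
Qed.

Lemma integral_derive a (N : R) : smooth a -> (forall t, N <= `|t| -> a t = 0) ->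
  (\int[mu]_t (derive1 a t)%:E = 0)%E /\
  (\int[mu]_(t in `]0%R, +oo[) (derive1 a t)%:E = (- a 0)%:E)%E.
Proof.
move=> sa aN; pose M := `|N| + 1.
have M0 : 0 < M by rewrite ltr_wpDl.
have aM t : M <= `|t| -> a t = 0 /\ derive1 a t = 0.
  move=> Mt; have NM := ler_norm N.
  by split; [apply: aN; rewrite /M in Mt; lra|apply: (derive1_supp sa aN); rewrite /M in Mt; lra].
have hM : M <= `|M| by rewrite ler_norm.
have hM' : M <= `|- M| by rewrite normrN.
split.
  rewrite (@integral_supp _ setT `[- M, M]%classic)//.
    rewrite FTC_smooth//; last by lra.
    by rewrite (aM _ hM).1 (aM _ hM').1 subrr.
  move=> t _ /=; rewrite in_itv/= -ler_norml => /negP; rewrite -ltNge => /ltW.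
  by move=> /aM[].
rewrite (@integral_supp _ _ `]0, M]%classic)//; last 2 first.
- by move=> t /=; rewrite !in_itv/= andbT => /andP[].
- move=> t /=; rewrite !in_itv/= andbT => t0 /negP; rewrite t0 -ltNge => /ltW.
  by rewrite -{1}(gtr0_norm t0) => /aM[].
rewrite integral_itv_obnd_cbnd; last first.
  apply/measurable_EFinP; apply: measurable_funTS.
  apply: continuous_measurable_fun; exact: smooth_continuous (smooth_derive sa).2.
by rewrite FTC_smooth// (aM _ hM).1 sub0r.
Qed.

Lemma integrable_smooth a (N : R) : smooth a -> (forall t, N <= `|t| -> a t = 0) ->
  mu.-integrable setT (EFin \o a).
Proof.
move=> sa aN.
have ca : continuous a by exact: smooth_continuous.
have : mu.-integrable `[- N, N] (EFin \o a).
  apply: continuous_compact_integrable; first exact: segment_compact.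
  exact: continuous_subspaceT.
have mI : measurable (`[- N, N]%classic : set (measurableTypeR R)).
  exact: measurable_itv.
move=> /(integrable_mkcond _ mI).
apply: eq_integrable => // t _; rewrite patchE; case: ifPn => //.
move=> /negP; rewrite inE/= in_itv/= -ler_norml => /negP; rewrite -ltNge => /ltW.
by move=> /aN ->.
Qed.


Lemma EFin_Rintegral d (T : measurableType d) (nu : {measure set T -> \bar R})
    (D : set T) (F : T -> R) : measurable D -> nu.-integrable D (EFin \o F) ->
  (\int[nu]_(x in D) (F x)%:E = (\int[nu]_(x in D) F x)%R%:E)%E.
Proof. by move=> mD iF; rewrite /Rintegral fineK//; exact: integrable_fin_num. Qed.

Lemma one_box T M : mu2.-integrable (box T M) (EFin \o cst (1 : R)).
Proof.
apply: measurable_bounded_integrable.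
- exact: measurable_box.
- rewrite [X in (X < _)%E](_ : _ =
      (mu `]0%R, T]%classic * mu `[(- M)%R, M]%classic)%E); last first.
    rewrite -product_measure1E; try exact: measurable_itv.
    congr (_ _); apply/seteqP; split => p; rewrite /box /= !in_itv/= -ler_norml.
      by case=> -> [-> ->].
    by case=> /andP[-> ->] ->.
  by rewrite !lebesgue_measure_itv/= !lte_fin; case: ifPn => _; case: ifPn => _;
    rewrite ?mule0 ?mul0e// -!EFinB -EFinM ltry.
- exact: measurable_cst.
- exact: bounded_cst.
Qed.

Lemma one_itv M : mu.-integrable `[- M, M] (EFin \o cst (1 : R)).
Proof.
apply: continuous_compact_integrable; first exact: segment_compact.
by apply: continuous_subspaceT => x; exact: cvg_cst.
Qed.

Lemma Ck_id m : Ck m (@id R).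
Proof.
case: m => [//|m]; exists (cst 1); split; last exact: Ck_cst.
by move=> x; exact: is_derive_id.
Qed.

(* (rho, n) = (1, 0) solves the mass equation. *)
Lemma mass_one_test u ut uy : admissible u ut uy ->
  weak_null (cst 1) (fun p => - (p.2 / 2)) (cst (- 2^-1)) (cst 1) u ut uy.
Proof.
move=> [C [N [C0 du u0 uC uN]]]; have my := @measurable_snd_half R.
have y2_box T M : mu2.-integrable (box T M) (EFin \o (fun p => - (p.2 / 2))).
  have := y_box (one_box T M); apply: eq_integrable; first exact: measurable_box.
  by move=> p _ /=; rewrite mulr1.
have half_box T M : mu2.-integrable (box T M) (EFin \o cst (- 2^-1 : R)).
  have := integrable_RZ (@measurable_box R T M) (- 2^-1) (one_box T M).
  apply: eq_integrable; first exact: measurable_box.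
  by move=> p _ /=; rewrite mulr1.
apply: (weak_null_C1 _ _ _ _ _ _ _ _ _ C0 du u0 uC uN) => //.
- by move=> T M; exact: one_box.
- exact: one_itv.
- move=> a b sa sb [N' abN].
  have [i1 i2] := weak_int_smooth (f := cst 1) (g := fun p => - (p.2 / 2))
    (q := cst (- 2^-1)) (f0 := cst 1) (measurable_cst _) my (measurable_cst _)
    (measurable_cst _) one_box y2_box half_box one_itv sa sb
    (fun t h => (abN t h).1) (fun t h => (abN t h).2).
  have [i3 _ E] := fubini_half i1.
  have [db _] := smooth_derive sb.
  have sd : smooth (fun y => y * b y) by move=> m; apply: CkM; [exact: Ck_id|exact: sb].
  have bN t (h : N' <= `|t|) := (abN t h).2.
  have aN t (h : N' <= `|t|) := (abN t h).1.
  have dN t : N' <= `|t| -> t * b t = 0 by move=> /bN ->; rewrite mulr0.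
  (* The integrand a' b - (y / 2) a b' - a b / 2 equals a' b - (a / 2) (y b)'. Its integral over y
     is a' times the integral of b, and integrating a' over tau > 0 produces -a(0), which cancels
     the initial term. *)
  have dE y : derive1 (fun y => y * b y) y = b y + y * derive1 b y.
    rewrite (is_derive_derive1 (fun y => is_deriveM (is_derive_id y 1) (db y))).
    by rewrite /GRing.scale/= mulr1 addrC.
  have ib := integrable_smooth sb bN.
  have id : mu.-integrable setT (EFin \o derive1 (fun y => y * b y)).
    apply: (@integrable_smooth _ (N' + 1)); first exact: (smooth_derive sd).2.
    by move=> t h; apply: (derive1_supp sd dN); lra.
  have d0 : \int[mu]_y derive1 (fun y => y * b y) y = 0.
    by rewrite /Rintegral (integral_derive sd dN).1.
  pose B := \int[mu]_y b y.
  rewrite /weak_form {1}/Rintegral E.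
  rewrite (_ : \int[mu]_y _ = a 0 * B); last first.
    rewrite -RintegralZl//; apply: eq_Rintegral => y _.
    by rewrite /wini mulr1.
  rewrite (_ : integral _ _ _ = (- a 0 * B)%:E); first by rewrite /= mulNr addNr.
  transitivity (\int[mu]_(t in `]0%R, +oo[) ((derive1 a t)%:E * B%:E))%E.
    apply: eq_integral => t _.
    have F1 : mu.-integrable setT (EFin \o (fun y => derive1 a t * b y)).
      exact: integrable_RZ.
    have F2 : mu.-integrable setT (EFin \o (fun y =>
        (- (a t / 2)) * derive1 (fun y => y * b y) y)).
      exact: integrable_RZ.
    have -> : (fun y => (wint (cst 1) (fun p => - (p.2 / 2)) (cst (- 2^-1))
        (fun p : R * R => a p.1 * b p.2) (fun p => derive1 a p.1 * b p.2)
        (fun p => a p.1 * derive1 b p.2) (t, y))%:E) =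
      EFin \o (fun y => derive1 a t * b y +
               (- (a t / 2)) * derive1 (fun y => y * b y) y).
      by apply/funext => y; rewrite /wint /= dE; congr EFin; field.
    rewrite EFin_Rintegral//; last exact: integrable_RD.
    by rewrite RintegralD// !RintegralZl// d0 mulr0 addr0 EFinM.
  rewrite integralZr//; first by rewrite (integral_derive sa aN).2.
    apply: (integrableS measurableT) => //.
    apply: (@integrable_smooth _ (N' + 1)); first exact: (smooth_derive sa).2.
    by move=> t h; apply: (derive1_supp sa aN); lra.
Qed.

(** The integral of u_y vanishes. Phrasing this as a weak form reduces it to smooth tensor products
    by the approximation already at hand. *)
Lemma y_derivative_test u ut uy : admissible u ut uy ->
  weak_null (cst 0) (cst 1) (cst 0) (cst 0) u ut uy.
Proof.
move=> [C [N [C0 du u0 uC uN]]].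
have zero_box T M : mu2.-integrable (box T M) (EFin \o cst (0 : R)).
  apply: (eq_integrable (@measurable_box R T M) (cst 0%E)) => //.
  exact: integrable0.
have zero_itv M : mu.-integrable `[- M, M] (EFin \o cst (0 : R)).
  apply: (eq_integrable _ (cst 0%E)) => //.
  exact: integrable0.
apply: (weak_null_C1 _ _ _ _ _ _ _ _ _ C0 du u0 uC uN) => //.
- by move=> T M; exact: one_box.
- move=> a b sa sb [N' abN].
  have [i1 i2] := weak_int_smooth (f := cst 0) (g := cst 1)
    (q := cst 0) (f0 := cst 0) (measurable_cst _) (measurable_cst _) (measurable_cst _)
    (measurable_cst _) zero_box one_box zero_box zero_itv sa sb
    (fun t h => (abN t h).1) (fun t h => (abN t h).2).
  have [i3 _ E] := fubini_half i1.
  have bN t (h : N' <= `|t|) := (abN t h).2.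
  have id : mu.-integrable setT (EFin \o derive1 b).
    apply: (@integrable_smooth _ (N' + 1)); first exact: (smooth_derive sb).2.
    by move=> t h; apply: (derive1_supp sb bN); lra.
  have d0 : \int[mu]_y derive1 b y = 0.
    by rewrite /Rintegral (integral_derive sb bN).1.
  rewrite /weak_form {1}/Rintegral E.
  rewrite (_ : \int[mu]_y _ = 0); last first.
    rewrite (@eq_Rintegral _ _ _ _ _ (cst 0)) ?Rintegral_cst ?mul0r//.
    by move=> y _; rewrite /wini mulr0.
  rewrite integral0_eq ?add0r// => t _.
  have -> : (fun y => (wint (cst 0) (cst 1) (cst 0)
      (fun p : R * R => a p.1 * b p.2) (fun p => derive1 a p.1 * b p.2)
      (fun p => a p.1 * derive1 b p.2) (t, y))%:E) =
    EFin \o (fun y => a t * derive1 b y).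
    by apply/funext => y; rewrite /wint /= ; congr EFin; ring.
  rewrite EFin_Rintegral//; last exact: integrable_RZ.
  by rewrite RintegralZl// d0 mulr0.
Qed.

End identities.

(** * Calculus of C^1 functions on the half-plane *)

Section regular_functions.
Context {R : realType}.
Local Notation plane := (measurableTypeR R * measurableTypeR R)%type.
Implicit Types (c ct cy d dt dy : R * R -> R) (a b : R -> R).

(** Coefficient functions with explicit partial derivatives, bounded on bounded sets up to tau = 0
    but differentiable only for tau > 0. The class is stable under sums, products and composition,
    so the coefficients of the gap belong to it, and cutting off gives admissible test functions. *)
Definition reg c ct cy :=
  [/\ forall t y : R, 0 < t -> is_derive t 1 (fun s => c (s, y)) (ct (t, y)) /\
                               is_derive y 1 (fun z => c (t, z)) (cy (t, y)),
      forall p, open_half p -> [/\ {for p, continuous c}, {for p, continuous ct} &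
                                {for p, continuous cy}],
      forall y, c (s, y) @[s --> 0^'+] --> c (0, y) &
      forall N : R, exists2 C, 0 <= C & forall p, open_half p -> p.1 <= N -> `|p.2| <= N ->
         [/\ `|c p| <= C, `|ct p| <= C & `|cy p| <= C]].

Lemma reg_mul c ct cy d dt dy : reg c ct cy -> reg d dt dy ->
  reg (fun p => c p * d p) (fun p => ct p * d p + c p * dt p)
      (fun p => cy p * d p + c p * dy p).
Proof.
move=> [c1 c2 c3 c4] [d1 d2 d3 d4]; split.
- move=> t y t0; have [ct' cy'] := c1 t y t0; have [dt' dy'] := d1 t y t0; split.
    by apply: (is_derive_eq (is_deriveM ct' dt')); rewrite /GRing.scale/=; ring.
  by apply: (is_derive_eq (is_deriveM cy' dy')); rewrite /GRing.scale/=; ring.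
- move=> p p0; have [h1 h2 h3] := c2 p p0; have [g1 g2 g3] := d2 p p0.
  by split; [exact: cvgM| |]; apply: cvgD; exact: cvgM.
- by move=> y; exact: cvgM.
- move=> N; have [C C0 hC] := c4 N; have [D D0 hD] := d4 N.
  exists (C * D + C * D); first by rewrite addr_ge0 ?mulr_ge0.
  move=> p p0 p1 p2.
  have [h1 h2 h3] := hC p p0 p1 p2; have [g1 g2 g3] := hD p p0 p1 p2.
  split; first by rewrite normrM (le_trans (ler_pM _ _ h1 g1))// lerDl mulr_ge0.
    by rewrite (le_trans (ler_normD _ _))// !normrM lerD// ler_pM.
  by rewrite (le_trans (ler_normD _ _))// !normrM lerD// ler_pM.
Qed.

Lemma reg_add c ct cy d dt dy : reg c ct cy -> reg d dt dy ->
  reg (fun p => c p + d p) (fun p => ct p + dt p) (fun p => cy p + dy p).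
Proof.
move=> [c1 c2 c3 c4] [d1 d2 d3 d4]; split.
- move=> t y t0; have [ct' cy'] := c1 t y t0; have [dt' dy'] := d1 t y t0.
  by split; exact: is_deriveD.
- move=> p p0; have [h1 h2 h3] := c2 p p0; have [g1 g2 g3] := d2 p p0.
  by split; exact: cvgD.
- by move=> y; exact: cvgD.
- move=> N; have [C C0 hC] := c4 N; have [D D0 hD] := d4 N.
  exists (C + D); first by rewrite addr_ge0.
  move=> p p0 p1 p2.
  have [h1 h2 h3] := hC p p0 p1 p2; have [g1 g2 g3] := hD p p0 p1 p2.
  by split; rewrite (le_trans (ler_normD _ _))// lerD.
Qed.

Lemma reg_cst (x : R) : reg (cst x) (cst 0) (cst 0).
Proof.
split.
- by move=> t y t0; split; exact: is_derive_cst.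
- by move=> p p0; split; exact: cvg_cst.
- by move=> y; exact: cvg_cst.
- by move=> N; exists `|x| => // p _ _ _; split; rewrite /= ?normr0.
Qed.

Lemma reg_time a a' : (forall t : R, is_derive t 1 a (a' t)) -> continuous a' ->
  reg (fun p => a p.1) (fun p => a' p.1) (cst 0).
Proof.
move=> da ca'; have ca : continuous a by move=> t; exact: derivable_cvg (da t).
split.
- by move=> t y t0; split; [exact: da|exact: (is_derive_cst (a t) y (1 : R))].
- move=> p p0; split; [exact: (continuous_fst (ca p.1))|exact: (continuous_fst (ca' p.1))|exact: cvg_cst].
- by move=> y; exact: cvg_at_right_filter (ca 0).
- move=> N; have [C C0 hC] := continuous_bounded N ca.
  have [D D0 hD] := continuous_bounded N ca'.
  exists (C + D); first by rewrite addr_ge0.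
  move=> p p0 p1 p2; have p1' : `|p.1| <= N by rewrite gtr0_norm.
  split; [|by rewrite (le_trans (hD _ p1'))// lerDr|by rewrite /= normr0 addr_ge0].
  by rewrite (le_trans (hC _ p1'))// lerDl.
Qed.

Lemma reg_space b b' : (forall t : R, is_derive t 1 b (b' t)) -> continuous b' ->
  reg (fun p => b p.2) (cst 0) (fun p => b' p.2).
Proof.
move=> db cb'; have cb : continuous b by move=> t; exact: derivable_cvg (db t).
split.
- by move=> t y t0; split; [exact: (is_derive_cst (b y) t (1 : R))|exact: db].
- move=> p p0; split; [exact: (continuous_snd (cb p.2))|exact: cvg_cst|exact: (continuous_snd (cb' p.2))].
- by move=> y; exact: (cvg_cst (b y)).
- move=> N; have [C C0 hC] := continuous_bounded N cb.
  have [D D0 hD] := continuous_bounded N cb'.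
  exists (C + D); first by rewrite addr_ge0.
  move=> p p0 p1 p2; split; [|by rewrite /= normr0 addr_ge0|].
    by rewrite (le_trans (hC _ p2))// lerDl.
  by rewrite (le_trans (hD _ p2))// lerDr.
Qed.

Lemma bounded_on_segment a (x y : R) : {in `[x, y], forall z, {for z, continuous a}} ->
  exists2 C : R, 0 <= C & forall z, x <= z <= y -> `|a z| <= C.
Proof.
move=> ca; have [xy|yx] := leP x y; last first.
  exists 0 => // z /andP[xz zy].
  by move: (le_lt_trans (le_trans xz zy) yx); rewrite ltxx.
have ca' : {within `[x, y], continuous (fun z => `|a z|)}.
  apply: continuous_in_subspaceT => z /set_mem zxy.
  by apply: (continuous_comp (ca z zxy)); exact: norm_continuous.
have [c _ hc] := EVT_max xy ca'.
by exists `|a c| => // z zxy; apply: hc; rewrite in_itv.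
Qed.

(** The lower bound keeps c in a compact interval [l, C] on bounded sets, away from the possible
    singularity of [a] at 0, and [a], [a'] are bounded there. *)
Lemma reg_comp a a' c ct cy (l : R) : 0 < l -> 
  (forall x : R, 0 < x -> is_derive x 1 a (a' x)) ->
  (forall x, 0 < x -> {for x, continuous a'}) ->
  (forall p, closed_half p -> l <= c p) ->
  reg c ct cy ->
  reg (fun p => a (c p)) (fun p => a' (c p) * ct p) (fun p => a' (c p) * cy p).
Proof.
move=> l0 da ca' lc [c1 c2 c3 c4].
have ca x : 0 < x -> {for x, continuous a} by move=> x0; exact: derivable_cvg (da x x0).
have c_gt0 p : open_half p -> 0 < c p.
  by move=> p0; rewrite (lt_le_trans l0)// lc//; exact: ltW.
split.
- move=> t y t0; have [ct' cy'] := c1 t y t0; have c0 := c_gt0 (t, y) t0.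
  by split; [exact: (is_derive1_comp (da _ c0) ct')|exact: (is_derive1_comp (da _ c0) cy')].
- move=> p p0; have [h1 h2 h3] := c2 p p0; have c0 := c_gt0 p p0.
  have h4 : {for p, continuous (fun p => a' (c p))}.
    exact: (cvg_comp _ _ h1 (ca' _ c0)).
  split; [|exact: cvgM|exact: cvgM].
  exact: (cvg_comp _ _ h1 (ca _ c0)).
- move=> y; have c0 : 0 < c (0, y).
    by rewrite (lt_le_trans l0)// lc//= /closed_half/= lexx.
  exact: (cvg_comp _ _ (c3 y) (ca _ c0)).
- move=> N; have [C C0 hC] := c4 N.
  have [|A A0 hA] := @bounded_on_segment a l C.
    by move=> z; rewrite in_itv/= => /andP[lz _]; apply: ca; exact: lt_le_trans lz.
  have [|A' A'0 hA'] := @bounded_on_segment a' l C.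
    by move=> z; rewrite in_itv/= => /andP[lz _]; apply: ca'; exact: lt_le_trans lz.
  exists (A + A' * C); first by rewrite addr_ge0// mulr_ge0.
  move=> p p0 p1 p2; have [h1 h2 h3] := hC p p0 p1 p2.
  have lcC : l <= c p <= C.
    by rewrite lc ?(le_trans (ler_norm _) h1)//; exact: ltW.
  split; first by rewrite (le_trans (hA _ lcC))// lerDl mulr_ge0.
    by rewrite normrM (le_trans (ler_pM _ _ (hA' _ lcC) h2))// lerDr.
  by rewrite normrM (le_trans (ler_pM _ _ (hA' _ lcC) h3))// lerDr.
Qed.

Lemma line_cvg_tau c (t y : R) : {for (t, y), continuous c} ->
  c (s, y) @[s --> t] --> c (t, y).
Proof.
move=> cc; apply: (@cvg_comp _ _ _ (fun s : R => (s, y)) c _ (nbhs (t, y)) _ _ cc).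
exact: (@cvg_pair _ _ _ (nbhs t) (nbhs t) (nbhs y) _ _ _ id (cst y) cvg_id (cvg_cst y)).
Qed.

Lemma line_cvg_y c (t y : R) : {for (t, y), continuous c} ->
  c (t, z) @[z --> y] --> c (t, y).
Proof.
move=> cc; apply: (@cvg_comp _ _ _ (fun z : R => (t, z)) c _ (nbhs (t, y)) _ _ cc).
exact: (@cvg_pair _ _ _ (nbhs y) (nbhs t) (nbhs y) _ _ _ (cst t) id (cvg_cst t) cvg_id).
Qed.

Lemma reg_measurable c ct cy : reg c ct cy ->
  [/\ measurable_fun (open_half : set plane) c, measurable_fun (open_half : set plane) ct &
      measurable_fun (open_half : set plane) cy].
Proof.
move=> [_ h _ _]; split; apply: continuous_measurable_plane => [|p /h[//]];
  exact: open_open_half.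
Qed.

(** Bounds up to N + 1 suffice: beyond, c vanishes in a neighbourhood of the point, hence so do its
    derivatives. *)
Lemma reg_admissible c ct cy (N : R) : reg c ct cy ->
  (forall p, open_half p -> N <= p.1 \/ N <= `|p.2| -> c p = 0) ->
  admissible c ct cy.
Proof.
move=> [c1 c2 c3 c4] cN; have [C C0 hC] := c4 (N + 1).
exists C, N; split => //.
- move=> t y t0; have [d1 d2] := c1 t y t0; have [e1 e2 e3] := c2 (t, y) t0.
  by split => //; [exact: line_cvg_tau|exact: line_cvg_tau|exact: line_cvg_y].
- move=> [t y] t0; have [d1 d2] := c1 t y t0.
  have [tN|tN] := leP t (N + 1).
    have [yN|yN] := leP `|y| (N + 1); first exact: hC.
    have E z : N <= `|z| -> forall s, 0 < s -> c (s, z) = 0.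
      by move=> Nz s s0; apply: cN => //; right.
    have yN' : N < `|y| by lra.
    rewrite (E y (ltW yN') t t0) (is_derive_eq0 _ d1).
      rewrite (is_derive_eq0 _ d2) ?normr0//.
      apply: (@filterS _ _ _ (fun z => N < `|z|)) => [z Nz|]; first by rewrite E// ltW.
      have h' : nbhs `|y| [set y | N < y] by exact: lt_nbhsr.
      exact: (norm_continuous h').
    apply: (@filterS _ _ _ (fun s => 0 < s)) => [s s0|]; first by rewrite E// ltW.
    exact: lt_nbhsr.
  have E s z : 0 < s -> N <= s -> c (s, z) = 0.
    by move=> s0 Ns; apply: cN => //; left.
  have tN' : N < t by lra.
  rewrite (E t y t0 (ltW tN')) (is_derive_eq0 _ d1).
    rewrite (is_derive_eq0 _ d2) ?normr0//.
    by near=> z; apply: E => //; exact: ltW.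
  near=> s; apply: E; first by near: s; exact: lt_nbhsr.
  by apply: ltW; near: s; exact: lt_nbhsr.
Unshelve. all: by end_near. Qed.

Lemma within_open_continuous c p : {within closed_half, continuous c} -> open_half p ->
  {for p, continuous c}.
Proof.
move=> cc p0.
have cc' : {within open_half, continuous c}.
  by apply: continuous_subspaceW cc => q q0; exact: (ltW q0).
by move: cc'; rewrite (continuous_open_subspace _ (@open_open_half R)) => /(_ p (mem_set p0)).
Qed.

Lemma within_right_cvg c (y : R) : {within closed_half, continuous c} ->
  c (s, y) @[s --> 0^'+] --> c (0, y).
Proof.
move=> /(_ (0, y)) cc A cA.
have y0 : closed_half ((0 : R), y) by rewrite /closed_half /=.
have := cc A cA; rewrite /nbhs/= -(nbhs_subspace_in y0) => h.
have pc : (fun s : R => (s, y)) @ (0 : R) --> nbhs ((0 : R), y).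
  exact: (@cvg_pair _ _ _ (nbhs (0 : R)) (nbhs (0 : R)) (nbhs y) _ _ _ id (cst y) cvg_id (cvg_cst y)).
apply: (@filterS _ (nbhs (0 : R)) _ _ _ _ (pc _ h)) => s /= hs s0.
by apply: hs; exact: ltW.
Qed.

End regular_functions.

(** * The cutoff identity for the relative entropy gap *)

Section cutoff_identity.
Context {R : realType}.
Local Notation mu := (@lebesgue_measure R).
Local Notation plane := (measurableTypeR R * measurableTypeR R)%type.
Local Notation mu2 := (mu \x mu)%E.
Variables (alpha k gamma : R) (rho0 n0 : R -> R) (rho n rhob nb : R * R -> R).
Variables (roo w w' pinf : R -> R).
Hypothesis sol : weak_solution alpha k gamma rho0 n0 rho n.
Hypothesis rhob_reg : reg rhob (Dtau rhob) (Dy rhob).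
Hypothesis nb_reg : reg nb (Dtau nb) (Dy nb).
Variable l : R.
Hypothesis l0 : 0 < l.
Hypothesis rhob_ge : forall p, closed_half p -> l <= rhob p.
Hypothesis w_derive : forall y : R, is_derive y 1 w (w' y).
Hypothesis w'_cont : continuous w'.
Hypothesis roo_cont : continuous roo.
Hypothesis pinf_derive : forall y : R, is_derive y 1 pinf (roo y * w' y).
Hypothesis no_vacuum_momentum :
  {ae mu2, forall p, open_half p -> rho p = 0 -> n p = 0}.

Local Notation V := (velocity rhob nb).
Let mo := @measurable_open_half R.

(** The coefficient of rho in the gap; [kappa] below is the part free of (rho, n), and [pinf] stands
    for p(rho_oo). *)
Definition beta (p : R * R) : R :=
  2^-1 * expR (- p.1) * V p ^+ 2 - dpot k gamma (rhob p) + w p.2.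
Definition kappa (p : R * R) : R := pressure k gamma (rhob p) - pinf p.2.
Definition gap (rho n : R * R -> R) (p : R * R) : R :=
  - expR (- p.1) * V p * n p + beta p * rho p + kappa p.
(** [gap], [flux] and [source] satisfy gap_tau + flux_y = source in the weak sense, which is what
    [cutoff_identity] expresses. *)
Definition flux (p : R * R) : R :=
  - (p.2 / 2) * gap rho n p + beta p * n p
  - expR (- p.1) * V p * (n p ^+ 2 / rho p)
  - V p * (pressure k gamma (rho p) - pressure k gamma (rhob p)).
(** Arranged as the difference between the claimed inequality and the total relative entropy
    condition: xi enters, half of the gap and the change in the friction term are moved to the left
    side, and the drift h'(rho_oo)_y (y / 2 (rho - rho_oo) - n) is removed. *)
Definition source (p : R * R) : R :=
  xi alpha k gamma rhob nb rho n p - 2^-1 * gap rho n p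
  - alpha * (- 2 * V p * n p + rho p * V p ^+ 2)
  - w' p.2 * (p.2 / 2 * (rho p - roo p.2) - n p).

Lemma powR_continuous (x a : R) : 0 < x -> {for x, continuous (fun x : R => x `^ a)}.
Proof. by move=> x0; exact: derivable_cvg (is_derive1_powR a x0). Qed.

Lemma ddpot_continuous (x : R) : 0 < x -> {for x, continuous (ddpot k gamma)}.
Proof. by move=> x0; apply: cvgM; [exact: cvg_cst|exact: powR_continuous]. Qed.

Lemma dpressure_continuous (x : R) : 0 < x -> {for x, continuous (dpressure k gamma)}.
Proof. by move=> x0; apply: cvgM; [exact: cvg_cst|exact: powR_continuous]. Qed.

Lemma dpressureE (x : R) : 0 < x -> dpressure k gamma x = x * ddpot k gamma x.
Proof.
move=> x0; rewrite /dpressure /ddpot mulrCA; congr (_ * _).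
rewrite -[X in X * _](powRr1 (ltW x0)) -powRD; last by rewrite (gt_eqF x0) implybT.
by congr (_ `^ _); ring.
Qed.

Lemma inv_reg : reg (fun p => (rhob p)^-1) (fun p => - (rhob p) ^- 2 * Dtau rhob p)
  (fun p => - (rhob p) ^- 2 * Dy rhob p).
Proof.
apply: (reg_comp (a := GRing.inv) (a' := fun x => - x ^- 2) l0 _ _ rhob_ge rhob_reg).
  move=> x x0; have := is_deriveV (lt0r_neq0 x0) (is_derive_id x (1 : R)).
  by move=> h; apply: (is_derive_eq h); rewrite /GRing.scale/= mulr1.
move=> x x0; apply: cvgN; apply: cvgV; first by rewrite expf_neq0// gt_eqF.
by apply: cvgM; exact: cvg_id.
Qed.

(** Given as a term, so that the partial derivatives are the expressions computed by [reg_mul]; the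
    same is done for the coefficients of the gap below. *)
Definition V_reg := reg_mul nb_reg inv_reg.

Lemma dpot_reg : reg (fun p => dpot k gamma (rhob p))
  (fun p => ddpot k gamma (rhob p) * Dtau rhob p)
  (fun p => ddpot k gamma (rhob p) * Dy rhob p).
Proof.
apply: (reg_comp l0 _ _ rhob_ge rhob_reg); last exact: ddpot_continuous.
by move=> x; exact: is_derive_dpot.
Qed.

Lemma pressure_reg : reg (fun p => pressure k gamma (rhob p))
  (fun p => dpressure k gamma (rhob p) * Dtau rhob p)
  (fun p => dpressure k gamma (rhob p) * Dy rhob p).
Proof.
apply: (reg_comp l0 _ _ rhob_ge rhob_reg); last exact: dpressure_continuous.
by move=> x; exact: is_derive_pressure.
Qed.

Lemma exp_reg : reg (fun p : R * R => expR (- p.1)) (fun p => - expR (- p.1)) (cst 0).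
Proof.
have d (t : R) : is_derive t 1 (fun t => expR (- t)) (- expR (- t)).
  have h := is_derive1_comp (g := -%R) (is_derive_expR (- t))
    (is_deriveN (is_derive_id t (1 : R))).
  by apply: (is_derive_eq h); rewrite mulrN1.
have c : continuous (fun t : R => - expR (- t)).
  move=> t; apply: cvgN; apply: (@continuous_comp _ _ _ -%R expR).
    exact: opp_continuous.
  exact: continuous_expR.
exact: (reg_time d c).
Qed.

Lemma w_reg : reg (fun p : R * R => w p.2) (cst 0) (fun p => w' p.2).
Proof. exact: reg_space. Qed.

Lemma pinf_reg : reg (fun p : R * R => pinf p.2) (cst 0) (fun p => roo p.2 * w' p.2).
Proof.
apply: (@reg_space _ pinf (fun y => roo y * w' y)) => // y.
by apply: cvgM; [exact: roo_cont|exact: w'_cont].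
Qed.

Variables (phi phi' chi chi' : R -> R) (N : R).
Hypothesis phi_derive : forall t : R, is_derive t 1 phi (phi' t).
Hypothesis phi'_cont : continuous phi'.
Hypothesis phi_supp : forall t, N <= t -> phi t = 0.
Hypothesis chi_derive : forall y : R, is_derive y 1 chi (chi' y).
Hypothesis chi'_cont : continuous chi'.
Hypothesis chi_supp : forall y, N <= `|y| -> chi y = 0.

Lemma cut_reg : reg (fun p : R * R => phi p.1 * chi p.2)
  (fun p => phi' p.1 * chi p.2 + phi p.1 * 0) (fun p => 0 * chi p.2 + phi p.1 * chi' p.2).
Proof. exact: (reg_mul (reg_time phi_derive phi'_cont) (reg_space chi_derive chi'_cont)). Qed.

Lemma cut_admissible c ct cy : reg c ct cy -> admissible
  (fun p : R * R => phi p.1 * chi p.2 * c p)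
  (fun p => (phi' p.1 * chi p.2 + phi p.1 * 0) * c p + phi p.1 * chi p.2 * ct p)
  (fun p => (0 * chi p.2 + phi p.1 * chi' p.2) * c p + phi p.1 * chi p.2 * cy p).
Proof.
move=> rc; apply: (reg_admissible (N := N) (reg_mul cut_reg rc)).
by move=> p _ [h|h]; [rewrite phi_supp|rewrite (chi_supp h) mulr0]; rewrite ?mul0r.
Qed.

Definition beta_reg := reg_add (reg_add
   (reg_mul (reg_mul (reg_cst (2^-1 : R)) exp_reg) (reg_mul V_reg V_reg))
   (reg_mul (reg_cst (-1 : R)) dpot_reg)) w_reg.
Definition kappa_reg := reg_add pressure_reg (reg_mul (reg_cst (-1 : R)) pinf_reg).

Definition momentum_reg := reg_mul (reg_cst (-1 : R)) (reg_mul exp_reg V_reg).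


Definition Vy (p : R * R) : R :=
  Dy nb p * (rhob p)^-1 + nb p * (- (rhob p) ^- 2 * Dy rhob p).
Lemma Dy_velocity p : open_half p -> Dy V p = Vy p.
Proof.
case: p => t y p0; have [h _ _ _] := V_reg; have [_ d] := h t y p0.
exact: (is_derive_y (u := V) d).2.
Qed.

Lemma Dy_momentum p : open_half p ->
  Dy (fun q => nb q ^+ 2 / rhob q) p = Dy nb p * V p + nb p * Vy p.
Proof.
case: p => t y p0; have [h _ _ _] := reg_mul nb_reg V_reg; have [_ d] := h t y p0.
have -> : (fun q => nb q ^+ 2 / rhob q) = (fun q => nb q * (nb q * (rhob q)^-1)).
  by apply/funext => q; rewrite expr2 mulrA.
exact: (is_derive_y (u := fun q => nb q * (nb q * (rhob q)^-1)) d).2.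
Qed.

Lemma Dy_pressure p : open_half p ->
  Dy (fun q => pressure k gamma (rhob q)) p = dpressure k gamma (rhob p) * Dy rhob p.
Proof.
case: p => t y p0; have [h _ _ _] := pressure_reg; have [_ d] := h t y p0.
exact: (is_derive_y (u := fun q => pressure k gamma (rhob q)) d).2.
Qed.

Definition R2 p : R := Dtau nb p - p.2 / 2 * Dy nb p - 2^-1 * nb p
  + (Dy nb p * V p + nb p * Vy p)
  + expR p.1 * (dpressure k gamma (rhob p) * Dy rhob p + alpha * nb p).

(** xi with the y-derivatives of composite expressions expanded. Only first derivatives of [rhob]
    and [nb] remain, which makes the pointwise balance a rational identity. *)
Definition xi_explicit p : R :=
  - Vy p * (expR (- p.1) * rho p * (n p / rho p - V p) ^+ 2
     + (pressure k gamma (rho p) - pressure k gamma (rhob p)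
        - dpressure k gamma (rhob p) * (rho p - rhob p)))
  + expR (- p.1) * (V p * residual1 rhob nb p - R2 p) * (rho p / rhob p)
     * (n p / rho p - V p)
  + (- (rho p - rhob p) * ddpot k gamma (rhob p) * residual1 rhob nb p).

Lemma xiE p : open_half p -> xi alpha k gamma rhob nb rho n p = xi_explicit p.
Proof.
move=> p0; rewrite /xi /xi1 /xi2 /xi3 Dy_velocity// real_normK ?num_real//.
by rewrite /residual /residual2 Dy_momentum// Dy_pressure.
Qed.

Let mR (f : R * R -> R) := measurable_fun (open_half : set plane) f.

Lemma measurable_V : mR V. Proof. by have [] := reg_measurable V_reg. Qed.
Lemma measurable_rhob : mR rhob. Proof. by have [] := reg_measurable rhob_reg. Qed.
Lemma measurable_E : mR (fun p => expR (- p.1)).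
Proof. by have [] := reg_measurable exp_reg. Qed.
Lemma measurable_beta : mR beta.
Proof.
have [h _ _] := reg_measurable beta_reg; apply: eq_measurable_fun h => p _.
by rewrite /beta /velocity /= mulN1r expr2.
Qed.
Lemma measurable_kappa : mR kappa.
Proof.
have [h _ _] := reg_measurable kappa_reg; apply: eq_measurable_fun h => p _.
by rewrite /kappa /= mulN1r.
Qed.

Lemma measurable_pressure_rhob : mR (fun p => pressure k gamma (rhob p)).
Proof. by have [] := reg_measurable pressure_reg. Qed.

Let mrho := measurable_rho sol.
Let mn := measurable_n sol.
Let my2 : mR (fun p => p.2 / 2).
Proof.
apply: (@measurable_snd_fun _ (fun y => y / 2)).
apply: continuous_measurable_fun => y; apply: cvgM; first exact: cvg_id.
exact: cvg_cst.
Qed.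

Lemma measurable_gap : mR (gap rho n).
Proof.
apply: measurable_funD; last exact: measurable_kappa.
apply: measurable_funD; apply: measurable_funM => //; last exact: measurable_beta.
apply: measurable_funM; last exact: measurable_V.
by apply: measurableT_comp => //; exact: measurable_E.
Qed.

Lemma measurable_flux : mR flux.
Proof.
apply: measurable_funB; last first.
  apply: measurable_funM; first exact: measurable_V.
  by apply: measurable_funB; [exact: measurable_pr sol|exact: measurable_pressure_rhob].
apply: measurable_funB; last first.
  apply: measurable_funM; last exact: measurable_kin sol.
  by apply: measurable_funM; [exact: measurable_E|exact: measurable_V].
apply: measurable_funD; apply: measurable_funM => //.
- by apply: measurableT_comp => //; exact: my2.
- exact: measurable_gap.
- exact: measurable_beta.
Qed.

Lemma measurable_xi : mR (xi alpha k gamma rhob nb rho n).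
Proof.
have [_ mVt mVy] := reg_measurable V_reg.
have [mrb mrt mry] := reg_measurable rhob_reg.
have [mnb mnt mny] := reg_measurable nb_reg.
have mV := measurable_V; have mE := measurable_E.
have mpr := measurable_pr sol; have mprb := measurable_pressure_rhob.
have me := measurable_fst_fun (@measurable_expR R).
have mcst (x : R) : mR (fun=> x) by exact: measurable_cst.
have mN (f : R * R -> R) : mR f -> mR (fun p => - f p).
  by move=> mf; exact: measurableT_comp.
have mpow (a : R) : mR (fun p => rhob p `^ a).
  rewrite /mR (_ : (fun p => _) = (@powR R ^~ a) \o rhob)//.
  by apply: measurableT_comp; [exact: measurable_powR|].
have mres1 : mR (residual1 rhob nb).
  exact: (measurable_funD (measurable_funB mrt (measurable_funM my2 mry)) mny).
have mdp : mR (fun p => dpressure k gamma (rhob p)).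
  exact: (measurable_funM (mcst (k * gamma)) (mpow (gamma - 1))).
have mddp : mR (fun p => ddpot k gamma (rhob p)).
  exact: (measurable_funM (mcst (k * gamma)) (mpow (gamma - 2))).
have mR2 : mR R2.
  apply: (measurable_funD (measurable_funD (measurable_funB (measurable_funB mnt
    (measurable_funM my2 mny)) (measurable_funM (mcst 2^-1) mnb))
    (measurable_funD (measurable_funM mny mV) (measurable_funM mnb mVy)))).
  exact: (measurable_funM me (measurable_funD (measurable_funM mdp mry)
    (measurable_funM (mcst alpha) mnb))).
have mir : mR (fun p => (rho p)^-1) by exact: measurable_inv.
have mirb : mR (fun p => (rhob p)^-1) by exact: measurable_inv.
have mrel : mR (fun p => n p / rho p - V p).
  by apply: measurable_funB => //; exact: measurable_funM.
suff h : mR xi_explicit by apply: eq_measurable_fun h => p /set_mem p0; rewrite xiE.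
apply: measurable_funD; last first.
  apply: measurable_funM => //; apply: measurable_funM => //.
  by apply: mN; exact: measurable_funB.
apply: measurable_funD.
  apply: measurable_funM; first exact: mN.
  apply: measurable_funD.
    by apply: measurable_funM; [exact: measurable_funM|exact: measurable_funX].
  apply: measurable_funB; first exact: measurable_funB.
  by apply: measurable_funM => //; exact: measurable_funB.
apply: measurable_funM => //; apply: measurable_funM; last exact: measurable_funM.
by apply: measurable_funM => //; apply: measurable_funB => //; exact: measurable_funM.
Qed.

Lemma measurable_source : mR source.
Proof.
have mcst (x : R) : mR (fun=> x) by exact: measurable_cst.
have mc (f : R -> R) : continuous f -> mR (fun p => f p.2).
  by move=> cf; apply: measurable_snd_fun; exact: continuous_measurable_fun.
have mV := measurable_V.
apply: measurable_funB; last first.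
  apply: measurable_funM; first exact: mc.
  apply: measurable_funB => //; apply: measurable_funM => //.
  by apply: measurable_funB => //; exact: mc.
apply: measurable_funB; last first.
  apply: measurable_funM => //; apply: measurable_funD.
    by apply: measurable_funM => //; exact: measurable_funM.
  by apply: measurable_funM => //; exact: measurable_funX.
apply: measurable_funB; first exact: measurable_xi.
by apply: measurable_funM => //; exact: measurable_gap.
Qed.

Let mphi : measurable_fun (setT : set (measurableTypeR R)) phi.
Proof.
by apply: continuous_measurable_fun => t; exact: derivable_cvg (phi_derive t).
Qed.

Let mchi : measurable_fun (setT : set (measurableTypeR R)) chi.
Proof.
by apply: continuous_measurable_fun => t; exact: derivable_cvg (chi_derive t).
Qed.

(** The sum of four identities with phi chi as cutoff: the mass equation tested with [beta], the
    momentum equation with - exp(-tau) V, the trivial solution (1, 0) of the mass equation with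
    [kappa], and the vanishing integral of the y-derivative of V p(rhob), which supplies the term V
    p(rhob) of the flux. *)
Lemma cutoff_identity :
  mu2.-integrable open_half (EFin \o (fun p => phi' p.1 * chi p.2 * gap rho n p
    + phi p.1 * chi p.2 * source p + phi p.1 * chi' p.2 * flux p)) /\
  \int[mu2]_(p in open_half) (phi' p.1 * chi p.2 * gap rho n p
    + phi p.1 * chi p.2 * source p + phi p.1 * chi' p.2 * flux p)
  + \int[mu]_y (phi 0 * chi y * gap (fun p => rho0 p.2) (fun p => n0 p.2) (0, y)) = 0.
Proof.
have [i1 j1 e1] := mass_test sol (cut_admissible beta_reg).
have [i2 j2 e2] := momentum_test sol (cut_admissible momentum_reg).
have [i3 j3 e3] := mass_one_test (cut_admissible kappa_reg).
have [i4 j4 e4] := y_derivative_test (cut_admissible (reg_mul V_reg pressure_reg)).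
move: i1 i2 i3 i4 j1 j2 j3 j4 e1 e2 e3 e4; rewrite /weak_form.
set w1 := wint _ _ _ _ _ _; set w2 := wint _ _ _ _ _ _.
set w3 := wint _ _ _ _ _ _; set w4 := wint _ _ _ _ _ _.
set v1 := wini _ _; set v2 := wini _ _; set v3 := wini _ _; set v4 := wini _ _.
move=> i1 i2 i3 i4 j1 j2 j3 j4 e1 e2 e3 e4.
have i12 := integrable_RD mo i1 i2; have i34 := integrable_RD mo i3 i4.
have j12 := integrable_RD measurableT j1 j2; have j34 := integrable_RD measurableT j3 j4.
pose F p := phi' p.1 * chi p.2 * gap rho n p
  + phi p.1 * chi p.2 * source p + phi p.1 * chi' p.2 * flux p.
have [||iF E] := @ae_Rintegral _ _ _ mu2 open_half mo F _ _ _ (integrable_RD mo i12 i34).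
- apply: measurable_funD; [apply: measurable_funD|]; apply: measurable_funM.
  + exact: (measurable_tensor (continuous_measurable_fun phi'_cont) mchi).
  + exact: measurable_gap.
  + exact: (measurable_tensor mphi mchi).
  + exact: measurable_source.
  + exact: (measurable_tensor mphi (continuous_measurable_fun chi'_cont)).
  + exact: measurable_flux.
(* All derivatives fall on the background and the cutoffs, so at each point the integrands are
   compared as rational expressions in independent variables; the only differential relations are p'
   = z h'' and those built into [reg]. *)
- case: no_vacuum_momentum => Z [mZ Z0 hZ]; exists Z; split=> // p /= np.
  apply: hZ => /= pn; apply: np => p0; have {pn}pn := pn p0.
  have rb0 : 0 < rhob p by rewrite (lt_le_trans l0)// rhob_ge//; exact: ltW.
  rewrite /F /w1 /w2 /w3 /w4 /wint /source xiE//.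
  rewrite /mass_flux /momentum_flux /flux /gap /beta /kappa /xi_explicit /R2 /Vy.
  rewrite /residual1 /velocity /= dpressureE// expRN.
  have : expR p.1 != 0 by rewrite gt_eqF// expR_gt0.
  move: (expR p.1) (Dtau rhob p) (Dy rhob p) (Dtau nb p) (Dy nb p) => e rt ry nt ny e0.
  move: (chi p.2) (chi' p.2) (w p.2) (w' p.2) (roo p.2) (pinf p.2) => c c' W W' ro P.
  move: (phi p.1) (phi' p.1) (p.2) => f f' y.
  move: (pressure _ _ (rho p)) (pressure _ _ (rhob p)) => pr pb.
  move: (dpot _ _ _) (ddpot _ _ _) => h1 h2.
  move: (rhob p) (nb p) (n p) rb0 pn => r m v /lt0r_neq0 r0.
  (* On the vacuum n = 0 as well, and every quotient by rho takes the value 0. *)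
  have [->|] := eqVneq (rho p) 0.
    by move=> /(_ erefl) ->; rewrite expr0n/= !mul0r !mulr0; field; rewrite r0 e0.
  by move: (rho p) => s s0 _; field; rewrite r0 e0 s0.
split=> //; rewrite E.
have -> : (fun y => phi 0 * chi y * gap (fun p => rho0 p.2) (fun p => n0 p.2) (0, y)) =
    (fun y => v1 y + v2 y + (v3 y + v4 y)).
  apply/funext => y; rewrite /v1 /v2 /v3 /v4 /wini /gap /beta /kappa /velocity /=.
  by ring.
rewrite (RintegralD mo i12 i34) (RintegralD mo i1 i2) (RintegralD mo i3 i4).
rewrite (RintegralD measurableT j12 j34) (RintegralD measurableT j1 j2).
rewrite (RintegralD measurableT j3 j4).
move: e1 e2 e3 e4; lra.
Qed.

End cutoff_identity.

(** * Removing the space cutoff *)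

Section cutoff_removal.
Context {R : realType}.
Local Notation mu := (@lebesgue_measure R).
Local Notation plane := (measurableTypeR R * measurableTypeR R)%type.
Local Notation mu2 := (mu \x mu)%E.

Let mo := @measurable_open_half R.

Lemma smooth_cutoff : exists chi : R -> R,
  [/\ smooth chi, forall y, 0 <= chi y <= 1, chi 0 = 1 &
      forall y, 1 <= `|y| -> chi y = 0].
Proof.
have [T [S [sS dS [Tm T0 T1] _]]] := @smooth_step R.
have T_bnd x : 0 <= T x <= 1.
  apply/andP; split.
    by have [x0|x0] := leP x 0; [rewrite T0|rewrite -(T0 _ (lexx 0)) Tm ?ltW].
  by have [x0|x0] := leP 1 x; [rewrite T1|rewrite -(T1 _ (lexx 1)) Tm ?ltW].
have [_] := smooth_derive (sS : smooth S); rewrite (is_derive_derive1 dS) => sA.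
(* The derivative of [S], translated by one: smoothness is inherited from [S], and the plateaus of
   [T] give the value 1 at 0 and the support. *)
exists (fun y => T (1 * y + 1) - T (1 * y + 1 - 1)); split.
- by move=> m; exact: (Ck_affine 1 1 (sA m)).
- move=> y; have /andP[h1 h2] := T_bnd (1 * y + 1).
  have /andP[h3 h4] := T_bnd (1 * y + 1 - 1).
  have := Tm (1 * y + 1 - 1) (1 * y + 1); lra.
- by rewrite mulr0 add0r T1// T0// ?subrr// subr0.
- move=> y; rewrite ler_normr => /orP[h|h].
    by rewrite !T1 ?subrr//; lra.
  by rewrite !T0 ?subrr//; lra.
Qed.

(** The positive part is integrable, so its cut-off integrals converge by domination. Those of the
    negative part then converge too, and Fatou's lemma bounds the integral of the negative part by
    their finite limit. *)
Lemma integrable_of_cutoff_limit (chi_ : nat -> R * R -> R) (X : R * R -> R) (L : R) :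
  (forall m, measurable_fun (open_half : set plane) (chi_ m)) ->
  (forall m p, 0 <= chi_ m p <= 1) ->
  (forall p, open_half p -> chi_ m p @[m --> \oo] --> (1 : R)) ->
  measurable_fun (open_half : set plane) X ->
  (\int[mu2]_(p in open_half) (Num.max (X p) 0)%:E < +oo)%E ->
  (forall m, mu2.-integrable open_half (EFin \o (fun p => chi_ m p * X p))) ->
  \int[mu2]_(p in open_half) (chi_ m p * X p) @[m --> \oo] --> L ->
  mu2.-integrable open_half (EFin \o X).
Proof.
move=> mchi chi01 chi1 mX Xp iX cX.
pose P p : R := Num.max (X p) 0; pose M p : R := Num.max (- X p) 0.
have PM p : X p = P p - M p.
  by rewrite /P /M; case: leP => h1; case: leP => h2; lra.
have P0 p : 0 <= P p by rewrite /P le_max lexx orbT.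
have M0 p : 0 <= M p by rewrite /M le_max lexx orbT.
have mP : measurable_fun (open_half : set plane) P by exact: measurable_maxr.
have mM : measurable_fun (open_half : set plane) M.
  by apply: measurable_maxr => //; exact: measurableT_comp.
have iP : mu2.-integrable open_half (EFin \o P).
  apply/integrableP; split; first exact/measurable_EFinP.
  by under eq_integral do rewrite /= ger0_norm//.
have chi_le m p (x : R) : 0 <= x -> `|chi_ m p * x| <= x.
  move=> x0; have /andP[h1 h2] := chi01 m p.
  by rewrite normrM !ger0_norm// ler_piMl.
have iPm m : mu2.-integrable open_half (EFin \o (fun p => chi_ m p * P p)).
  apply: (integrable_Rle mo _ iP) => [|p _]; [exact: measurable_funM|exact: chi_le].
have [||||_ cP] := @Rdominated_convergence _ _ _ mu2 _ mo (fun m p => chi_ m p * P p) P P.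
- by move=> m; exact: measurable_funM.
- exact: iP.
- by move=> m p _; exact: chi_le.
- move=> p p0; rewrite -[X in _ --> X]mul1r; apply: cvgM; first exact: chi1.
  exact: cvg_cst.
have iMm m : mu2.-integrable open_half (EFin \o (fun p => chi_ m p * M p)).
  have := integrable_RB mo (iPm m) (iX m).
  by apply: eq_integrable => // p _ /=; rewrite PM; congr EFin; ring.
have cM : \int[mu2]_(p in open_half) (chi_ m p * M p) @[m --> \oo] -->
    \int[mu2]_(p in open_half) P p - L.
  rewrite (_ : (fun m => _) = (fun m => \int[mu2]_(p in open_half) (chi_ m p * P p)
      - \int[mu2]_(p in open_half) (chi_ m p * X p))).
    exact: cvgB.
  apply/funext => m; rewrite -(RintegralB mo (iPm m) (iX m)).
  by apply: eq_Rintegral => p _ /=; rewrite PM; ring.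
have iM : mu2.-integrable open_half (EFin \o M).
  apply/integrableP; split; first exact/measurable_EFinP.
  under eq_integral do rewrite /= ger0_norm//.
  have mf m : measurable_fun (open_half : set plane) (EFin \o (fun p => chi_ m p * M p)).
    by apply/measurable_EFinP; exact: measurable_funM.
  have f0 m p : open_half p -> (0 <= (EFin \o (fun p => chi_ m p * M p)%R) p)%E.
    by move=> _; rewrite /= lee_fin mulr_ge0//; have /andP[] := chi01 m p.
  have := fatou mu2 mo mf f0.
  rewrite (_ : limn_einf _ = (\int[mu2]_(p in open_half) P p - L)%R%:E); last first.
    have cE : (\int[mu2]_(x in open_half) (EFin \o (fun p => chi_ m p * M p)%R) x)%E
        @[m --> \oo] --> (\int[mu2]_(p in open_half) P p - L)%R%:E.
      rewrite (_ : (fun m => _) = EFin \o (fun m =>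
        \int[mu2]_(p in open_half) (chi_ m p * M p))); last first.
        by apply/funext => m /=; rewrite -EFin_Rintegral.
      by apply: cvg_EFin; [exact: nearW|exact: cM].
    rewrite is_cvg_limn_einfE; last by apply/cvg_ex; eexists; exact: cE.
    exact/cvg_lim.
  move=> h; apply: le_lt_trans (ltry _); apply: le_trans h.
  rewrite le_eqVlt; apply/orP; left; apply/eqP.
  apply: eq_integral => p /set_mem p0.
  have cE : ((EFin \o (fun p => chi_ m p * M p)%R) p)%E @[m --> \oo] --> (M p)%:E.
    apply: cvg_EFin; first exact: nearW.
    rewrite -[X in _ --> X]mul1r; apply: cvgM; [exact: chi1|exact: cvg_cst].
  rewrite is_cvg_limn_einfE; last by apply/cvg_ex; eexists; exact: cE.
  exact/esym/cvg_lim.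
have := integrable_RB mo iP iM.
by apply: eq_integrable => // p _ /=; rewrite PM.
Qed.

(** Cutoffs chi(y / (m + 1)) are inserted. Both chi_m' and y chi_m' are bounded uniformly in m and
    tend to 0 pointwise, so the flux term disappears although its part (y / 2) Bg grows in y. The
    cut-off integrals of [X] therefore converge, which upgrades the extended existence of its
    integral to integrability. *)
Lemma cutoff_limit (A X B0 Bg : R * R -> R) (I0 : R -> R) :
  mu2.-integrable open_half (EFin \o A) ->
  mu2.-integrable open_half (EFin \o B0) ->
  mu2.-integrable open_half (EFin \o Bg) ->
  mu.-integrable setT (EFin \o I0) ->
  measurable_fun (open_half : set plane) X -> integral_exists X ->
  (forall (chi : R -> R) (N : R), smooth chi -> (forall y, N <= `|y| -> chi y = 0) ->
    mu2.-integrable open_half (EFin \o (fun p => chi p.2 * (A p + X p)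
      + derive1 chi p.2 * (B0 p - p.2 / 2 * Bg p))) /\
    \int[mu2]_(p in open_half) (chi p.2 * (A p + X p)
      + derive1 chi p.2 * (B0 p - p.2 / 2 * Bg p))
    + \int[mu]_y (chi y * I0 y) = 0) ->
  mu2.-integrable open_half (EFin \o X) /\
  \int[mu2]_(p in open_half) A p + \int[mu2]_(p in open_half) X p
   + \int[mu]_y I0 y = 0.
Proof.
move=> iA iB0 iBg iI0 mX Xex cut.
have [chi [schi chi01 chi0 chiN]] := smooth_cutoff.
have [dchi schi'] := smooth_derive schi.
have chi'N y : 2 <= `|y| -> derive1 chi y = 0.
  by move=> h; apply: (derive1_supp schi chiN); lra.
have [C C0 hC] := smooth_bounded schi' chi'N.
pose c m y : R := chi (m.+1%:R^-1 * y + 0).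
have m0 m : 0 < m.+1%:R^-1 :> R by rewrite invr_gt0.
have m1 m : m.+1%:R^-1 <= 1 :> R by rewrite invf_le1// ler1n.
have sc m : smooth (c m) by move=> j; exact: Ck_affine.
have cN m y : m.+1%:R <= `|y| -> c m y = 0.
  move=> h; apply: chiN; rewrite addr0 normrM gtr0_norm//.
  by rewrite ler_pdivlMl// mulr1.
have c' m y : derive1 (c m) y = m.+1%:R^-1 * derive1 chi (m.+1%:R^-1 * y).
  have d1 (a x : R) : is_derive x (1 : R) (fun x => a * x + 0) a.
    have d := is_deriveD (is_deriveZ a (is_derive_id x (1 : R))) (is_derive_cst (0 : R) x (1 : R)).
    by apply: (is_derive_eq d); rewrite addr0 /GRing.scale/= mulr1.
  have d2 z := is_derive1_comp (g := fun x => m.+1%:R^-1 * x + 0)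
    (dchi (m.+1%:R^-1 * z + 0)) (d1 m.+1%:R^-1 z).
  by rewrite (is_derive_derive1 d2) addr0 mulrC.
have limh : m.+1%:R^-1 @[m --> \oo] --> (0 : R) by exact: cvg_harmonic.
have lim0 y : m.+1%:R^-1 * y @[m --> \oo] --> (0 : R).
  rewrite -[X in _ --> X](mul0r y); by apply: cvgM; last exact: cvg_cst.
have cc y : c m y @[m --> \oo] --> (1 : R).
  rewrite (_ : (fun m => c m y) = chi \o (fun m => m.+1%:R^-1 * y)); last first.
    by apply/funext => m; rewrite /c /= addr0.
  rewrite -[X in _ --> X]chi0; exact: (cvg_comp _ _ (lim0 y) (@smooth_continuous _ _ schi 0)).
have c01 m y : 0 <= c m y <= 1 by exact: chi01.
have cle m y (x : R) : `|c m y * x| <= `|x|.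
  have /andP[h1 h2] := c01 m y.
  by rewrite normrM ger0_norm// ler_piMl.
have mcont (f : R -> R) : continuous f -> measurable_fun (open_half : set plane) (fun p => f p.2).
  by move=> cf; apply: measurable_snd_fun; exact: continuous_measurable_fun.
have mc m : measurable_fun (open_half : set plane) (fun p => c m p.2).
  by apply: mcont => y; exact: (@smooth_continuous _ _ (sc m) y).
have mc' m : measurable_fun (open_half : set plane) (fun p => derive1 (c m) p.2).
  by apply: mcont; apply: smooth_continuous; exact: (smooth_derive (sc m)).2.
have my : measurable_fun (open_half : set plane) (fun p => p.2 / 2).
  apply: (@measurable_snd_fun _ (fun y => y / 2)).
  apply: continuous_measurable_fun => y; apply: cvgM; first exact: cvg_id.
  exact: cvg_cst.
pose Q m p := derive1 (c m) p.2 * (B0 p - p.2 / 2 * Bg p).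
have mB0 := integrable_Rmeasurable iB0; have mBg := integrable_Rmeasurable iBg.
have mA := integrable_Rmeasurable iA.
have mQ m : measurable_fun (open_half : set plane) (Q m).
  exact: (measurable_funM (mc' m) (measurable_funB mB0 (measurable_funM my mBg))).
pose G p := C * `|B0 p| + C * `|Bg p|.
have iG : mu2.-integrable open_half (EFin \o G).
  by apply: integrable_RD => //; apply: integrable_RZ => //; exact: integrable_norm.
have QG m p : `|Q m p| <= G p.
  rewrite /Q mulrBr (le_trans (ler_normB _ _))// /G c'; apply: lerD.
    rewrite normrM ler_wpM2r// normrM gtr0_norm//.
    by rewrite -[leRHS]mul1r ler_pM// ltW.
  rewrite mulrA normrM ler_wpM2r//.
  rewrite (_ : _ * _ * _ = (m.+1%:R^-1 * p.2) / 2 * derive1 chi (m.+1%:R^-1 * p.2)); last by ring.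
  (* With z = y / (m + 1) the factor is (z / 2) chi'(z); chi' vanishes for |z| >= 2, so |z / 2| <= 1
     where it matters. *)
  move: (_ * p.2) => z; have [z2|z2] := leP 2 `|z|.
    by rewrite chi'N// mulr0 normr0.
  rewrite normrM -[leRHS]mul1r ler_pM//.
  by rewrite normrM [`|2^-1|]ger0_norm// ler_pdivrMr// mul1r ltW.
have iQ m : mu2.-integrable open_half (EFin \o Q m).
  by apply: (integrable_Rle mo (mQ m) iG) => p _; exact: QG.
have [||||_ cQ] := @Rdominated_convergence _ _ _ mu2 _ mo Q (cst 0) G.
- exact: mQ.
- exact: iG.
- by move=> m p _; exact: QG.
- move=> p _; rewrite /Q.
  have cd : derive1 chi (m.+1%:R^-1 * p.2) @[m --> \oo] --> derive1 chi 0.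
    exact: (cvg_comp _ _ (lim0 p.2) (@smooth_continuous _ _ schi' 0)).
  rewrite (_ : (fun m => _) = (fun m => m.+1%:R^-1 * derive1 chi (m.+1%:R^-1 * p.2) * B0 p
     - m.+1%:R^-1 * p.2 * derive1 chi (m.+1%:R^-1 * p.2) * (Bg p / 2))); last first.
    by apply/funext => m; rewrite c'; field.
  rewrite [X in _ --> X](_ : _ = 0 * derive1 chi 0 * B0 p
    - 0 * derive1 chi 0 * (Bg p / 2)); last by rewrite /= !mul0r subr0.
  apply: cvgB; apply: cvgM; try exact: cvg_cst.
    by apply: cvgM.
  by apply: cvgM.
have icA m : mu2.-integrable open_half (EFin \o (fun p => c m p.2 * A p)).
  apply: (integrable_Rle mo _ (integrable_norm iA)) => [|p _]; last exact: cle.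
  exact: measurable_funM.
have [||||_ cA] := @Rdominated_convergence _ _ _ mu2 _ mo (fun m p => c m p.2 * A p) A
  (fun p => `|A p|).
- by move=> m; exact: measurable_funM.
- exact: integrable_norm.
- by move=> m p _; exact: cle.
- by move=> p _; rewrite -[X in _ --> X]mul1r; apply: cvgM; [exact: cc|exact: cvg_cst].
have [||||_ cI] := @Rdominated_convergence _ _ _ mu _ measurableT (fun m y => c m y * I0 y) I0
  (fun p => `|I0 p|).
- move=> m; apply: measurable_funM; last exact: integrable_Rmeasurable iI0.
  by apply: continuous_measurable_fun; exact: smooth_continuous.
- exact: integrable_norm.
- by move=> m p _; exact: cle.
- by move=> p _; rewrite -[X in _ --> X]mul1r; apply: cvgM; [exact: cc|exact: cvg_cst].
have icX m : mu2.-integrable open_half (EFin \o (fun p => c m p.2 * X p)).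
  have := integrable_RB mo (integrable_RB mo (cut _ _ (sc m) (cN m)).1 (icA m)) (iQ m).
  by apply: eq_integrable => // p _ /=; rewrite /Q; congr EFin; ring.
pose L := - (\int[mu]_y I0 y) - \int[mu2]_(p in open_half) A p.
have cXL : \int[mu2]_(p in open_half) (c m p.2 * X p) @[m --> \oo] --> L.
  rewrite (_ : (fun m => _) = (fun m => - (\int[mu]_y (c m y * I0 y))
      - \int[mu2]_(p in open_half) (c m p.2 * A p) - \int[mu2]_(p in open_half) Q m p)).
    rewrite /L -[X in _ --> X]subr0; apply: cvgB.
      by apply: cvgB => //; exact: cvgN.
    by rewrite (_ : 0 = \int[mu2]_(p in open_half) cst 0 p)// Rintegral_cst// mul0r.
  apply/funext => m; have [i1 e1] := cut _ _ (sc m) (cN m).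
  rewrite -[X in X - _ - _ ](addKr (\int[mu2]_(p in open_half) (c m p.2 * (A p + X p)
      + derive1 (c m) p.2 * (B0 p - p.2 / 2 * Bg p)))).
  have -> (a b : R) : - a + (a + - b) = - b by ring.
  have -> : - (\int[mu]_y (c m y * I0 y)) = \int[mu2]_(p in open_half) (c m p.2 * (A p + X p)
      + derive1 (c m) p.2 * (B0 p - p.2 / 2 * Bg p)).
    by apply/eqP; rewrite eq_sym -subr_eq0 opprK; apply/eqP.
  rewrite -(RintegralB mo i1 (icA m)) -(RintegralB mo (integrable_RB mo i1 (icA m)) (iQ m)).
  by apply: eq_Rintegral => p _ /=; rewrite /Q; ring.
have iX : mu2.-integrable open_half (EFin \o X).
  (* If only the negative part is known to have finite integral, the argument is applied to -X,
     whose cut-off integrals tend to -L. *)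
  case: Xex => Xex.
    exact: (@integrable_of_cutoff_limit (fun m p => c m p.2) X L).
  have /(integrable_RZ mo (-1)) : mu2.-integrable open_half (EFin \o (fun p => - X p)).
    apply: (@integrable_of_cutoff_limit (fun m p => c m p.2) _ (- L)) => //.
    - exact: measurableT_comp.
    - move=> m; have := integrable_RZ mo (-1) (icX m).
      by apply: eq_integrable => // p _ /=; congr EFin; ring.
    - rewrite (_ : (fun m => _) = (fun m => - \int[mu2]_(p in open_half) (c m p.2 * X p))).
        exact: cvgN.
      apply/funext => m; rewrite -mulN1r -(RintegralZl _ mo (icX m)).
      by apply: eq_Rintegral => p _ /=; ring.
  by apply: eq_integrable => // p _ /=; rewrite mulN1r opprK.
split=> //.
have [||||_ cX'] := @Rdominated_convergence _ _ _ mu2 _ mo (fun m p => c m p.2 * X p) X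
  (fun p => `|X p|).
- by move=> m; exact: measurable_funM.
- exact: integrable_norm.
- by move=> m p _; exact: cle.
- by move=> p _; rewrite -[X in _ --> X]mul1r; apply: cvgM; [exact: cc|exact: cvg_cst].
rewrite (cvg_unique (@Rhausdorff R) cX' cXL) /L; ring.
Qed.

End cutoff_removal.

(** * Pointwise bounds by the relative entropy *)

Section potential.
Context {R : realType}.
Variables (k gamma : R).
Hypothesis k0 : 0 < k.
Hypothesis gamma1 : 1 <= gamma.
Local Notation pot := (pot k gamma).
Local Notation dpot := (dpot k gamma).
Local Notation pressure := (pressure k gamma).

Lemma pressure_ge0 (z : R) : 0 <= pressure z.
Proof. by rewrite mulr_ge0 ?powR_ge0// ltW. Qed.

Lemma pot0 : pot 0 = 0.
Proof.
rewrite /pot; case: eqP => [_|_]; first by rewrite mulr0 mul0r.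
by rewrite powR0 ?mulr0// gt_eqF// (lt_le_trans ltr01).
Qed.

(** It puts h(r | z) in the form h(r) - h'(z) r + p(z), in which two relative potentials of the same
    r differ by an affine function of r. *)
Lemma legendre (z : R) : 0 <= z -> (gamma == 1 -> 0 < z) -> z * dpot z - pot z = pressure z.
Proof.
move=> z0 z1; rewrite /dpot /pot /pressure; have [g1|g1] := eqVneq gamma 1.
  by rewrite g1 powRr1//; ring.
have g0 : gamma - 1 != 0 by rewrite subr_eq0.
have -> : z * (k * gamma / (gamma - 1) * z `^ (gamma - 1)) =
    k * gamma / (gamma - 1) * z `^ gamma.
  rewrite mulrCA; congr (_ * _).
  have [->|z0'] := eqVneq z 0.
    by rewrite mul0r powR0// gt_eqF// (lt_le_trans ltr01).
  rewrite -[X in X * _](powRr1 z0) -powRD; last by rewrite z0' implybT.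
  by congr (_ `^ _); ring.
by field.
Qed.

Lemma dpot_mono (a b : R) : 0 < a -> a <= b -> dpot a <= dpot b.
Proof.
move=> a0; rewrite le_eqVlt => /predU1P[->//|ab].
have [x /andP[ax _]|c /andP[ac _] E] := @mvt_on _ dpot (ddpot k gamma) a b _ ab.
  by apply: is_derive_dpot; exact: lt_le_trans ax.
rewrite -subr_ge0 E mulr_ge0 ?subr_ge0 ?(ltW ab)//.
by rewrite /ddpot !mulr_ge0 ?powR_ge0 ?(ltW k0)// (le_trans ler01).
Qed.

(** Convexity of h: its graph lies above the tangent at z. The vacuum r = 0, where h' may be
    singular, is settled by p >= 0; otherwise the mean value theorem and the monotonicity of h'
    apply. *)
Lemma pot_tangent (r z : R) : 0 <= r -> 0 < z -> dpot z * r - pressure z <= pot r.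
Proof.
move=> r0 z0; rewrite -legendre ?(ltW z0)//.
suff : dpot z * (r - z) <= pot r - pot z by lra.
move: r0; rewrite le_eqVlt => /predU1P[<-|r0].
  rewrite pot0; have := pressure_ge0 z; rewrite -legendre ?(ltW z0)//; lra.
have [rz|zr|->] := ltgtP r z; last by rewrite !subrr mulr0.
  have [x /andP[rx _]|c /andP[rc cz] E] := @mvt_on _ pot dpot r z _ rz.
    by apply: is_derive_pot; exact: lt_le_trans rx.
  have : dpot c * (z - r) <= dpot z * (z - r).
    by rewrite ler_wpM2r ?subr_ge0 ?(ltW rz)// dpot_mono ?(ltW cz)// (lt_trans r0).
  by move: E; lra.
have [x /andP[zx _]|c /andP[zc cr] E] := @mvt_on _ pot dpot z r _ zr.
  by apply: is_derive_pot; exact: lt_le_trans zx.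
by rewrite E ler_wpM2r ?subr_ge0 ?(ltW zr)// dpot_mono ?(ltW zc).
Qed.

Lemma dpot_unbounded (W : R) : exists2 z : R, 0 < z & W <= dpot z.
Proof.
rewrite /dpot; have [g1|g1] := eqVneq gamma 1.
  exists (expR (W / k)); first exact: expR_gt0.
  by rewrite expRK mulrDr mulr1 mulrC divfK ?gt_eqF// lerDl ltW.
have g0 : 0 < gamma - 1 by rewrite subr_gt0 lt_neqAle eq_sym g1.
have c0 : 0 < k * gamma / (gamma - 1).
  by rewrite divr_gt0// mulr_gt0// (lt_le_trans ltr01).
pose m := Num.max (W / (k * gamma / (gamma - 1))) 1.
have m0 : 0 < m by rewrite lt_max ltr01 orbT.
exists (m `^ (gamma - 1)^-1); first exact: powR_gt0.
rewrite -powRrM mulVf ?gt_eqF// (powRr1 (ltW m0)) -ler_pdivrMl// mulrC.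
by rewrite /m le_max lexx.
Qed.

(** Superlinear growth of h: the tangent at a point z where h'(z) >= W + 1 is steeper than any
    admissible s by at least 1, at the cost of the constant p(z). *)
Lemma density_bound (W : R) : exists2 C : R, 0 <= C & forall r s, 0 <= r -> s <= W ->
  r <= pot r - s * r + C.
Proof.
have [z z0 Wz] := dpot_unbounded (W + 1).
exists (pressure z); first exact: pressure_ge0.
move=> r s r0 sW; have := pot_tangent r0 z0.
have : (W + 1) * r <= dpot z * r by rewrite ler_wpM2r.
have : s * r <= W * r by rewrite ler_wpM2r.
lra.
Qed.

(** The density is controlled by [density_bound]. The pressure is k r when gamma = 1 and (gamma - 1)
    h(r) when gamma > 1, and h(r) <= H + W r, where H = h(r) - s r + q. In the application s =
    h'(rho_oo) and q = p(rho_oo). *)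
Lemma entropy_bounds (W : R) : 0 <= W -> exists2 C : R, 0 <= C & forall r s q,
  0 <= r -> `|s| <= W -> 0 <= q -> 0 <= pot r - s * r + q ->
  r <= C * (1 + (pot r - s * r + q)) /\ pressure r <= C * (1 + (pot r - s * r + q)).
Proof.
move=> W0; have [C0 C00 hC0] := density_bound W.
have a1 : 0 <= 1 + C0 by rewrite addr_ge0.
have a2 : 0 <= gamma * (1 + W) by rewrite mulr_ge0 ?addr_ge0// (le_trans ler01).
have a3 : 0 <= k + gamma * (1 + W) by rewrite addr_ge0// ltW.
exists ((1 + C0) * (k + gamma * (1 + W)) + (1 + C0)); first by rewrite addr_ge0 ?mulr_ge0.
move=> r s q r0; rewrite ler_norml => /andP[s1 s2] q0 H0.
set H := pot r - s * r + q in H0 *.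
have H1 : 0 <= 1 + H by rewrite addr_ge0.
have rC : r <= (1 + C0) * (1 + H).
  have := hC0 r s r0 s2; have : 0 <= C0 * H by rewrite mulr_ge0.
  by rewrite /H; lra.
have cC : 0 <= (1 + C0) * (1 + H) by exact: le_trans rC.
split.
  by rewrite (le_trans rC)// ler_wpM2r// lerDr mulr_ge0.
apply: (@le_trans _ _ ((k + gamma * (1 + W)) * ((1 + C0) * (1 + H)))); last first.
  by rewrite mulrA [_ * (1 + C0)]mulrC ler_wpM2r// lerDl.
have [g1|g1] := eqVneq gamma 1.
  rewrite /pressure g1 powRr1//.
  rewrite g1 in a2.
  apply: (@le_trans _ _ (k * ((1 + C0) * (1 + H)))).
    by rewrite ler_wpM2l// ltW.
  by rewrite ler_wpM2r// lerDl.
have -> : pressure r = (gamma - 1) * pot r.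
  rewrite /pressure /pot (negbTE g1); field; by rewrite subr_eq0.
have g0 : 0 < gamma - 1 by rewrite subr_gt0 lt_neqAle eq_sym g1.
have h1 : pot r <= (1 + W) * ((1 + C0) * (1 + H)).
  have h : pot r <= H + W * r.
    have : s * r <= W * r by rewrite ler_wpM2r.
    by rewrite /H; lra.
  have h2 : W * r <= W * ((1 + C0) * (1 + H)) by rewrite ler_wpM2l.
  have h3 : 0 <= C0 * H by rewrite mulr_ge0.
  lra.
apply: (@le_trans _ _ ((gamma - 1) * ((1 + W) * ((1 + C0) * (1 + H))))).
  by rewrite ler_wpM2l// ltW.
rewrite mulrA ler_wpM2r//.
have -> : (gamma - 1) * (1 + W) = gamma * (1 + W) - (1 + W) by ring.
by move: a2 k0 W0; lra.
Qed.

Lemma momentum_le (r m : R) : 0 <= r -> (r = 0 -> m = 0) -> `|m| <= 2^-1 * (m ^+ 2 / r + r).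
Proof.
move=> r0 rm; have [r00|rn0] := eqVneq r 0.
  by rewrite r00 (rm r00) normr0 addr0 invr0 mulr0 mulr0.
have rp : 0 < r by rewrite lt_neqAle eq_sym rn0.
rewrite -(ler_pM2r rp) -real_normK ?num_real//.
have -> : 2^-1 * (`|m| ^+ 2 / r + r) * r = 2^-1 * (`|m| ^+ 2 + r ^+ 2) by field.
have : 0 <= (`|m| - r) ^+ 2 by exact: sqr_ge0.
rewrite !expr2; lra.
Qed.

(** The terms of the gap, its flux and the friction difference are estimated as a background factor
    of size O(d), where d dominates m, h'(rb) - s and p(rb) - q, times a factor of size O(1 + H +
    K); the free term p(rb) - q is itself at most d. *)
Lemma flux_bounds (l u W : R) : 0 < l -> l <= u -> 0 <= W ->
  exists2 C : R, 0 <= C & forall r n rb m s q e d,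
  0 <= r -> (r = 0 -> n = 0) -> l <= rb <= u -> `|m| <= u -> `|s| <= W -> 0 <= q ->
  0 <= e <= 1 -> `|m| <= d -> `|dpot rb - s| <= d -> `|pressure rb - q| <= d ->
  0 <= pot r - s * r + q ->
  let v := m / rb in let H := pot r - s * r + q in let K := n ^+ 2 / r in
  let b := 2^-1 * e * v ^+ 2 - dpot rb + s in
  [/\ `|- e * v * n + b * r + (pressure rb - q)| <= C * (d * (1 + H + K)),
      `|b * n - e * v * K - v * (pressure r - pressure rb)| <= C * (d * (1 + H + K)),
      `|- 2 * v * n + r * v ^+ 2| <= C * (d * (1 + H + K)) &
      r <= C * (1 + H + K) /\ `|n| <= C * (1 + H + K)].
Proof.
move=> l0 lu W0; have [C0 C00 hC] := entropy_bounds W0.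
have u0 : 0 < u by exact: lt_le_trans lu.
pose P := pressure u.
have P0 : 0 <= P by exact: pressure_ge0.
(* [A * d] bounds |v|, v^2 and |b| at once: the summands come from |v| <= d / l, from v^2 <= (u / l)
   (d / l) and from |h'(rb) - s| <= d. *)
pose A := l^-1 + l^-1 * (u * l^-1) + 1.
have il : 0 < l^-1 by rewrite invr_gt0.
have B0 : 0 <= l^-1 * (u * l^-1) by rewrite !mulr_ge0// ltW.
have A1 : 1 <= A by rewrite /A lerDr addr_ge0// ltW.
have A0 : 0 <= A by exact: le_trans A1.
pose C1 := C0 + 1.
(* The factor P + 3 counts the products to be added: at most three, plus one multiplied by the bound
   P on p(rb). *)
pose C := A * (C1 + 1) * (P + 3).
have C10 : 0 <= C1 by rewrite /C1 addr_ge0.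
have C11 : 0 <= C1 + 1 by rewrite addr_ge0.
have P3 : 0 <= P + 3 by rewrite addr_ge0.
exists C; first by rewrite !mulr_ge0.
move=> r n rb m s q e d r0 rn /andP[lrb rbu] mu sW q0 /andP[e0 e1] md sd qd H0 /=.
set v := m / rb; set H := _ + q in H0 *; set K := n ^+ 2 / r.
set b := _ - _ + s.
have K0 : 0 <= K by rewrite /K mulr_ge0 ?sqr_ge0 ?invr_ge0.
have [rC pC] := hC r s q r0 sW q0 H0; rewrite -/H in rC pC.
have rb0 : 0 < rb by exact: lt_le_trans lrb.
have irb : rb^-1 <= l^-1 by rewrite lef_pV2 ?posrE.
have d0 : 0 <= d by exact: le_trans (normr_ge0 _) md.
pose S := 1 + H + K.
have S1 : 1 <= S by rewrite /S -addrA lerDl addr_ge0.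
have S0 : 0 <= S by exact: le_trans S1.
have irb0 : 0 <= rb^-1 by rewrite invr_ge0 ltW.
have vd : `|v| <= l^-1 * d.
  by rewrite normrM mulrC [`|rb^-1|]ger0_norm// ler_pM.
have vu : `|v| <= u * l^-1.
  by rewrite normrM [`|rb^-1|]ger0_norm// ler_pM.
have rS : r <= C1 * S.
  have h : C0 * (1 + H) <= C0 * S by rewrite ler_wpM2l// /S lerDl.
  by rewrite (le_trans rC)// (le_trans h)// ler_wpM2r// /C1 lerDl.
have KS : K <= S by rewrite /S; move: H0; lra.
have pS : pressure r <= C1 * S.
  have h : C0 * (1 + H) <= C0 * S by rewrite ler_wpM2l// /S lerDl.
  by rewrite (le_trans pC)// (le_trans h)// ler_wpM2r// /C1 lerDl.
have nS : `|n| <= (C1 + 1) * S.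
  rewrite (le_trans (momentum_le r0 rn))// -/K.
  have : 0 <= (C1 + 1) * S by rewrite mulr_ge0.
  have -> : (C1 + 1) * S = C1 * S + S by ring.
  by move: KS rS; lra.
have rS' : r <= (C1 + 1) * S by rewrite (le_trans rS)// ler_wpM2r// lerDl.
have pS' : pressure r <= (C1 + 1) * S by rewrite (le_trans pS)// ler_wpM2r// lerDl.
have KS' : K <= (C1 + 1) * S by rewrite (le_trans KS)// ler_peMl// lerDr.
have pb : pressure rb <= P.
  rewrite /P /pressure ler_wpM2l ?(ltW k0)// ge0_ler_powR ?nnegrE ?(ltW rb0) ?(ltW u0)//.
  by rewrite (le_trans ler01).
have vA : `|v| <= A * d.
  by rewrite (le_trans vd)// ler_wpM2r// /A -addrA lerDl addr_ge0.
have v2 : v ^+ 2 <= l^-1 * (u * l^-1) * d.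
  rewrite -real_normK ?num_real// expr2 mulrAC; exact: ler_pM.
have bA : `|b| <= A * d.
  rewrite /b (_ : _ - _ + s = 2^-1 * e * v ^+ 2 - (dpot rb - s)); last by ring.
  rewrite (le_trans (ler_normB _ _))// /A mulrDl mul1r lerD//.
  rewrite mulrDl ler_wpDl ?mulr_ge0 ?(ltW il)//.
  rewrite ger0_norm; last by rewrite mulr_ge0 ?sqr_ge0// mulr_ge0.
  apply: le_trans v2; rewrite -[leRHS]mul1r ler_wpM2r ?sqr_ge0//.
  by rewrite mulr_ile1// invf_le1// ler1n.
have T0 : 0 <= A * d * ((C1 + 1) * S) by rewrite !mulr_ge0.
have PS : P <= P * ((C1 + 1) * S).
  rewrite ler_peMr// (le_trans S1)// ler_peMl// lerDr//.
have CE : C * (d * S) = A * d * ((C1 + 1) * S) * (P + 3) by rewrite /C; ring.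
have bound (x y : R) : `|x| <= A * d -> `|y| <= (C1 + 1) * S ->
    `|x * y| <= A * d * ((C1 + 1) * S).
  by move=> hx hy; rewrite normrM ler_pM.
have evA : `|e * v| <= A * d.
  by rewrite normrM (ger0_norm e0) (le_trans _ vA)// ler_piMl.
have rn' : `|r| <= (C1 + 1) * S by rewrite ger0_norm.
have Kn' : `|K| <= (C1 + 1) * S by rewrite ger0_norm.
have TP : A * d * ((C1 + 1) * S) * P >= 0 by rewrite mulr_ge0.
have qA : `|pressure rb - q| <= A * d * ((C1 + 1) * S).
  rewrite (le_trans qd)// -[leLHS]mulr1 ler_pM//.
    by rewrite ler_peMl.
  by rewrite (le_trans S1)// ler_peMl// lerDr.
rewrite -/S CE mulrDr; split.
- have h1 := bound _ _ evA nS; have h2 := bound _ _ bA rn'.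
  have := ler_normD (- e * v * n + b * r) (pressure rb - q).
  have := ler_normD (- e * v * n) (b * r).
  rewrite -(normrN (- e * v * n)) (_ : - (- e * v * n) = e * v * n); last by ring.
  by lra.
- have h1 := bound _ _ bA nS; have h2 := bound _ _ evA Kn'.
  have h3 : `|v * (pressure r - pressure rb)| <=
      A * d * ((C1 + 1) * S) * P + A * d * ((C1 + 1) * S).
    rewrite normrM; apply: (@le_trans _ _ (A * d * ((C1 + 1) * S * P + (C1 + 1) * S))).
      rewrite ler_pM// (le_trans (ler_normB _ _))// !ger0_norm ?pressure_ge0//.
      rewrite addrC lerD// (le_trans pb)//.
      by rewrite [leRHS]mulrC.
    by rewrite mulrDr mulrA.
  have := ler_normB (b * n - e * v * K) (v * (pressure r - pressure rb)).
  have := ler_normB (b * n) (e * v * K).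
  by lra.
- have h1 := bound _ _ vA nS.
  have v2A : `|v ^+ 2| <= A * d.
    rewrite ger0_norm ?sqr_ge0// (le_trans v2)// ler_wpM2r// /A.
    by rewrite -addrA addrCA lerDl addr_ge0// ltW.
  have h2 := bound _ _ v2A rn'.
  have := ler_normD (- 2 * v * n) (r * v ^+ 2).
  rewrite (_ : - 2 * v * n = - (2 * (v * n))); last by ring.
  rewrite normrN [`|2 * _|]normrM (ger0_norm (ler0n _ 2)) [r * _]mulrC.
  by lra.
- have h : (C1 + 1) * S <= C * S.
    rewrite ler_wpM2r// /C (_ : A * (C1 + 1) * (P + 3) = (C1 + 1) * (A * (P + 3))); last by ring.
    rewrite ler_peMr ?addr_ge0//.
    have : 1 * 1 <= A * (P + 3) by rewrite ler_pM//; lra.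
    by rewrite mulr1.
  by split; [exact: le_trans rS' h|exact: le_trans nS h].
Qed.

End potential.

(** * The locally bounded L^1 and L^oo spaces *)

Section almost_everywhere_rules.
Context d (T : sigmaRingType d) (R : realFieldType) (mu : set T -> \bar R).

Lemma ae_mono (P Q : T -> Prop) : (forall x, P x -> Q x) ->
  {ae mu, forall x, P x} -> {ae mu, forall x, Q x}.
Proof.
by move=> PQ [N [mN N0 PN]]; exists N; split => // x nQ; apply: PN => Px; exact/nQ/PQ.
Qed.

End almost_everywhere_rules.

Lemma ae_and d (T : ringOfSetsType d) (R : realFieldType) (mu : measure T R)
    (P Q : T -> Prop) : {ae mu, forall x, P x} -> {ae mu, forall x, Q x} ->
  {ae mu, forall x, P x /\ Q x}.
Proof. by move=> aP aQ; apply: filterS2 aP aQ => x. Qed.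

Section local_bounds.
Context {R : realType}.
Local Notation mu := (@lebesgue_measure R).
Local Notation plane := (measurableTypeR R * measurableTypeR R)%type.
Local Notation mu2 := (mu \x mu)%E.
Implicit Types (f : R * R -> R).

Let mo := @measurable_open_half R.

Definition strip (T : R) : set (R * R) := [set p | 0 < p.1 /\ p.1 <= T].

Lemma measurable_strip T : measurable (strip T : set plane).
Proof.
rewrite (_ : strip T = [set p : plane | `]0, T]%classic p.1 /\ setT p.2]).
  by apply: measurable_rect => //; exact: measurable_itv.
by apply/seteqP; split => p; rewrite /strip /= in_itv/=; [case=> -> ->|case=> /andP[-> ->]].
Qed.

Lemma strip_open T : strip T `<=` @open_half R. Proof. by move=> p []. Qed.

Lemma ae_dense (P : R -> Prop) (a b : R) : {ae mu, forall t, P t} -> a < b ->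
  exists2 t, a < t < b & P t.
Proof.
move=> [N [mN N0 PN]] ab; apply: contrapT => h.
have abN : `]a, b[ `<=` N.
  move=> t /=; rewrite in_itv/= => tab; apply: PN => /= Pt; apply: h.
  by exists t.
have : (mu `]a, b[%classic <= mu N)%E.
  by apply: le_measure => //; rewrite inE//=; exact: measurable_itv.
rewrite N0 lebesgue_measure_itv/= lte_fin ab -EFinB lee_fin.
by rewrite leNgt subr_gt0 ab.
Qed.

(** At a point of continuity a strict violation of the essential bound would persist on a whole
    neighbourhood, which contains a good time and a good point of the corresponding slice. The L^1
    bound remains valid for almost every time only. *)
Lemma Linf_bound f T : Linfloc_L1_Linf f -> exists2 C : R, 0 <= C &
  (forall p, open_half p -> p.1 <= T -> {for p, continuous f} -> `|f p| <= C) /\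
  {ae mu, forall t, 0 < t <= T -> (\int[mu]_y `|f (t, y)|%:E <= C%:E)%E}.
Proof.
move=> [_ /(_ T)[C hC]].
have mT : (0 < mu setT)%E.
  apply: (@lt_le_trans _ _ (mu `]0, 1[%classic)).
    by rewrite lebesgue_measure_itv/= lte_fin ltr01 -EFinB lte_fin subr0.
  by apply: le_measure; rewrite ?inE//=; exact: measurable_itv.
have aeC : {ae mu, forall t : R, 0 < t <= T ->
    (\int[mu]_y `|f (t, y)|%:E <= C%:E)%E /\ {ae mu, forall y, `|f (t, y)| <= C}}.
  apply: (ae_mono _ hC) => t + tT => /(_ tT)[h1 h2]; split.
    by move: h1; rewrite Lnorm1.
  move: h2; rewrite unlock mT => /ess_supP.
  by apply: ae_mono => y /=; rewrite lee_fin.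
exists `|C| => //; split; last first.
  apply: (ae_mono _ aeC) => t /[apply] -[h _].
  by apply: (le_trans h); rewrite lee_fin ler_norm.
move=> [t0 y0] /= t00 t0T cf; rewrite leNgt; apply/negP => Cf.
have : \forall p \near (t0, y0), `|C| < `|f p|.
  have h' : nbhs `|f (t0, y0)| [set y | `|C| < y] by exact: lt_nbhsr.
  have cf' : {for (t0, y0), continuous (fun p => `|f p|)}.
    by apply: (cvg_comp _ _ cf); exact: norm_continuous.
  exact: (cf' _ h').
move=> /nbhs_ballP[e /= e0 he].
have ab : Num.max 0 (t0 - e) < t0 by rewrite gt_max t00/= ltrBlDr ltrDl.
have [t /andP[+ tt0] ht] := ae_dense aeC ab.
rewrite gt_max => /andP[t0' te].
have [|_ hy] := ht; first by rewrite t0' (le_trans (ltW tt0)).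
have yy : y0 - e < y0 by rewrite ltrBlDr ltrDl.
have [y /andP[ye y0'] hyC] := ae_dense hy yy.
have := he (t, y); rewrite /= => /(_ _).
have bt : ball (t0, y0) e (t, y).
  by split; rewrite /ball/= ger0_norm ?subr_ge0 ?ltW// ltrBlDl; lra.
move=> /(_ bt); rewrite ltNge => /negP; apply.
by rewrite (le_trans hyC)// ler_norm.
Qed.

(** By Tonelli: the L^1 norms of the slices are bounded by C on the time interval (0, T], which has
    finite length. *)
Lemma Linf_strip f T : Linfloc_L1_Linf f ->
  mu2.-integrable (strip T) (EFin \o f).
Proof.
move=> Lf; have [C C0 [_ aeC]] := Linf_bound T Lf; case: Lf => mf _.
have ms := @measurable_strip T.
have mf' : measurable_fun (strip T : set plane) f.
  by apply: measurable_funS mf => //; exact: strip_open.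
apply/integrableP; split; first exact/measurable_EFinP.
rewrite (_ : strip T = open_half `&` strip T); last by apply/esym/setIidr/strip_open.
rewrite integral_mkcondr tonelli_half; last 2 first.
- apply/(measurable_restrict _ ms mo); rewrite setIidr; last exact: strip_open.
  by apply: measurableT_comp => //; exact/measurable_EFinP.
- by move=> p _; apply: erestrict_ge0 => q _; exact: abse_ge0.
have mI : measurable (`]0, +oo[%classic : set (measurableTypeR R)) by exact: measurable_itv.
apply: (@le_lt_trans _ _ (\int[mu]_(t in `]0%R, +oo[)
    ((fun _ => C%:E) \_ `]0%R, T]) t)%E).
  apply: ae_ge0_le_integral => //.
  - by move=> t _; apply: integral_ge0 => y _; apply: erestrict_ge0 => q _; exact: abse_ge0.
  - apply: measurable_half_iter; apply/(measurable_restrict _ ms mo).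
    rewrite setIidr; last exact: strip_open.
    by apply: measurableT_comp => //; exact/measurable_EFinP.
  - by move=> t _; apply: erestrict_ge0 => q _; rewrite lee_fin.
  - apply/(measurable_restrict _ _ mI) => //; exact: measurable_itv.
  apply: (ae_mono _ aeC) => t + /= _.
  rewrite patchE; case: ifPn => [|/negP tT _].
    rewrite inE/= in_itv/= => tT /(_ tT); apply: le_trans.
    apply: ge0_le_integral => //.
    - by move=> y _; apply: erestrict_ge0 => q /= _; rewrite lee_fin.
    - apply: (@measurable_half_section R _ _ (fun q => (fun q0 => `|(EFin \o f) q0|%E) \_ (strip T) q) t); last first.
        by move: tT => /andP[].
      apply/(measurable_restrict _ ms mo); rewrite setIidr; last exact: strip_open.
      by apply: measurableT_comp => //; exact/measurable_EFinP.
    - have := @measurable_half_section R _ _ (fun q => (`|f q|)%:E) t.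
      apply; last by move: tT => /andP[].
      by apply/measurable_EFinP; apply: measurableT_comp.
    - by move=> y _; rewrite patchE; case: ifPn => //= _; rewrite lee_fin.
  rewrite integral0_eq// => y _; rewrite patchE ifF//; apply/negP => /set_mem[h1 h2].
  by apply: tT; rewrite inE/= in_itv/= h1.
rewrite -integral_mkcondr (_ : _ `&` _ = `]0%R, T]%classic); last first.
  by apply: setIidr => t /=; rewrite !in_itv/= andbT => /andP[].
have mIT : measurable (`]0, T]%classic : set (measurableTypeR R)) by exact: measurable_itv.
apply: (@le_lt_trans _ _ (C%:E * mu `]0%R, T]%classic)%E).
  by have /= -> := integral_cst mu mIT C%:E.
have -> : mu `]0, T]%classic = (if 0 < T then (T%:E - 0%:E)%E else 0%E).
  by rewrite lebesgue_measure_itv/= lte_fin.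
by case: ifPn => _; rewrite ?mule0 ?ltry// -EFinB -EFinM ltry.
Qed.

End local_bounds.

(** * Bounds on the background state up to time zero *)

Section background_bounds.
Context {R : realType}.
Local Notation mu := (@lebesgue_measure R).
Local Notation plane := (measurableTypeR R * measurableTypeR R)%type.
Local Notation mu2 := (mu \x mu)%E.
Implicit Types (f : R * R -> R) (g : R -> R).

Lemma closed_box_bounded f (T : R) : {within closed_half, continuous f} ->
  exists2 C : R, 0 <= C & forall p, 0 <= p.1 <= T -> `|p.2| <= T -> `|f p| <= C.
Proof.
move=> cf; pose K := [set p : R * R | 0 <= p.1 <= T /\ - T <= p.2 <= T].
have cK : compact K by exact: compact_rectangle.
have cf' : {within K, continuous f}.
  by apply: continuous_subspaceW cf => p [/andP[]].
have [M [_ hM]] := compact_bounded (continuous_compact cf' cK).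
exists (`|M| + 1) => [|p p1 p2]; first by rewrite addr_ge0.
apply: hM; first by rewrite (le_lt_trans (ler_norm M))// ltrDl.
by exists p => //; split => //; rewrite -ler_norml.
Qed.

(** The derivatives are continuous for tau > 0 only, so their bounds near tau = 0 come from the L^oo
    assumptions, whereas f itself is bounded on boxes by compactness. *)
Lemma C1_on_reg f : C1_on open_half f -> {within closed_half, continuous f} ->
  Linfloc_L1_Linf (Dtau f) -> Linfloc_L1_Linf (Dy f) -> reg f (Dtau f) (Dy f).
Proof.
move=> f1 f0 ft fy; split.
- move=> t y t0; have [h1 h2 _ _] := f1 (t, y) t0.
  by split; [exact: tau_is_derive|exact: y_is_derive].
- move=> p p0; have [_ _ h1 h2] := f1 p p0; split => //.
  exact: within_open_continuous.
- by move=> y; exact: within_right_cvg.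
- move=> N; have [A A0 hA] := closed_box_bounded N f0.
  have [B B0 [hB _]] := Linf_bound N ft; have [C C0 [hC _]] := Linf_bound N fy.
  exists (A + B + C) => [|p p0 p1 p2]; first by rewrite !addr_ge0.
  have [_ _ c1 c2] := f1 p p0.
  have := hA p; rewrite (ltW p0) => /(_ p1 p2); have := hB p p0 p1 c1; have := hC p p0 p1 c2.
  have e1 : A <= A + B + C by rewrite -addrA lerDl addr_ge0.
  have e2 : B <= A + B + C by rewrite -addrA addrCA lerDl addr_ge0.
  have e3 : C <= A + B + C by rewrite lerDr addr_ge0.
  move=> h3 h2 h1.
  by split; [exact: (le_trans h1)|exact: (le_trans h2)|exact: (le_trans h3)].
Qed.

(** The assumptions speak of positive times. The supremum bound passes to tau = 0 by continuity of
    f, the L^1 bound by Fatou's lemma along good times s_m tending to 0. A jump of g at y = 0 is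
    neutralized by the factor y. *)
Lemma weighted_bound f g (T : R) : {within closed_half, continuous f} ->
  measurable_fun setT g -> (forall y, y != 0 -> {for y, continuous g}) ->
  Linfloc_L1_Linf (fun p => p.2 * (f p - g p.2)) ->
  (exists2 C : R, 0 <= C & forall p, 0 <= p.1 <= T -> `|p.2 * (f p - g p.2)| <= C) /\
  mu.-integrable setT (EFin \o (fun y => y * (f (0, y) - g y))).
Proof.
(* The window must contain positive times near 0 even for T = 0, hence the maximum with 1. *)
move=> cf mg cg Lf; have [C C0 [hC iC]] := Linf_bound (Num.max T 1) Lf.
have h0 y : y * (f (s, y) - g y) @[s --> 0^'+] --> y * (f (0, y) - g y).
  by apply: cvgM; [exact: cvg_cst|apply: cvgB; [exact: within_right_cvg|exact: cvg_cst]].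
have bound p : open_half p -> p.1 <= Num.max T 1 -> `|p.2 * (f p - g p.2)| <= C.
  move=> p0 p1; have [->|y0] := eqVneq p.2 0; first by rewrite mul0r normr0.
  apply: (hC p p0 p1).
  have c1 : {for p, continuous (fun p : R * R => p.2)} by exact: cvg_snd.
  have c2 : {for p, continuous (fun p : R * R => g p.2)} by apply: continuous_snd; exact: cg.
  exact: (continuousM c1 (continuousB (within_open_continuous cf p0) c2)).
split.
  exists C => // -[t y] /= /andP[+ tT]; rewrite le_eqVlt => /predU1P[t0|t0]; last first.
    by apply: (bound (t, y)) => //=; rewrite le_max tT.
  rewrite -t0; have h : `|y * (f (s, y) - g y)| @[s --> 0^'+] --> `|y * (f (0, y) - g y)|.
    by apply: cvg_norm; exact: h0.
  apply: (ler_cvg_to h (cvg_cst C)).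
  near=> s; apply: (bound (s, y)) => /=.
    by near: s; exact: nbhs_right_gt.
  by rewrite le_max; apply/orP; right; near: s; exact: nbhs_right_le.
have Cm (m : nat) : exists s : R, 0 < s < m.+1%:R^-1 /\ (\int[mu]_y `|y * (f (s, y) - g y)|%:E <= C%:E)%E.
  have m0 : 0 < m.+1%:R^-1 :> R by rewrite invr_gt0.
  have [s /andP[s0 sm] hs] := ae_dense iC m0; exists s; split; first by rewrite s0.
  apply: hs; rewrite s0/= le_max; apply/orP; right; apply: (le_trans (ltW sm)).
  by rewrite invf_le1// ler1n.
pose s m := proj1_sig (cid (Cm m)).
have sP m := proj2_sig (cid (Cm m)).
have s_gt0 m : 0 < s m by have [/andP[]] := sP m.
have s_lt m : s m < m.+1%:R^-1 by have [/andP[]] := sP m.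
have s_int m : (\int[mu]_y `|y * (f (s m, y) - g y)|%:E <= C%:E)%E by have [] := sP m.
have s0 : s m @[m --> \oo] --> 0^'+.
  have s00 : s m @[m --> \oo] --> 0.
    apply: (@squeeze_cvgr _ _ _ _ (cst 0) (fun m => m.+1%:R^-1)).
    - by apply: nearW => m; rewrite (ltW (s_gt0 m)) (ltW (s_lt m)).
    - exact: cvg_cst.
    - exact: cvg_harmonic.
  move=> A [e /= e0 eA]; have /cvgrPdist_lt/(_ e e0) := s00.
  apply: filterS => m h; apply: eA => //=; exact: s_gt0.
have cs y : y * (f (s m, y) - g y) @[m --> \oo] --> y * (f (0, y) - g y).
  exact: (cvg_comp _ _ s0 (h0 y)).
have ms m : measurable_fun setT (fun y : measurableTypeR R => y * (f (s m, y) - g y)).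
  have [mLf _] := Lf.
  exact: (@measurable_half_section R _ _ _ (s m) mLf).
have m0 : measurable_fun setT (fun y : measurableTypeR R => y * (f (0, y) - g y)).
  by apply: (measurable_fun_cvg ms) => y _; exact: cs.
pose G (y : measurableTypeR R) : R := y * (f (0, y) - g y).
pose H (m : nat) (y : measurableTypeR R) : R := y * (f (s m, y) - g y).
apply/integrableP; split; first exact/measurable_EFinP.
have F := @fatou _ _ R mu setT measurableT (fun m y => `|H m y|%:E).
apply: (@le_lt_trans _ _ C%:E); last exact: ltry.
rewrite (_ : integral _ _ _ = \int[mu]_y limn_einf (fun m => `|H m y|%:E))%E; last first.
  apply: eq_integral => y _.
  have h : (`|H m y|%:E)%E @[m --> \oo] --> (`|G y|%:E)%E.
    by apply: cvg_EFin; [exact: nearW|apply: cvg_norm; exact: (cs y)].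
  by have [-> _] := cvg_limn_einf_sup h.
apply: (le_trans (F _ _)).
- by move=> m; apply/measurable_EFinP; apply: measurableT_comp; [exact: normr_measurable|exact: ms].
- by move=> m y _; rewrite lee_fin.
rewrite limn_einf_lim; apply: lime_le; first exact: is_cvg_einfs.
apply: nearW => m; apply: le_trans (s_int m).
by apply: ereal_inf_lbound; exists m => /=.
Unshelve. all: end_near.
Qed.

End background_bounds.

(** * The asymptotic state *)

Section asymptotic_state.
Context {R : realType}.
Variables (k gamma rhom rhop L l : R) (roo : R -> R).
Hypotheses (k0 : 0 < k) (gamma1 : 1 <= gamma).
Hypothesis roo_C1 : C1 roo.
Hypothesis roo_ge0 : forall y, 0 <= roo y.
Hypothesis w_C1 : C1 (dpot k gamma \o roo).
Hypothesis roo_right : forall y, L < y -> roo y = rhop.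
Hypothesis roo_left : forall y, y < - L -> roo y = rhom.
Hypotheses (l0 : 0 < l) (rhop_ge : l <= rhop) (rhom_ge : l <= rhom).

Local Notation w := (dpot k gamma \o roo).

Lemma roo_derive (y : R) : is_derive y 1 roo (derive1 roo y).
Proof. by rewrite derive1E; apply: derivableP; case: roo_C1. Qed.

Lemma w_derive (y : R) : is_derive y 1 w (derive1 w y).
Proof. by rewrite derive1E; apply: derivableP; case: w_C1. Qed.

Lemma roo_continuous : continuous roo.
Proof. by move=> y; exact: derivable_cvg (roo_derive y). Qed.

Lemma w_continuous : continuous w.
Proof. by move=> y; exact: derivable_cvg (w_derive y). Qed.

(* For gamma = 1, [exp (w / k - 1) - rho_oo] is continuous with values in
   {0, 1} (recall [ln 0 = 0]), and vanishes near infinity. *)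
Lemma roo_gt0 (y : R) : gamma == 1 -> 0 < roo y.
Proof.
move=> g1; rewrite lt_neqAle eq_sym roo_ge0 andbT; apply/eqP => y0.
pose f z := expR (w z / k - 1) - roo z.
have f1 z : f z = (roo z == 0)%:R.
  have -> : f z = expR (ln (roo z)) - roo z.
    by rewrite /f /= /dpot g1 [X in expR (X - 1)]mulrC mulKf ?gt_eqF// addrK.
  have [->|z0] := eqVneq; first by rewrite ln0// expR0 subr0.
  by rewrite lnK ?subrr// posrE lt_neqAle eq_sym z0 roo_ge0.
have cf : continuous f.
  move=> z; apply: cvgB; last exact: roo_continuous.
  apply: (@cvg_comp _ _ _ (fun z => w z / k - 1) expR); last exact: continuous_expR.
  apply: cvgB; last exact: cvg_cst.
  by apply: cvgM; [exact: w_continuous|exact: cvg_cst].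
have fr : f (`|L| + `|y| + 1) = 0.
  rewrite f1 roo_right ?gt_eqF ?(lt_le_trans l0)//.
  by rewrite (le_lt_trans (ler_norm L))// -addrA ltrDl ltr_wpDl.
have yz : y <= `|L| + `|y| + 1.
  by rewrite (le_trans (ler_norm y))// -addrA addrCA lerDl addr_ge0.
have fy : f y = 1 by rewrite f1 y0 eqxx.
have [|c _] := @IVT R f _ _ 2^-1 yz (continuous_subspaceT cf).
  rewrite fr fy ge_min le_max; apply/andP; split; apply/orP; [right|left]; lra.
by rewrite f1; case: eqP => _ /=; lra.
Qed.

(** Where rho_oo > 0 this is the chain rule with p' = z h''. At a zero of rho_oo, possible only for
    gamma > 1, h'' may be singular and the C^1 regularity of h'(rho_oo) is used instead. *)
Lemma pinf_derive (y : R) : is_derive y 1 (pressure k gamma \o roo) (roo y * derive1 w y).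
Proof.
have : 0 <= roo y by [].
rewrite le_eqVlt => /predU1P[y0|y0]; last first.
  have d1 := is_derive1_comp (is_derive_pressure k gamma y0) (roo_derive y).
  have d2 := is_derive1_comp (is_derive_dpot k gamma y0) (roo_derive y).
  have -> : derive1 w y = ddpot k gamma (roo y) * derive1 roo y.
    by rewrite derive1E (@derive_val _ _ _ _ _ _ _ d2).
  by rewrite mulrA -dpressureE.
have g1 : gamma != 1.
  by apply/negP => /(roo_gt0 y); rewrite -y0 ltxx.
(* p(z) = (gamma - 1) / gamma z h'(z), a product of differentiable functions of y; both factors
   vanish at this point, and so does the derivative. *)
have E : pressure k gamma \o roo = (fun z => (gamma - 1) / gamma * (roo z * w z)).
  apply/funext => z /=; rewrite /pressure /dpot (negbTE g1).
  have [->|z0] := eqVneq (roo z) 0.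
    by rewrite powR0 ?mul0r ?mulr0// gt_eqF// (lt_le_trans ltr01).
  have -> : (roo z) `^ gamma = roo z * (roo z) `^ (gamma - 1).
    rewrite -{2}(powRr1 (roo_ge0 z)) -powRD ?z0 ?implybT//; congr (_ `^ _); ring.
  field; rewrite subr_eq0 g1/= gt_eqF// (lt_le_trans ltr01)//.
rewrite E; have d := is_deriveZ ((gamma - 1) / gamma) (is_deriveM (roo_derive y) (w_derive y)).
apply: is_derive_eq.
rewrite /GRing.scale/= -y0 /dpot (negbTE g1) powR0 ?subr_eq0//; ring.
Qed.

Lemma w'_supp (y : R) : L < `|y| -> derive1 w y = 0.
Proof.
move=> Ly; suff [c hc] : exists c, \forall z \near y, w z = c.
  have h : is_derive y 1 w 0.
    apply: near_eq_is_derive (is_derive_cst c y (1 : R)).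
    by apply: filterS hc => z ->.
  by rewrite derive1E (@derive_val _ _ _ _ _ _ _ h).
move: Ly; rewrite ltr_normr => /orP[h|h].
  exists (dpot k gamma rhop); near=> z; rewrite /= roo_right//.
  by near: z; exact: lt_nbhsr.
exists (dpot k gamma rhom); near=> z; rewrite /= roo_left//.
by near: z; apply: lt_nbhsl; rewrite ltrNr.
Unshelve. all: end_near.
Qed.

Lemma w_bounded : exists2 W : R, 0 <= W & forall y, `|w y| <= W.
Proof.
have [C C0 hC] := continuous_bounded L w_continuous.
exists (C + `|dpot k gamma rhop| + `|dpot k gamma rhom|); first by rewrite !addr_ge0.
move=> y; have [yL|Ly] := leP `|y| L.
  by rewrite (le_trans (hC y yL))// -addrA lerDl addr_ge0.
move: Ly; rewrite ltr_normr => /orP[h|h] /=.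
  by rewrite roo_right// -addrA addrCA lerDl addr_ge0.
by rewrite roo_left ?lerDr ?addr_ge0// ltrNr.
Qed.

Lemma w'_bounded : exists2 C : R, 0 <= C & forall y, `|derive1 w y| <= C.
Proof.
have [C C0 hC] := continuous_bounded L (proj2 w_C1).
exists C => // y; have [yL|Ly] := leP `|y| L; first exact: hC.
by rewrite w'_supp// normr0.
Qed.

End asymptotic_state.

(** * An integrable envelope *)

Lemma lipschitz_on (R : realType) (f f' : R -> R) (a b : R) :
  (forall x : R, a <= x <= b -> is_derive x 1 f (f' x)) ->
  {in `[a, b], forall x, {for x, continuous f'}} ->
  exists2 C : R, 0 <= C & forall x y, a <= x <= b -> a <= y <= b ->
    `|f x - f y| <= C * `|x - y|.
Proof.
move=> df cf; have [C C0 hC] := bounded_on_segment cf; exists C => //.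
have h x y : a <= x <= b -> a <= y <= b -> x < y -> `|f y - f x| <= C * `|y - x|.
  move=> /andP[ax xb] /andP[ay yb] xy.
  have := @slope_bound R f f' C x y xy _ _.
  rewrite normrM normfV ler_pdivrMr ?normr_gt0 ?subr_eq0 ?gt_eqF//; apply => z /andP[xz zy].
    by apply: df; rewrite (le_trans ax xz) (le_trans zy yb).
  by apply: hC; rewrite (le_trans ax xz) (le_trans zy yb).
move=> x y xab yab; have [xy|yx|->] := ltgtP x y.
- by rewrite distrC [`|x - y|]distrC; exact: h.
- exact: h.
- by rewrite !subrr normr0 mulr0.
Qed.

Section envelope.
Context {R : realType}.
Local Notation mu := (@lebesgue_measure R).
Local Notation plane := (measurableTypeR R * measurableTypeR R)%type.
Local Notation mu2 := (mu \x mu)%E.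
Variables (k gamma rhom rhop L l : R) (roo : R -> R) (rhob nb : R * R -> R).
Hypotheses (k0 : 0 < k) (gamma1 : 1 <= gamma).
Hypotheses (rhom0 : 0 <= rhom) (rhop0 : 0 <= rhop).
Hypothesis roo_C1 : C1 roo.
Hypothesis roo_ge0 : forall y, 0 <= roo y.
Hypothesis w_C1 : C1 (dpot k gamma \o roo).
Hypothesis roo_right : forall y, L < y -> roo y = rhop.
Hypothesis roo_left : forall y, y < - L -> roo y = rhom.
Hypothesis l0 : 0 < l.
Hypothesis rhob_ge : forall p, closed_half p -> l <= rhob p.
Hypothesis rhob_C0 : {within closed_half, continuous rhob}.
Hypothesis nb_C0 : {within closed_half, continuous nb}.
Hypothesis y_rhob : Linfloc_L1_Linf (fun p => p.2 * (rhob p - rho_hat rhom rhop p.2)).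
Hypothesis y_nb : Linfloc_L1_Linf (fun p => p.2 * nb p).

Local Notation w := (dpot k gamma \o roo).
Local Notation pinf := (pressure k gamma \o roo).
Local Notation hat := (rho_hat rhom rhop).

Lemma measurable_rho_hat : measurable_fun (setT : set (measurableTypeR R)) hat.
Proof.
apply: (@measurable_fun_ifT _ _ _ _ (cst rhom) (cst rhop) (fun y : measurableTypeR R => y < 0)) => //.
exact: measurable_fun_ltr.
Qed.

Lemma rho_hat_continuous (y : R) : y != 0 -> {for y, continuous hat}.
Proof.
move=> y0; have [yn|yp|/eqP] := ltgtP y 0; last by rewrite (negbTE y0).
  have e : rhom = hat y by rewrite /rho_hat yn.
  apply: (eq_rect _ (fun c => hat z @[z --> y] --> c) _ _ e); apply: cvg_near_cst.
  by near=> z; rewrite /rho_hat ifT//; near: z; exact: lt_nbhsl.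
have e : rhop = hat y by rewrite /rho_hat ltNge (ltW yp).
apply: (eq_rect _ (fun c => hat z @[z --> y] --> c) _ _ e); apply: cvg_near_cst.
near=> z; rewrite /rho_hat ifF//; apply/negbTE; rewrite -leNgt ltW//.
by near: z; exact: lt_nbhsr.
Unshelve. all: end_near.
Qed.

Let y_nb' : Linfloc_L1_Linf (fun p => p.2 * (nb p - cst 0 p.2)).
Proof.
by rewrite (_ : (fun p => _) = (fun p => p.2 * nb p))//; apply/funext => p; rewrite /= subr0.
Qed.

Let rhob_bd (T : R) := weighted_bound T rhob_C0 measurable_rho_hat rho_hat_continuous y_rhob.
Let nb_bd (T : R) := weighted_bound T nb_C0 (measurable_cst (0 : R)) (fun y _ => cvg_cst (0 : R)) y_nb'.

(** Boundedness of y (rhob - rhop) at time 0 forces rhob(0, y) to tend to rhop as y grows, so rhop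
    inherits the lower bound of rhob. *)
Lemma rhop_ge : l <= rhop.
Proof.
have [[C C0 hC] _] := rhob_bd 0; rewrite leNgt; apply/negP => lp.
have lp' : 0 < l - rhop by rewrite subr_gt0.
(* Were rhop < l, the weighted difference at this y would be at least C + 1. *)
pose y := (C + 1) / (l - rhop).
have y0 : 0 < y by rewrite divr_gt0// ltr_wpDl.
have := hC (0, y); rewrite /= lexx /rho_hat ltNge (ltW y0)/= => /(_ isT).
apply/negP; rewrite -ltNge.
have h : y * (l - rhop) = C + 1 by rewrite divfK ?gt_eqF.
apply: (@lt_le_trans _ _ (C + 1)); first by rewrite ltrDl.
rewrite -h (le_trans _ (ler_norm _))// ler_wpM2l ?(ltW y0)// lerB//.
by apply: rhob_ge; rewrite /closed_half/=.
Qed.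

Lemma rhom_ge : l <= rhom.
Proof.
have [[C C0 hC] _] := rhob_bd 0; rewrite leNgt; apply/negP => lp.
have lp' : 0 < l - rhom by rewrite subr_gt0.
pose y := (C + 1) / (l - rhom).
have y0 : 0 < y by rewrite divr_gt0// ltr_wpDl.
have := hC (0, - y); rewrite /= lexx /rho_hat oppr_lt0 y0 => /(_ isT).
apply/negP; rewrite -ltNge.
have h : y * (l - rhom) = C + 1 by rewrite divfK ?gt_eqF.
apply: (@lt_le_trans _ _ (C + 1)); first by rewrite ltrDl.
rewrite mulNr normrN -h (le_trans _ (ler_norm _))// ler_wpM2l ?(ltW y0)// lerB//.
by apply: rhob_ge; rewrite /closed_half/=.
Qed.

(** For |y| > M one has both rho_oo = rho_hat and |f| <= |y f|. *)
Let M := Num.max L 1.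

Definition envelope (p : R * R) : R :=
  `|p.2 * (rhob p - hat p.2)| + `|p.2 * nb p| + (`|p.2| <= M)%R%:R.

Lemma envelope_ge0 p : 0 <= envelope p.
Proof. by rewrite !addr_ge0. Qed.

(** For |y| <= M the indicator is 1 and constants suffice. For |y| > M the weights control nb and
    rhob - rho_hat themselves, rho_oo equals rho_hat, and h' and p are Lipschitz on [l, u]. *)
Lemma envelope_bounds (T : R) : exists u : R, l <= u /\ exists2 C : R, 0 <= C &
  forall p, 0 <= p.1 <= T ->
    [/\ rhob p <= u, `|nb p| <= u & envelope p <= C] /\
    [/\ `|nb p| <= C * envelope p,
        `|dpot k gamma (rhob p) - w p.2| <= C * envelope p &
        `|pressure k gamma (rhob p) - pinf p.2| <= C * envelope p].
Proof.
have [[A A0 hA] _] := rhob_bd T; have [[B B0 hB] _] := nb_bd T.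
have [Cr Cr0 hCr] := closed_box_bounded (Num.max T M) rhob_C0.
have [Cn Cn0 hCn] := closed_box_bounded (Num.max T M) nb_C0.
have [W W0 hW] := w_bounded w_C1 roo_right roo_left.
have pinf_cont : continuous pinf.
  move=> y; apply: derivable_cvg.
  exact: (pinf_derive k0 gamma1 roo_C1 roo_ge0 w_C1 roo_right l0 rhop_ge).
have [P P0 hP] := continuous_bounded M pinf_cont.
(* The sum of all bounds that occur for |y| <= M or |y| > M, so one interval [l, u] contains the
   values of rhob and both end states, and |nb| <= u. *)
pose u := Cr + A + rhop + rhom + Cn + B.
have lu : l <= u.
  by have := rhop_ge; move: Cr0 A0 rhom0 Cn0 B0; rewrite /u; lra.
have rhop_le : rhop <= u by move: Cr0 A0 rhom0 Cn0 B0; rewrite /u; lra.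
have rhom_le : rhom <= u by move: Cr0 A0 rhop0 Cn0 B0; rewrite /u; lra.
have pos x : l <= x <= u -> 0 < x by move=> /andP[lx _]; exact: lt_le_trans lx.
have [C1 C10 hC1] : exists2 C : R, 0 <= C & forall x y, l <= x <= u -> l <= y <= u ->
    `|dpot k gamma x - dpot k gamma y| <= C * `|x - y|.
  apply: (@lipschitz_on _ _ (ddpot k gamma)) => x xlu.
    by apply: is_derive_dpot; exact: pos.
  by apply: ddpot_continuous; apply: pos; rewrite in_itv in xlu.
have [C2 C20 hC2] : exists2 C : R, 0 <= C & forall x y, l <= x <= u -> l <= y <= u ->
    `|pressure k gamma x - pressure k gamma y| <= C * `|x - y|.
  apply: (@lipschitz_on _ _ (dpressure k gamma)) => x xlu.
    by apply: is_derive_pressure; exact: pos.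
  by apply: dpressure_continuous; apply: pos; rewrite in_itv in xlu.
have [C3 C30 hC3] : exists2 C : R, 0 <= C & forall x, l <= x <= u -> `|dpot k gamma x| <= C.
  apply: bounded_on_segment => x xlu; apply: derivable_cvg.
  by apply: is_derive_dpot; apply: pos; rewrite in_itv in xlu.
have [C4 C40 hC4] : exists2 C : R, 0 <= C & forall x, l <= x <= u -> `|pressure k gamma x| <= C.
  apply: bounded_on_segment => x xlu; apply: derivable_cvg.
  by apply: is_derive_pressure; apply: pos; rewrite in_itv in xlu.
exists u; split => //; pose C := 1 + u + A + B + C1 + C2 + C3 + C4 + W + P.
have u0 : 0 <= u by exact: le_trans (ltW l0) lu.
exists C; first by rewrite !addr_ge0.
move=> [t y] /= tT; have D0 := envelope_ge0 (t, y).
have t0 : 0 <= t by case/andP: tT.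
have tTM : 0 <= t <= Num.max T M by rewrite le_max t0; case/andP: tT => _ ->.
have M1 : 1 <= M by rewrite le_max lexx orbT.
have lr : l <= rhob (t, y) by exact: rhob_ge.
have yge z : M < `|y| -> `|z| <= `|y * z|.
  by move=> My; rewrite normrM ler_peMl// (le_trans M1)// ltW.
have ru : rhob (t, y) <= u.
  have [yM|My] := leP `|y| M.
    have := hCr (t, y) tTM; rewrite /= le_max yM orbT => /(_ isT).
    move/(le_trans (ler_norm _)) => h.
    by move: A0 rhop0 rhom0 Cn0 B0 h; rewrite /u; lra.
  have := le_trans (ler_norm _) (le_trans (yge _ My) (hA (t, y) tT)).
  rewrite /= /rho_hat; case: ifP => _ h;
    by move: Cr0 A0 rhop0 rhom0 Cn0 B0 h; rewrite /u; lra.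
have nu : `|nb (t, y)| <= u.
  have [yM|My] := leP `|y| M.
    have := hCn (t, y) tTM; rewrite /= le_max yM orbT => /(_ isT) h.
    by move: Cr0 A0 rhop0 rhom0 B0 h; rewrite /u; lra.
  have := (le_trans (yge _ My) (hB (t, y) tT)); rewrite subr0 => h.
  by move: Cr0 A0 rhop0 rhom0 Cn0 B0 h; rewrite /u; lra.
pose D := envelope (t, y).
have Dle c x : 0 <= c -> c <= C -> x <= c * D -> x <= C * D.
  by move=> c0 cC /le_trans; apply; rewrite ler_wpM2r.
have in1 x c : `|y| <= M -> 0 <= c -> x <= c -> x <= c * D.
  move=> yM c0 /le_trans; apply; rewrite ler_peMr// /D /envelope/= yM.
  by rewrite lerDr addr_ge0.
have D1 : M < `|y| -> `|rhob (t, y) - hat y| <= D.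
  by move=> My; apply: (le_trans (yge _ My)); rewrite /D /envelope/= -addrA lerDl addr_ge0.
have D2 : M < `|y| -> `|nb (t, y)| <= D.
  move=> My; apply: (le_trans (yge _ My)).
  by rewrite /D /envelope/= -addrA addrCA lerDl addr_ge0.
have LM : L <= M by rewrite le_max lexx.
have roohat : M < `|y| -> roo y = hat y.
  rewrite ltr_normr => /orP[h|h]; rewrite /rho_hat.
    rewrite roo_right ?(le_lt_trans LM)// ifF//; apply/negbTE; rewrite -leNgt.
    by rewrite (le_trans _ (ltW h))// (le_trans ler01).
  rewrite roo_left; last by rewrite ltrNr (le_lt_trans LM).
  by rewrite ifT// -oppr_gt0 (lt_trans _ h)// (lt_le_trans ltr01).
have hatlu : l <= hat y <= u.
  by rewrite /rho_hat; case: ifP => _; rewrite ?rhom_ge ?rhop_ge.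
have rlu : l <= rhob (t, y) <= u by rewrite lr ru.
split; split => //.
- have := hA (t, y) tT; have := hB (t, y) tT; rewrite /= subr0 /envelope/=.
  have : (`|y| <= M)%R%:R <= 1 :> R by case: (`|y| <= M).
  move: u0 C10 C20 C30 C40 W0 P0; rewrite /C; lra.
- have [yM|My] := leP `|y| M.
    apply: (Dle u) => //; last exact: in1.
    by move: u0 A0 B0 C10 C20 C30 C40 W0 P0; rewrite /C; lra.
  apply: (Dle 1) => //; last by rewrite mul1r; exact: D2.
  by move: u0 A0 B0 C10 C20 C30 C40 W0 P0; rewrite /C; lra.
- have [yM|My] := leP `|y| M.
    apply: (Dle (C3 + W)); first exact: addr_ge0.
      by move: u0 A0 B0 C10 C20 C30 C40 W0 P0; rewrite /C; lra.
    apply: (in1 _ _ yM); first exact: addr_ge0.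
    by apply: (le_trans (ler_normB _ _)); apply: lerD; [exact: hC3|exact: hW].
  apply: (Dle C1) => //.
    by move: u0 A0 B0 C10 C20 C30 C40 W0 P0; rewrite /C; lra.
  rewrite /= roohat//; apply: (le_trans (hC1 _ _ rlu hatlu)).
  by rewrite ler_wpM2l// D1.
- have [yM|My] := leP `|y| M.
    apply: (Dle (C4 + P)); first exact: addr_ge0.
      by move: u0 A0 B0 C10 C20 C30 C40 W0 P0; rewrite /C; lra.
    apply: (in1 _ _ yM); first exact: addr_ge0.
    by apply: (le_trans (ler_normB _ _)); apply: lerD; [exact: hC4|exact: hP].
  apply: (Dle C2) => //.
    by move: u0 A0 B0 C10 C20 C30 C40 W0 P0; rewrite /C; lra.
  rewrite /= roohat//; apply: (le_trans (hC2 _ _ rlu hatlu)).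
  by rewrite ler_wpM2l// D1.
Qed.

Lemma measurable_envelope : measurable_fun (open_half : set plane) envelope.
Proof.
have [m1 _] := y_rhob; have [m2 _] := y_nb.
have m3 : measurable_fun (open_half : set plane) (fun p => (`|p.2| <= M)%R%:R : R).
  apply: (@measurable_snd_fun R (fun y => (`|y| <= M)%R%:R)).
  rewrite (_ : (fun y => _) = \1_(`[- M, M]%classic)).
    by apply: measurable_indic; exact: measurable_itv.
  by apply/funext => y; rewrite indicE mem_setE in_itv/= ler_norml.
apply: measurable_funD => //; apply: measurable_funD; exact: measurableT_comp.
Qed.

Lemma envelope_strip (T : R) : mu2.-integrable (strip T) (EFin \o envelope).
Proof.
have ms := @measurable_strip R T.
have i1 := integrable_abse (Linf_strip T y_rhob).
have i2 := integrable_abse (Linf_strip T y_nb).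
have mD := measurable_funS (@measurable_open_half R) (@strip_open R T) measurable_envelope.
have i3 : mu2.-integrable (strip T) (EFin \o (fun p => (`|p.2| <= M)%R%:R : R)).
  have mb := @measurable_box R T M.
  have := one_box T M; rewrite (_ : box T M = strip T `&` box T M); last first.
    by apply/esym/setIidr => p [p0 [pT _]].
  move/(integrable_restrict mu2 mb ms); apply: eq_integrable => // -[t y] /set_mem/= [t0 tT].
  rewrite patchE; case: ifPn => [/set_mem[_ [_ /= ->]]//|/negP h].
  by case: (boolP (`|y| <= M)) => // yM; case: h; rewrite inE.
apply: (@integrable_Rle _ _ _ mu2 _ ms _ envelope mD (integrable_RD ms (integrable_RD ms i1 i2) i3)) => p _ /=.
by rewrite ger0_norm// envelope_ge0.
Qed.

Lemma envelope_zero : mu.-integrable setT (EFin \o (fun y => envelope (0, y))).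
Proof.
have [_ i1] := rhob_bd 0; have [_ i2] := nb_bd 0.
have j1 := integrable_abse i1; have j2 := integrable_abse i2.
have i3 : mu.-integrable setT (EFin \o (fun y => (`|y| <= M)%R%:R : R)).
  have := @integrable_indic_itv R (- M) M true false.
  by apply: eq_integrable => // y _ /=; rewrite indicE mem_setE in_itv/= ler_norml.
have := integrable_RD measurableT (integrable_RD measurableT j1 j2) i3.
by apply: eq_integrable => // y _ /=; rewrite /envelope/= subr0.
Qed.

End envelope.

(** * Densities of the relative entropy *)

Section densities.
Context {R : realType}.
Variables (k gamma : R).
Hypotheses (k0 : 0 < k) (gamma1 : 1 <= gamma).
Local Notation pot := (pot k gamma).
Local Notation dpot := (dpot k gamma).
Local Notation pressure := (pressure k gamma).

Lemma kinetic_fin (r m : R) : (r = 0 -> m = 0) -> kinetic r m = (m ^+ 2 / r)%:E.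
Proof. by move=> rm; rewrite /kinetic ifF//; case: eqP => //= /rm ->; rewrite eqxx. Qed.

Lemma rel_kinetic_fin (r m v : R) : (r = 0 -> m = 0) ->
  rel_kinetic r m v = (m ^+ 2 / r - 2 * v * m + r * v ^+ 2)%:E.
Proof.
move=> rm; rewrite /rel_kinetic; have [r0|r0] := eqVneq r 0.
  by rewrite (rm r0) r0 eqxx/=; congr EFin; rewrite !mul0r mulr0 expr0n mul0r subrr addr0.
by rewrite /= real_normK ?num_real//; congr EFin; field.
Qed.

Lemma rel_pot_fin (r rb : R) : 0 <= r -> 0 <= rb -> (gamma == 1 -> 0 < rb) ->
  rel_pot k gamma r rb = (pot r - dpot rb * r + pressure rb)%:E.
Proof.
move=> r0 rb0 rb1; rewrite /rel_pot !ltNge r0 rb0/= ifF.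
  by rewrite -(legendre k gamma1 rb0 rb1); congr EFin; ring.
by apply/negbTE/negP => /and3P[/rb1 + /eqP rb00 _]; rewrite rb00 ltxx.
Qed.

(** Convexity of h when rb > 0; when rb = 0, which requires gamma > 1, the expression is h(r)
    itself. *)
Lemma rel_pot_ge0 (r rb : R) : 0 <= r -> 0 <= rb -> (gamma == 1 -> 0 < rb) ->
  0 <= pot r - dpot rb * r + pressure rb.
Proof.
move=> r0; rewrite le_eqVlt => /predU1P[<-|rb0] rb1.
  have g1 : gamma == 1 = false by apply/negbTE/negP => /rb1; rewrite ltxx.
  have g0 : 0 < gamma - 1 by rewrite subr_gt0 lt_neqAle eq_sym g1.
  have gn0 : gamma != 0 by rewrite gt_eqF// (lt_le_trans ltr01).
  rewrite /Defs.dpot /Defs.pot /Defs.pressure g1 (powR0 gn0) powR0 ?gt_eqF//.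
  rewrite !mulr0 mul0r subr0 addr0; apply: mulr_ge0; last exact: powR_ge0.
  by apply: mulr_ge0; rewrite ?invr_ge0 ltW.
by have := pot_tangent k0 gamma1 r0 rb0; lra.
Qed.

Lemma vacuum_momentum (c : R) (r m v rb : R) : 0 < c -> 0 <= r ->
  (c%:E * rel_kinetic r m v + rel_pot k gamma r rb < +oo)%E -> r = 0 -> m = 0.
Proof.
move=> c0 r0 + r00; apply: contraPP => /eqP m0.
rewrite /rel_kinetic r00 eqxx m0/= gt0_muley ?lte_fin//.
by rewrite addye// /rel_pot; case: ifPn.
Qed.

Section measurability.
Context d (T : measurableType d) (D : set T) (mD : measurable D).

Section one_function.
Variable f : T -> R.
Hypothesis mf : measurable_fun D f.

Lemma measurable_comp_powR (a : R) : measurable_fun D (fun x => f x `^ a).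
Proof. by apply: (measurableT_comp (measurable_powR a)). Qed.

Lemma measurable_comp_pressure : measurable_fun D (fun x => pressure (f x)).
Proof. by apply: measurable_funM => //; exact: measurable_comp_powR. Qed.

Lemma measurable_comp_pot : measurable_fun D (fun x => pot (f x)).
Proof.
rewrite /Defs.pot; case: (gamma == 1).
  apply: measurable_funM; first exact: measurable_funM.
  exact: (measurableT_comp (@measurable_ln R)).
by apply: measurable_funM => //; exact: measurable_comp_powR.
Qed.

Lemma measurable_comp_dpot : measurable_fun D (fun x => dpot (f x)).
Proof.
rewrite /Defs.dpot; case: (gamma == 1).
  apply: measurable_funM => //; apply: measurable_funD => //.
  exact: (measurableT_comp (@measurable_ln R)).
by apply: measurable_funM => //; exact: measurable_comp_powR.
Qed.

Lemma measurable_eq0 : measurable_fun D (fun x => f x == 0).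
Proof. by apply: measurable_fun_eqr. Qed.

End one_function.

Variables (f g h : T -> R).
Hypotheses (mf : measurable_fun D f) (mg : measurable_fun D g) (mh : measurable_fun D h).

Lemma measurable_kinetic : measurable_fun D (fun x => kinetic (f x) (g x)).
Proof.
apply: measurable_fun_if => //.
- apply: measurable_and; first exact: measurable_eq0.
  by apply: measurable_neg; exact: measurable_eq0.
- apply/measurable_EFinP; apply: (@measurable_funS _ _ _ _ D) => //.
  apply: measurable_funM; first exact: measurable_funX.
  exact: measurable_inv.
Qed.

Lemma measurable_rel_kinetic : measurable_fun D (fun x => rel_kinetic (f x) (g x) (h x)).
Proof.
apply: measurable_fun_if => //.
- apply: measurable_and; first exact: measurable_eq0.
  by apply: measurable_neg; exact: measurable_eq0.
- apply/measurable_EFinP; apply: (@measurable_funS _ _ _ _ D) => //.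
  apply: measurable_funM => //; apply: measurable_funX; apply: measurableT_comp => //.
  apply: measurable_funB => //; apply: measurable_funM => //.
  exact: measurable_inv.
Qed.

Lemma measurable_rel_pot : measurable_fun D (fun x => rel_pot k gamma (f x) (g x)).
Proof.
apply: measurable_fun_if => //.
- apply: measurable_or; first exact: measurable_fun_ltr.
  apply: measurable_or; first exact: measurable_fun_ltr.
  apply: measurable_and => //; apply: measurable_and; first exact: measurable_eq0.
  by apply: measurable_neg; exact: measurable_eq0.
- apply/measurable_EFinP; apply: (@measurable_funS _ _ _ _ D) => //.
  apply: measurable_funB; first by apply: measurable_funB; exact: measurable_comp_pot.
  by apply: measurable_funM; [exact: measurable_comp_dpot|exact: measurable_funB].
Qed.

End measurability.
End densities.

(** * Iterated integrals *)

Lemma integrable_ae_le d (T : measurableType d) (R : realType)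
    (mu : {measure set T -> \bar R}) (D : set T) (mD : measurable D) (F G : T -> R) :
  measurable_fun D F -> mu.-integrable D (EFin \o G) ->
  {ae mu, forall x, D x -> `|F x| <= G x} -> mu.-integrable D (EFin \o F).
Proof.
move=> mF iG FG; apply/integrableP; split; first exact/measurable_EFinP.
case/integrableP : (iG) => mG; apply: le_lt_trans.
apply: ae_ge0_le_integral => //.
- by apply: measurableT_comp => //; exact/measurable_EFinP.
- exact: measurableT_comp.
- apply: (ae_mono _ FG) => x h Dx; rewrite /= lee_fin.
  by rewrite (le_trans (h Dx))// ler_norm.
Qed.

Section slices.
Context {R : realType}.
Local Notation mu := (@lebesgue_measure R).
Local Notation plane := (measurableTypeR R * measurableTypeR R)%type.
Local Notation mu2 := (mu \x mu)%E.
Implicit Types (F A : R * R -> R) (c : R -> R).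

Let mo := @measurable_open_half R.
Let mI : measurable (`]0, +oo[%classic : set (measurableTypeR R)).
Proof. exact: measurable_itv. Qed.

Lemma strip_mul c F (T C : R) :
  measurable_fun (setT : set (measurableTypeR R)) c ->
  (forall t, 0 < t -> `|c t| <= C) -> (forall t, T < t -> c t = 0) ->
  mu2.-integrable (strip T) (EFin \o F) ->
  mu2.-integrable open_half (EFin \o (fun p => c p.1 * F p)).
Proof.
move=> mc cC cT iF; have ms := @measurable_strip R T.
have mc' : measurable_fun (strip T : set plane) (fun p => c p.1).
  by apply: measurable_funS mo (@strip_open R T) (measurable_fst_fun mc).
have := integrable_bounded_mul ms mc' (fun p h => cC p.1 (strip_open h)) iF.
rewrite {1}(_ : strip T = open_half `&` strip T); last exact/esym/setIidr/strip_open.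
move/(integrable_restrict mu2 ms mo); apply: eq_integrable => // p /set_mem p0.
rewrite patchE; case: ifPn => // /negP h /=; rewrite cT ?mul0r// ltNge.
by apply/negP => pT; apply: h; rewrite inE.
Qed.

(** Fubini on the strips of integer height gives integrable slices for almost every t; countably
    many exceptional null sets are discarded. It converts extended-valued densities into their real
    versions on almost every slice. *)
Lemma slice_integral (f : R * R -> \bar R) F :
  measurable_fun (open_half : set plane) f ->
  {ae mu2, forall p, open_half p -> f p = (F p)%:E} ->
  (forall T, mu2.-integrable (strip T) (EFin \o F)) ->
  {ae mu, forall t, 0 < t -> mu.-integrable setT (EFin \o (fun y => F (t, y))) /\
    (\int[mu]_y f (t, y) = (\int[mu]_y F (t, y))%:E)%E}.
Proof.
move=> mf fF iF.
have iFm (m : nat) : {ae mu, forall t, 0 < t -> t <= m%:R ->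
    mu.-integrable setT (EFin \o (fun y => F (t, y)))}.
  have mc : measurable_fun (setT : set (measurableTypeR R)) (\1_(`]0, m%:R]%classic) : measurableTypeR R -> R).
    by apply: measurable_indic; exact: measurable_itv.
  have c1 (t : R) : 0 < t -> `|\1_(`]0, m%:R]%classic) t : R| <= 1.
    by move=> _; rewrite indicE; case: (_ \in _); rewrite ?normr1 ?normr0.
  have c0 (t : R) : m%:R < t -> \1_(`]0, m%:R]%classic) t = 0 :> R.
    by move=> mt; rewrite indicE mem_setE in_itv/= (leNgt t) mt andbF.
  have [h _ _] := fubini_half (strip_mul mc c1 c0 (iF m%:R)).
  apply: (ae_mono _ h) => t {}h t0 tm; apply: eq_integrable (h t0) => // y _ /=.
  by rewrite indicE mem_setE in_itv/= t0 tm mul1r.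
have h1 := ae_foralln iFm.
have h2 := ae_section fF.
apply: (ae_mono _ (ae_and h1 h2)) => t [{}h1 {}h2] t0.
have it : mu.-integrable setT (EFin \o (fun y => F (t, y))).
  have [m _ tm] := ex_nat_above t; exact: (h1 m).
split => //; apply: (eq_trans _ (EFin_Rintegral measurableT it)).
apply: ae_eq_integral => //.
- exact: measurable_half_section.
- exact: measurable_int it.
- by apply: (ae_mono _ h2) => y h _; exact: h.
Qed.

Lemma iterated_integral (G : R -> \bar R) A :
  measurable_fun (`]0, +oo[%classic : set (measurableTypeR R)) G ->
  mu2.-integrable open_half (EFin \o A) ->
  {ae mu, forall t, 0 < t -> G t = (\int[mu]_y A (t, y))%:E} ->
  (\int[mu]_(t in `]0%R, +oo[) G t = (\int[mu2]_(p in open_half) A p)%:E)%E.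
Proof.
move=> mG iA GA; have [i1 i2 E] := fubini_half iA.
apply: (eq_trans _ (EFin_Rintegral mo iA)); rewrite [RHS]E; apply: ae_eq_integral => //.
- exact: measurable_int i2.
- apply: (ae_mono _ (ae_and GA i1)) => t [h {}i1] /=; rewrite in_itv/= andbT => t0.
  by rewrite h//; apply/esym/EFin_Rintegral => //; exact: i1.
Qed.

End slices.

(** With a nonincreasing weight every term on the left of the total relative entropy condition is
    nonnegative. *)
Lemma time_cutoff (R : realType) (T : R) : 0 <= T -> exists phi : R -> R, exists N : R,
  [/\ smooth phi, forall t, 0 <= t -> 0 <= phi t, forall t, 0 <= t <= T -> phi t = 1,
      forall t, 0 < t -> derive1 phi t <= 0 & forall t, N <= `|t| -> phi t = 0].
Proof.
move=> T0; have [A [S [sS dS [Am _ _] [Sm S0 S1]]]] := @smooth_step R.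
(* The second factor descends from 1 to 0 on [T, T + 2]. The first is 1 for t >= -1 and only makes
   the support compact at negative times. *)
pose phi t := S (1 * t + 3) * (1 + -1 * S (1 * t - T)).
exists phi, (T + 3); split.
- move=> m; apply: CkM; first exact: Ck_affine.
  apply: CkD; first exact: Ck_cst.
  by apply: CkM; [exact: Ck_cst|exact: Ck_affine].
- move=> t t0; apply: mulr_ge0; first by rewrite -(S0 0 (lexx 0)) Sm//; lra.
  have : S (1 * t - T) <= S (Num.max (1 * t - T) 2) by rewrite Sm// le_max lexx.
  by rewrite (S1 (Num.max _ _)); [lra|rewrite le_max lexx orbT].
- by move=> t /andP[t0 tT]; rewrite /phi S1 ?S0; lra.
- move=> t t0.
  have d : is_derive t 1 (fun x => 1 - S (x - T)) (- (A (t - T) - A (t - T - 1))).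
    have d1 : is_derive t 1 (fun x : R => x - T) 1.
      apply: (is_derive_eq (is_deriveB (is_derive_id t 1) (is_derive_cst T t 1))).
      by rewrite subr0.
    have d2 := is_derive1_comp (g := fun x => x - T) (dS (t - T)) d1.
    apply: (is_derive_eq (is_deriveB (is_derive_cst (1 : R) t 1) d2)).
    by rewrite mulr1 sub0r.
  have d' : is_derive t 1 phi (- (A (t - T) - A (t - T - 1))).
    apply: near_eq_is_derive d; near=> x.
    have x0 : 0 < x by near: x; exact: lt_nbhsr.
    by rewrite /phi !mul1r mulN1r (S1 (x + 3)) ?mul1r//; lra.
  rewrite derive1E (@derive_val _ _ _ _ _ _ _ d') oppr_le0 subr_ge0; apply: Am; lra.
- move=> t; rewrite ler_normr => /orP[h|h].
    by rewrite /phi [X in _ * (1 + -1 * X)]S1; lra.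
  by rewrite /phi S0 ?mul0r//; lra.
Unshelve. all: end_near.
Qed.

Section weighted_iterated_integrals.
Context {R : realType}.
Local Notation mu := (@lebesgue_measure R).
Local Notation plane := (measurableTypeR R * measurableTypeR R)%type.
Local Notation mu2 := (mu \x mu)%E.
Local Notation half_line := (`]0%R, +oo[%classic : set (measurableTypeR R)).

Let mo := @measurable_open_half R.

Definition time_weight (c : R -> R) := [/\ measurable_fun (setT : set (measurableTypeR R)) c,
  exists C : R, forall t, 0 < t -> `|c t| <= C & exists T : R, forall t, T < t -> c t = 0].

Lemma weight_integrable c F : time_weight c ->
  (forall T, mu2.-integrable (strip T) (EFin \o F)) ->
  mu2.-integrable open_half (EFin \o (fun p => c p.1 * F p)).
Proof. by move=> [mc [C hC] [T hT]] iF; exact: (strip_mul mc hC hT). Qed.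

Lemma measurable_weight c : time_weight c -> measurable_fun half_line (fun t => (c t)%:E).
Proof. by move=> [mc _ _]; apply/measurable_EFinP; exact: measurable_funTS. Qed.

Lemma weighted_iterated (c1 c2 : R -> R) (E J : R -> \bar R) (F G : R * R -> R) :
  time_weight c1 -> time_weight c2 ->
  measurable_fun half_line E -> measurable_fun half_line J ->
  (forall T, mu2.-integrable (strip T) (EFin \o F)) ->
  (forall T, mu2.-integrable (strip T) (EFin \o G)) ->
  {ae mu, forall t, 0 < t -> mu.-integrable setT (EFin \o (fun y => F (t, y))) /\
    E t = (\int[mu]_y F (t, y))%:E} ->
  {ae mu, forall t, 0 < t -> mu.-integrable setT (EFin \o (fun y => G (t, y))) /\
    J t = (\int[mu]_y G (t, y))%:E} ->
  let A p := c1 p.1 * F p + c2 p.1 * (2^-1 * F p + G p) in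
  mu2.-integrable open_half (EFin \o A) /\
  (\int[mu]_(t in `]0%R, +oo[) ((c1 t)%:E * E t + (c2 t)%:E * (2^-1%:E * E t + J t))
    = (\int[mu2]_(p in open_half) A p)%:E)%E.
Proof.
move=> w1 w2 mE mJ iF iG EF JG A.
have i1 T : mu2.-integrable (strip T) (EFin \o (fun p => 2^-1 * F p + G p)).
  have ms := @measurable_strip R T.
  by apply: integrable_RD => //; exact: integrable_RZ.
have iA : mu2.-integrable open_half (EFin \o A).
  by apply: integrable_RD => //; exact: weight_integrable.
split => //; apply: iterated_integral => //.
  have m1 := measurable_weight w1; have m2 := measurable_weight w2.
  apply: emeasurable_funD; first exact: emeasurable_funM.
  apply: emeasurable_funM => //; apply: emeasurable_funD => //.
  exact: emeasurable_funM.
apply: (ae_mono _ (ae_and EF JG)) => t [hF hG] t0.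
have [jF ->] := hF t0; have [jG ->] := hG t0.
have j2 := integrable_RZ measurableT 2^-1 jF.
have j3 := integrable_RD measurableT j2 jG.
have j4 := integrable_RZ measurableT (c2 t) j3.
have j1 := integrable_RZ measurableT (c1 t) jF.
rewrite /A /= (RintegralD measurableT j1 j4) (RintegralZl _ measurableT jF).
by rewrite (RintegralZl _ measurableT j3) (RintegralD measurableT j2 jG) (RintegralZl _ measurableT jF).
Qed.

(** Only the product of [c] and [F] is assumed integrable, as is the case for xi. Where c(t) = 0
    both sides vanish whatever the slice of [F]; elsewhere one divides by c(t). *)
Lemma weighted_iterated1 (c : R -> R) (F : R * R -> R) :
  measurable_fun half_line (fun t => (c t)%:E) -> measurable_fun (open_half : set plane) F ->
  mu2.-integrable open_half (EFin \o (fun p => c p.1 * F p)) ->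
  (\int[mu]_(t in `]0%R, +oo[) ((c t)%:E * \int[mu]_y (F (t, y))%:E)
    = (\int[mu2]_(p in open_half) (c p.1 * F p))%:E)%E.
Proof.
move=> mc mF iF; apply: iterated_integral => //.
  apply: emeasurable_funM => //.
  by apply: (@measurable_half_iter _ (EFin \o F)); exact/measurable_EFinP.
have [h _ _] := fubini_half iF.
apply: (ae_mono _ h) => t {}h t0; have [c0|c0] := eqVneq (c t) 0.
  rewrite c0 mul0e /Rintegral integral0_eq// => y _ /=.
  by rewrite mul0r.
have j : mu.-integrable setT (EFin \o (fun y => F (t, y))).
  have := integrable_RZ measurableT (c t)^-1 (h t0).
  by apply: eq_integrable => // y _ /=; rewrite mulKf.
by rewrite (EFin_Rintegral measurableT j) /= (RintegralZl _ measurableT j).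
Qed.

End weighted_iterated_integrals.

(** * Behaviour on the vacuum set *)

Section good_densities.
Context {R : realType}.
Local Notation mu := (@lebesgue_measure R).
Local Notation plane := (measurableTypeR R * measurableTypeR R)%type.
Local Notation mu2 := (mu \x mu)%E.
Variables (alpha k gamma : R) (rho0 n0 : R -> R) (rho n : R * R -> R).
Hypothesis sol : weak_solution alpha k gamma rho0 n0 rho n.

(** [kinetic] is +oo where rho = 0 and n <> 0, and its local integrability makes it finite almost
    everywhere on each of countably many boxes exhausting the half-plane. *)
Lemma physical_ae : {ae mu2, forall p, open_half p ->
  0 <= rho p /\ (rho p = 0 -> n p = 0)}.
Proof.
have h1 := ws_rho_ge0 sol.
have h2 : {ae mu2, forall p (m : nat), box m%:R m%:R p -> kinetic (rho p) (n p) \is a fin_num}.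
  apply: ae_foralln => m.
  by apply: (integrable_ae (@measurable_box R _ _)); exact: L1loc_box (ws_kinetic_L1loc sol).
apply: (ae_mono _ (ae_and h1 h2)) => p [{}h1 {}h2] p0; split; first exact/h1/ltW.
have [m _ hm] := ex_nat_above (Num.max p.1 `|p.2|).
have hb : box m%:R m%:R p by move: hm; rewrite ge_max => /andP[hm1 hm2]; split.
by move=> r0; apply/eqP/negPn/negP => n00; have := h2 m hb; rewrite /kinetic r0 eqxx n00.
Qed.

End good_densities.

(** * Consequences of the total relative entropy condition *)

Section entropy_integrability.
Context {R : realType}.
Local Notation mu := (@lebesgue_measure R).
Local Notation plane := (measurableTypeR R * measurableTypeR R)%type.
Local Notation mu2 := (mu \x mu)%E.
Local Notation half_line := (`]0%R, +oo[%classic : set (measurableTypeR R)).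
Variables (alpha k gamma : R) (rho0 n0 : R -> R) (rho n : R * R -> R).
Variables (roo w' : R -> R) (L W' E0 : R).
Hypotheses (alpha0 : 0 <= alpha) (k0 : 0 < k) (gamma1 : 1 <= gamma).
Hypothesis sol : weak_solution alpha k gamma rho0 n0 rho n.
Hypothesis roo_ge0 : forall y, 0 <= roo y.
Hypothesis roo_gt0 : forall y, gamma == 1 -> 0 < roo y.
Hypothesis roo_cont : continuous roo.
Hypothesis w'_cont : continuous w'.
Hypothesis w'_supp : forall y, L < `|y| -> w' y = 0.
Hypothesis w'_bound : forall y, `|w' y| <= W'.
Hypothesis TRE : forall phi : R -> R, test_fun phi -> (forall t, 0 <= t -> 0 <= phi t) ->
  let E t := rel_entropy k gamma t (fun y => rho (t, y)) (fun y => n (t, y)) roo (cst 0) in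
  (\int[mu]_(t in `]0%R, +oo[)
     ((- derive1 phi t)%:E * E t
      + (phi t)%:E * (2^-1%:E * E t
          + \int[mu]_y (alpha%:E * kinetic (rho (t, y)) (n (t, y)))))
   <= (phi 0)%:E * E0%:E
      + \int[mu]_(t in `]0%R, +oo[)
          ((phi t)%:E * \int[mu]_y
             (w' y * (y / 2 * (rho (t, y) - roo y) - n (t, y)))%:E))%E.

Let mo := @measurable_open_half R.

Definition kin_density (p : R * R) : R := n p ^+ 2 / rho p.
(** h(rho | rho_oo), rewritten by [legendre]. *)
Definition pot_density (p : R * R) : R :=
  pot k gamma (rho p) - dpot k gamma (roo p.2) * rho p + pressure k gamma (roo p.2).
Definition entropy_density (p : R * R) : R :=
  2^-1 * expR (- p.1) * kin_density p + pot_density p.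
Definition drift (p : R * R) : R :=
  w' p.2 * (p.2 / 2 * (rho p - roo p.2) - n p).

Local Notation K := kin_density.
Local Notation H := pot_density.
Local Notation e := entropy_density.

Let f p := ((2^-1 * expR (- p.1))%:E * rel_kinetic (rho p) (n p) (0 / roo p.2)%R
  + rel_pot k gamma (rho p) (roo p.2))%E.
Let g p := (alpha%:E * kinetic (rho p) (n p))%E.

Lemma measurable_roo : measurable_fun (setT : set (measurableTypeR R)) roo.
Proof. exact: continuous_measurable_fun. Qed.

Lemma measurable_exp_fst : measurable_fun (open_half : set plane) (fun p => expR (- p.1)).
Proof.
apply: (@measurable_fst_fun R (fun t => expR (- t))); apply: continuous_measurable_fun => t.
by apply: (@cvg_comp _ _ _ -%R expR); [apply: cvgN; exact: cvg_id|exact: continuous_expR].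
Qed.

Let mrho := measurable_rho sol.
Let mn := measurable_n sol.
Let mroo := measurable_snd_fun measurable_roo.

Lemma measurable_kin_density : measurable_fun (open_half : set plane) K.
Proof. exact: measurable_kin sol. Qed.

Lemma measurable_pot_density : measurable_fun (open_half : set plane) H.
Proof.
apply: measurable_funD; last exact: measurable_comp_pressure.
apply: measurable_funB; first exact: measurable_comp_pot.
by apply: measurable_funM => //; exact: measurable_comp_dpot.
Qed.

Lemma measurable_entropy_density : measurable_fun (open_half : set plane) e.
Proof.
apply: measurable_funD; last exact: measurable_pot_density.
apply: measurable_funM; last exact: measurable_kin_density.
by apply: measurable_funM => //; exact: measurable_exp_fst.
Qed.

Let mf : measurable_fun (open_half : set plane) f.
Proof.
apply: emeasurable_funD; last exact: measurable_rel_pot.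
apply: emeasurable_funM.
  by apply/measurable_EFinP; apply: measurable_funM => //; exact: measurable_exp_fst.
apply: measurable_rel_kinetic => //; apply: measurable_funM => //; exact: measurable_inv.
Qed.

Let mg : measurable_fun (open_half : set plane) g.
Proof. by apply: emeasurable_funM => //; exact: measurable_kinetic. Qed.

Lemma entropy_ae : {ae mu2, forall p, open_half p ->
  [/\ f p = (e p)%:E, g p = (alpha * K p)%:E, 0 <= K p & 0 <= H p]}.
Proof.
apply: (ae_mono _ (physical_ae sol)) => p + p0 => /(_ p0)[r0 rn]; split.
- rewrite /f rel_kinetic_fin// (rel_pot_fin k gamma1 r0 (roo_ge0 _) (roo_gt0 _)).
  rewrite -EFinM -EFinD /= mul0r; congr EFin; rewrite /e /H /K; ring.
- by rewrite /g kinetic_fin.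
- by rewrite mulr_ge0 ?sqr_ge0// invr_ge0.
- exact: (rel_pot_ge0 k0 gamma1 r0 (roo_ge0 _) (roo_gt0 _)).
Qed.

(** w' vanishes for |y| > L, so the drift lives on a box, where local integrability of rho and n
    applies. *)
Lemma drift_strip T : mu2.-integrable (strip T) (EFin \o drift).
Proof.
have mb := @measurable_box R T L; have ms := @measurable_strip R T.
have mS := fun (F : R * R -> R) (mF : measurable_fun (open_half : set plane) F) =>
  measurable_funS mo (@box_open R T L) mF.
have [C C0 hC] := continuous_bounded L roo_cont.
have i1 : mu2.-integrable (box T L) (EFin \o (fun p => roo p.2 * cst 1 p)).
  apply: (@integrable_bounded_mul _ _ _ _ C mb (mS _ mroo) _ (one_box T L)).
  by move=> p [_ [_ pL]]; exact: hC.
have i2 := integrable_RB mb (rho_box sol T L) i1.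
have i3 := integrable_RB mb (integrable_RZ mb (-1) (y_box i2)) (n_box sol T L).
have i4 := integrable_bounded_mul mb
  (mS _ (measurable_snd_fun (continuous_measurable_fun w'_cont))) (fun p _ => w'_bound p.2) i3.
have i5 : mu2.-integrable (strip T `&` box T L) (EFin \o drift).
  rewrite (_ : _ `&` _ = box T L); last by apply: setIidr => p [p0 [pT _]].
  by apply: eq_integrable i4 => // p _ /=; rewrite /drift /= mulr1; congr EFin; ring.
move/(integrable_restrict mu2 mb ms): i5; apply: eq_integrable => // p /set_mem[p0 pT].
rewrite patchE; case: ifPn => // /negP h; rewrite /= /drift w'_supp ?mul0r// ltNge.
by apply/negP => pL; apply: h; rewrite inE.
Qed.

Lemma measurable_drift : measurable_fun (open_half : set plane) drift.
Proof.
apply: measurable_funM; first exact: measurable_snd_fun (continuous_measurable_fun w'_cont).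
apply: measurable_funB => //; apply: measurable_funM; last exact: measurable_funB.
apply: (@measurable_snd_fun R (fun y => y / 2)); apply: continuous_measurable_fun => y.
by apply: cvgM; [exact: cvg_id|exact: cvg_cst].
Qed.

Lemma weight_continuous (c : R -> R) (N : R) : continuous c ->
  (forall t, N < `|t| -> c t = 0) -> time_weight c.
Proof.
move=> cc cN; split; first exact: continuous_measurable_fun.
- by have [C _ hC] := supp_bounded cc cN; exists C.
- by exists N => t Nt; rewrite cN// (lt_le_trans Nt)// ler_norm.
Qed.

Lemma drift_iterated (c : R -> R) : time_weight c ->
  (\int[mu]_(t in `]0%R, +oo[) ((c t)%:E * \int[mu]_y
     (w' y * (y / 2 * (rho (t, y) - roo y) - n (t, y)))%:E)
   = (\int[mu2]_(p in open_half) (c p.1 * drift p))%:E)%E.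
Proof.
move=> wc; apply: (weighted_iterated1 (measurable_weight wc) measurable_drift).
exact: (weight_integrable wc drift_strip).
Qed.

(** The total relative entropy condition with the weight of [time_cutoff] has a finite right side by
    [drift_strip]. On the left all terms are nonnegative, and on (0, T], where the weight is 1, they
    contain half of the relative entropy. *)
Lemma entropy_strip T : mu2.-integrable (strip T) (EFin \o e).
Proof.
have ms := @measurable_strip R T.
have me := measurable_entropy_density.
have me' : measurable_fun (strip T : set plane) e := measurable_funS mo (@strip_open R T) me.
have T0 : 0 <= Num.max T 0 by rewrite le_max lexx orbT.
have [phi [N [sphi phi0 phi1 phi' phiN]]] := time_cutoff T0.
pose E t := (\int[mu]_y f (t, y))%E; pose J t := (\int[mu]_y g (t, y))%E.
(* The densities are nonnegative only almost everywhere; with absolute values the sign holds at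
   every time, and nothing changes for almost every t. *)
pose E' t := (\int[mu]_y `|e (t, y)|%:E)%E; pose J' t := (\int[mu]_y `|alpha * K (t, y)|%:E)%E.
have mE : measurable_fun half_line E by exact: measurable_half_iter.
have mJ : measurable_fun half_line J by exact: measurable_half_iter.
have mae : measurable_fun (open_half : set plane) (fun p => `|e p|%:E).
  by apply/measurable_EFinP; exact: measurableT_comp.
have maK : measurable_fun (open_half : set plane) (fun p => `|alpha * K p|%:E).
  apply/measurable_EFinP; apply: measurableT_comp => //.
  by apply: measurable_funM => //; exact: measurable_kin_density.
have mE' : measurable_fun half_line E' by exact: (measurable_half_iter mae).
have mJ' : measurable_fun half_line J' by exact: (measurable_half_iter maK).
have E'0 t : (0 <= E' t)%E by apply: integral_ge0 => y _; rewrite lee_fin.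
have J'0 t : (0 <= J' t)%E by apply: integral_ge0 => y _; rewrite lee_fin.
have EJ : {ae mu, forall t, 0 < t -> E t = E' t /\ J t = J' t}.
  apply: (ae_mono _ (ae_section entropy_ae)) => t h t0; split.
    apply: ae_eq_integral => //; first exact: (measurable_half_section mf t0).
      exact: (measurable_half_section mae t0).
    apply: (ae_mono _ h) => y /(_ t0)[-> _ K0 H0] _; rewrite ger0_norm//.
    by rewrite addr_ge0// mulr_ge0// mulr_ge0// expR_ge0.
  apply: ae_eq_integral => //; first exact: (measurable_half_section mg t0).
    exact: (measurable_half_section maK t0).
  by apply: (ae_mono _ h) => y /(_ t0)[_ -> K0 H0] _; rewrite ger0_norm// mulr_ge0.
have wphi : time_weight phi.
  apply: (weight_continuous (N := N)); first exact: smooth_continuous.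
  by move=> t Nt; apply: phiN; exact: ltW.
have [dphi sphi'] := smooth_derive sphi.
have wphi' : time_weight (fun t => - derive1 phi t).
  apply: (weight_continuous (N := N)).
    by move=> t; apply: cvgN; exact: (smooth_continuous sphi').
  by move=> t Nt; rewrite (derive1_supp sphi phiN)// oppr0.
pose G t := ((- derive1 phi t)%:E * E' t + (phi t)%:E * (2^-1%:E * E' t + J' t))%E.
have mG : measurable_fun half_line G.
  have m1 := measurable_weight wphi; have m2 := measurable_weight wphi'.
  apply: emeasurable_funD; first exact: emeasurable_funM.
  apply: emeasurable_funM => //; apply: emeasurable_funD => //.
  exact: emeasurable_funM.
have G0 t : 0 < t -> (0 <= G t)%E.
  move=> t0; apply: adde_ge0; apply: mule_ge0; rewrite ?lee_fin ?oppr_ge0 ?phi' ?phi0 ?(ltW t0)//.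
  by apply: adde_ge0 => //; apply: mule_ge0; rewrite // lee_fin.
have GE : (\int[mu]_(t in `]0%R, +oo[) G t < +oo)%E.
  have := TRE (test_fun_smooth sphi phiN) phi0.
  rewrite (drift_iterated wphi) -EFinM -EFinD => /le_lt_trans/(_ (ltry _)).
  apply: le_lt_trans; rewrite le_eqVlt; apply/orP; left; apply/eqP.
  have mI : measurable (`]0, +oo[%classic : set (measurableTypeR R)) by exact: measurable_itv.
  apply: ae_eq_integral => //.
    have m1 := measurable_weight wphi; have m2 := measurable_weight wphi'.
    apply: emeasurable_funD; first exact: emeasurable_funM.
    apply: emeasurable_funM => //; apply: emeasurable_funD => //.
    exact: emeasurable_funM.
  apply: (ae_mono _ EJ) => t h /=; rewrite in_itv/= andbT => /h[h1 h2].
  by rewrite /G -h1 -h2.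
apply/integrableP; split; first exact/measurable_EFinP.
rewrite (_ : strip T = open_half `&` strip T); last by apply/esym/setIidr/strip_open.
have mst : measurable_fun (open_half : set plane) ((abse \o (EFin \o e)) \_ (strip T)).
  apply/(measurable_restrict _ ms mo); rewrite setIidr; last exact: strip_open.
  by apply: measurableT_comp => //; exact/measurable_EFinP.
rewrite integral_mkcondr tonelli_half//; last first.
  by move=> p _; apply: erestrict_ge0 => q _ /=; rewrite lee_fin.
(* The factor 2 compensates the coefficient 1/2 of the entropy in [G]. *)
apply: (@le_lt_trans _ _ (\int[mu]_(t in `]0%R, +oo[) (2%:E * G t))%E); last first.
  rewrite ge0_integralZl//; first by rewrite lte_mul_pinfty.
  by move=> t /=; rewrite in_itv/= andbT => /G0.
apply: ge0_le_integral.
- exact: measurable_itv.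
- move=> t _; apply: integral_ge0 => y _; apply: erestrict_ge0 => q _ /=; by rewrite lee_fin.
- exact: measurable_half_iter.
- exact: emeasurable_funM.
move=> t /=; rewrite in_itv/= andbT => t0; have [tT|Tt] := leP t T; last first.
  rewrite integral0_eq; first by rewrite mule_ge0// G0.
  move=> y _; rewrite patchE; case: ifPn => // /set_mem[_ /=].
  by rewrite leNgt Tt.
apply: (@le_trans _ _ (E' t)).
  apply: ge0_le_integral => //.
  - by move=> y _; apply: erestrict_ge0 => q _ /=; rewrite lee_fin.
  - exact: (measurable_half_section mst).
  - exact: (measurable_half_section mae).
  - by move=> y _; rewrite patchE; case: ifPn => //= _; rewrite lee_fin.
have hG : (2^-1%:E * E' t <= G t)%E.
  rewrite /G phi1 ?mul1e; last by rewrite (ltW t0) le_max tT.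
  apply: (@le_trans _ _ (2^-1%:E * E' t + J' t)%E); first by rewrite leeDl.
  by rewrite leeDr// mule_ge0// lee_fin oppr_ge0 phi'.
apply: (@le_trans _ _ (2%:E * (2^-1%:E * E' t))%E); last by rewrite lee_pmul2l.
by rewrite muleA -EFinM divff// mul1e.
Qed.

(** On the strip exp(-tau) >= exp(-T), so the weight of the kinetic term in the entropy density is
    bounded below; hence the constant 2 exp(T). *)
Lemma kin_strip T : mu2.-integrable (strip T) (EFin \o K).
Proof.
have ms := @measurable_strip R T.
have mK : measurable_fun (strip T : set plane) K.
  exact: measurable_funS mo (@strip_open R T) measurable_kin_density.
apply: (integrable_ae_le ms mK (integrable_RZ ms (2 * expR T) (entropy_strip T))).
apply: (ae_mono _ entropy_ae) => p h [p0 pT]; have [_ _ K0 H0] := h p0.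
rewrite (ger0_norm K0); apply: (@le_trans _ _ (2 * expR T * (2^-1 * expR (- p.1) * K p))).
  have -> : 2 * expR T * (2^-1 * expR (- p.1) * K p) = expR T * expR (- p.1) * K p by field.
  rewrite ler_peMl// -expRD -expR0 ler_expR subr_ge0//.
by rewrite ler_wpM2l ?mulr_ge0 ?expR_ge0// lerDl.
Qed.

Lemma pot_strip T : mu2.-integrable (strip T) (EFin \o H).
Proof.
have ms := @measurable_strip R T.
have mH : measurable_fun (strip T : set plane) H.
  exact: measurable_funS mo (@strip_open R T) measurable_pot_density.
apply: (integrable_ae_le ms mH (entropy_strip T)).
apply: (ae_mono _ entropy_ae) => p h [p0 pT]; have [_ _ K0 H0] := h p0.
by rewrite (ger0_norm H0) lerDr mulr_ge0// mulr_ge0// expR_ge0.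
Qed.

Lemma smooth_entropy_inequality (phi : R -> R) (N : R) : smooth phi ->
  (forall t, N <= `|t| -> phi t = 0) -> (forall t, 0 <= t -> 0 <= phi t) ->
  \int[mu2]_(p in open_half)
    (- derive1 phi p.1 * e p + phi p.1 * (2^-1 * e p + alpha * K p))
  <= phi 0 * E0 + \int[mu2]_(p in open_half) (phi p.1 * drift p).
Proof.
move=> sphi phiN phi0; have [dphi sphi'] := smooth_derive sphi.
have wphi : time_weight phi.
  apply: (weight_continuous (N := N)); first exact: smooth_continuous.
  by move=> t Nt; apply: phiN; exact: ltW.
have wphi' : time_weight (fun t => - derive1 phi t).
  apply: (weight_continuous (N := N)).
    by move=> t; apply: cvgN; exact: (smooth_continuous sphi').
  by move=> t Nt; rewrite (derive1_supp sphi phiN)// oppr0.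
have iK T := integrable_RZ (@measurable_strip R T) alpha (kin_strip T).
have fe : {ae mu2, forall p, open_half p -> f p = (e p)%:E}.
  by apply: (ae_mono _ entropy_ae) => p + p0 => /(_ p0)[].
have gK : {ae mu2, forall p, open_half p -> g p = (alpha * K p)%:E}.
  by apply: (ae_mono _ entropy_ae) => p + p0 => /(_ p0)[].
have [_ E] := weighted_iterated wphi' wphi (measurable_half_iter mf) (measurable_half_iter mg)
  entropy_strip iK (slice_integral mf fe entropy_strip) (slice_integral mg gK iK).
have := TRE (test_fun_smooth sphi phiN) phi0.
by rewrite (drift_iterated wphi) -EFinM -EFinD -lee_fin => h; rewrite -E.
Qed.

End entropy_integrability.

(** Quasi-interpolants again. The bumps are nonnegative and only later times are sampled, so
    nonnegativity of phi on [0, oo) alone is preserved; the support grows by at most 3, the widest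
    reach of a bump. *)
Lemma C1_approximation (R : realType) (phi : R -> R) (N : R) : C1 phi ->
  (forall t, N <= `|t| -> phi t = 0) ->
  exists phi_ : nat -> R -> R, exists2 C : R, 0 <= C &
  [/\ forall m, smooth (phi_ m), forall m t, N + 3 <= `|t| -> phi_ m t = 0,
      (forall t, 0 <= t -> 0 <= phi t) -> forall m t, 0 <= t -> 0 <= phi_ m t,
      forall m t, `|phi_ m t| <= C /\ `|derive1 (phi_ m) t| <= C &
      forall t, phi_ m t @[m --> \oo] --> phi t /\
        derive1 (phi_ m) t @[m --> \oo] --> derive1 phi t].
Proof.
move=> [dphi' cphi'] phiN.
have dphi (t : R) : is_derive t 1 phi (derive1 phi t).
  by rewrite derive1E; exact: derivableP.
have cphi : continuous phi by move=> t; exact: derivable_cvg (dphi t).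
have phi'N t : N < `|t| -> derive1 phi t = 0 by exact: (supp_derive dphi phiN).
have [T [S [sS dS [Tm T0 T1] [Sm S0 S1]]]] := @smooth_step R.
have [M M3 NM] := ex_nat_above (N + 4).
have phiM x : M%:R - 3 <= `|x| -> phi x = 0 by move=> h; apply: phiN; lra.
have M3' : 3 <= M%:R :> R by rewrite (ler_nat _ 3).
have [C1 C10 hC1] := supp_bounded cphi (fun t h => phiN t (ltW h)).
have [C2 C20 hC2] := supp_bounded cphi' phi'N.
have dQ m (t : R) : is_derive t 1 (Q S M m phi) (Qd T M m phi t).
  have -> : Q S M m phi = \sum_(i < size_grid M m)
      (phi (node M m i) \*: (fun t => bump S i (zoom M m t))).
    by apply/funext => s; rewrite fct_sumE.
  rewrite /Qd; apply: is_derive_sum => i.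
  exact: is_deriveZ (is_derive_bump dS M m i t).
have dQ1 m : derive1 (Q S M m phi) = Qd T M m phi by exact: is_derive_derive1.
exists (fun m => Q S M m phi), (C1 + C2); first exact: addr_ge0.
split.
- move=> m j; rewrite /Q.
  rewrite (_ : (fun t => _) = (fun t => \sum_(i <- index_enum 'I_(size_grid M m)) phi (node M m i) * bump S i (zoom M m t)))//.
  elim: index_enum => [|i s IH].
    by rewrite (_ : (fun t => _) = cst 0); [exact: Ck_cst|apply/funext => t; rewrite big_nil].
  rewrite (_ : (fun t => _) = (fun t => cst (phi (node M m i)) t * bump S i (zoom M m t) +
    \sum_(i <- s) phi (node M m i) * bump S i (zoom M m t))).
    by apply: CkD => //; apply: CkM; [exact: Ck_cst|exact: Ck_bump].
  by apply/funext => t; rewrite big_cons.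
- move=> m t Nt; apply: (Q_supp S0 S1) => x tx xt; apply: phiN.
  move: Nt; rewrite !ler_normr => /orP[h|h]; apply/orP; [left|right]; lra.
- move=> phi0 m t t0; apply: sumr_ge0 => i _.
  have [/(node_in (m := m))/andP[h _]|/(bump_supp S0 S1) ->] :=
    boolP (0 < (nat_of_ord i)%:R - zoom M m t < 3); last by rewrite mulr0.
  by apply: mulr_ge0; [apply: phi0; exact: ltW (le_lt_trans t0 h)|exact: (bump_ge0 Sm)].
- move=> m t; rewrite dQ1; split.
    by rewrite (le_trans (Q_bound Sm S0 S1 C10 _))// ?lerDl.
  rewrite (le_trans (Qd_bound Tm T0 T1 C20 _ _ _))// ?lerDr// => [||i _].
  + by rewrite node0 phiM// normrN ger0_norm//; lra.
  + by rewrite node_size// phiM// ger0_norm//; lra.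
  have m0 : 0 < m.+1%:R^-1 :> R by rewrite invr_gt0.
  have := @slope_bound _ phi (derive1 phi) C2 (node M m i) (node M m i.+1).
  rewrite node_next ltrDl m0 [_ + _ - node M m i]addrAC subrr add0r invrK.
  by rewrite -node_next; apply.
- move=> t; split.
    by apply: (Q_cvg Sm S0 S1) => //; exact: cvg_at_right_filter (cphi _).
  rewrite (_ : (fun m => _) = (fun m => Qd T M m phi t)); last by apply/funext => m; rewrite dQ1.
  apply: (Qd_cvg Tm T0 T1) => //; first by move=> h; apply: phi'N; lra.
  apply: slope_cvg; last exact: cvg_at_right_filter (cphi' _).
  exact: nearW.
Qed.

(** * Passing to C^1 time weights in the entropy inequality *)

Section C1_test_functions.
Context {R : realType}.
Local Notation mu := (@lebesgue_measure R).
Local Notation plane := (measurableTypeR R * measurableTypeR R)%type.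
Local Notation mu2 := (mu \x mu)%E.

Let mo := @measurable_open_half R.

Lemma time_weight_indic (T : R) : time_weight (\1_(`]0, T]%classic) : R -> R).
Proof.
split.
- by apply: measurable_indic; exact: measurable_itv.
- by exists 1 => t _; rewrite indicE; case: (_ \in _); rewrite ?normr1 ?normr0.
- by exists T => t Tt; rewrite indicE mem_setE in_itv/= (leNgt t) Tt andbF.
Qed.

Variables (F1 F2 D : R * R -> R) (E0 : R).
Hypothesis iF1 : forall T, mu2.-integrable (strip T) (EFin \o F1).
Hypothesis iF2 : forall T, mu2.-integrable (strip T) (EFin \o F2).
Hypothesis iD : forall T, mu2.-integrable (strip T) (EFin \o D).
Hypothesis smooth_inequality : forall (phi : R -> R) (N : R), smooth phi ->
  (forall t, N <= `|t| -> phi t = 0) -> (forall t, 0 <= t -> 0 <= phi t) ->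
  \int[mu2]_(p in open_half)
    (- derive1 phi p.1 * F1 p + phi p.1 * (2^-1 * F1 p + F2 p))
  <= phi 0 * E0 + \int[mu2]_(p in open_half) (phi p.1 * D p).

Lemma C1_weight (phi : R -> R) (N : R) : C1 phi -> (forall t, N <= `|t| -> phi t = 0) ->
  time_weight phi /\ time_weight (fun t => - derive1 phi t).
Proof.
move=> [dphi' cphi'] phiN.
have dphi (t : R) : is_derive t 1 phi (derive1 phi t).
  by rewrite derive1E; exact: derivableP.
split; apply: (weight_continuous (N := N)).
- by move=> t; exact: derivable_cvg (dphi t).
- by move=> t /ltW; exact: phiN.
- by move=> t; apply: cvgN; exact: cphi'.
- by move=> t Nt; rewrite (supp_derive dphi phiN)// oppr0.
Qed.

Lemma smooth_C1 (phi : R -> R) : smooth phi -> C1 phi.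
Proof.
move=> sphi; have [dphi sphi'] := smooth_derive sphi.
by split => [t|t]; [case: (dphi t)|exact: (smooth_continuous sphi')].
Qed.

Lemma C1_inequality (phi : R -> R) (N : R) : C1 phi ->
  (forall t, N <= `|t| -> phi t = 0) -> (forall t, 0 <= t -> 0 <= phi t) ->
  \int[mu2]_(p in open_half)
    (- derive1 phi p.1 * F1 p + phi p.1 * (2^-1 * F1 p + F2 p))
  <= phi 0 * E0 + \int[mu2]_(p in open_half) (phi p.1 * D p).
Proof.
move=> phi1 phiN phi0.
have [phi_ [C C0 [sm smN sm0 smC smcvg]]] := C1_approximation phi1 phiN.
have iB T : mu2.-integrable (strip T) (EFin \o (fun p => 2^-1 * F1 p + F2 p)).
  have ms := @measurable_strip R T.
  by apply: integrable_RD => //; exact: integrable_RZ.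
have iA (psi : R -> R) (M : R) : C1 psi -> (forall t, M <= `|t| -> psi t = 0) ->
    mu2.-integrable open_half (EFin \o (fun p => - derive1 psi p.1 * F1 p + psi p.1 * (2^-1 * F1 p + F2 p))) /\
    mu2.-integrable open_half (EFin \o (fun p => psi p.1 * D p)).
  move=> c1 cN; have [w w'] := C1_weight c1 cN.
  split; last exact: weight_integrable w iD.
  exact: (integrable_RD mo (weight_integrable w' iF1) (weight_integrable w iB)).
(* A majorant common to all approximants: they and their derivatives are bounded by C and supported
   up to N + 3. *)
pose W p := \1_(`]0, N + 3]%classic) p.1 *
  (C * (`|F1 p| + `|2^-1 * F1 p + F2 p| + `|D p|)).
have iW : mu2.-integrable open_half (EFin \o W).
  apply: (weight_integrable (time_weight_indic _)) => T.
  have ms := @measurable_strip R T; apply: integrable_RZ => //.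
  apply: integrable_RD => //; last exact: integrable_abse (iD T).
  by apply: integrable_RD => //; [exact: integrable_abse (iF1 T)|exact: integrable_abse (iB T)].
pose X_ m p := (- derive1 (phi_ m) p.1 * F1 p + phi_ m p.1 * (2^-1 * F1 p + F2 p)) - phi_ m p.1 * D p.
pose X p := (- derive1 phi p.1 * F1 p + phi p.1 * (2^-1 * F1 p + F2 p)) - phi p.1 * D p.
have iX_ m : mu2.-integrable open_half (EFin \o X_ m).
  have [h1 h2] := iA _ _ (smooth_C1 (sm m)) (smN m); exact: (integrable_RB mo h1 h2).
have X_W m p : open_half p -> `|X_ m p| <= W p.
  move=> p0; rewrite /W indicE mem_setE in_itv/= p0/=.
  have [pN|Np] := leP p.1 (N + 3); last first.
    have h : N + 3 < `|p.1| by rewrite (lt_le_trans Np)// ler_norm.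
    rewrite /X_ (derive1_supp (sm m) (smN m) h) (smN m p.1 (ltW h)).
    by rewrite oppr0 !mul0r addr0 subr0 normr0.
  have [h1 h2] := smC m p.1; rewrite mul1r /X_.
  apply: (le_trans (ler_normB _ _)); rewrite [leRHS]mulrDr; apply: lerD; rewrite 1?[leRHS]mulrDr.
    apply: (le_trans (ler_normD _ _)).
    by rewrite !normrM normrN; apply: lerD; rewrite ler_wpM2r.
  by rewrite normrM ler_wpM2r.
have X_cvg p : open_half p -> X_ m p @[m --> \oo] --> X p.
  move=> p0; have [h1 h2] := smcvg p.1.
  apply: cvgB; last by apply: cvgM => //; exact: cvg_cst.
  apply: cvgD; apply: cvgM => //; try exact: cvg_cst.
  exact: cvgN.
have [_ XX] := @Rdominated_convergence _ _ _ mu2 _ mo X_ X W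
  (fun m => integrable_Rmeasurable (iX_ m)) iW X_W X_cvg.
have h0 : phi_ m 0 * E0 @[m --> \oo] --> phi 0 * E0.
  by apply: cvgM; [exact: (smcvg 0).1|exact: cvg_cst].
have [i1 i2] := iA _ _ phi1 phiN.
rewrite -lerBlDr -RintegralB//.
apply: (ler_cvg_to XX h0); apply: nearW => m.
have [j1 j2] := iA _ _ (smooth_C1 (sm m)) (smN m).
rewrite /X_ RintegralB// lerBlDr.
apply: (smooth_inequality (sm m) (smN m)); exact: sm0.
Qed.

End C1_test_functions.

(** * Time zero *)

Section time_zero.
Context {R : realType}.
Local Notation mu := (@lebesgue_measure R).
Variables (alpha k gamma rhom rhop L l W : R) (rho0 n0 : R -> R) (rho n : R * R -> R).
Variable roo : R -> R.
Hypotheses (k0 : 0 < k) (gamma1 : 1 <= gamma).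
Hypotheses (l0 : 0 < l) (rhom_ge : l <= rhom) (rhop_ge : l <= rhop).
Hypothesis sol : weak_solution alpha k gamma rho0 n0 rho n.
Hypothesis roo_ge0 : forall y, 0 <= roo y.
Hypothesis roo_gt0 : forall y, gamma == 1 -> 0 < roo y.
Hypothesis roo_cont : continuous roo.
Hypothesis pinf_cont : continuous (pressure k gamma \o roo).
Hypothesis roo_right : forall y, L < y -> roo y = rhop.
Hypothesis roo_left : forall y, y < - L -> roo y = rhom.
Hypothesis L0 : 0 < L.
Hypothesis w_bound : forall y, `|dpot k gamma (roo y)| <= W.
Hypothesis E0_fin :
  (rel_entropy k gamma 0%R rho0 n0 (rho_hat rhom rhop) (cst 0%R) < +oo)%E.

Local Notation hat := (rho_hat rhom rhop).

Definition kin_density0 (y : R) : R := n0 y ^+ 2 / rho0 y.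
Definition pot_density0 (y : R) : R :=
  pot k gamma (rho0 y) - dpot k gamma (roo y) * rho0 y + pressure k gamma (roo y).

Local Notation K := kin_density0.
Local Notation H := pot_density0.

Let mrho0 : measurable_fun (setT : set (measurableTypeR R)) rho0.
Proof. by have [] := ws_rho0_L1loc sol. Qed.
Let mn0 : measurable_fun (setT : set (measurableTypeR R)) n0.
Proof. by have [] := ws_n0_L1loc sol. Qed.
Let mroo : measurable_fun (setT : set (measurableTypeR R)) roo.
Proof. exact: continuous_measurable_fun. Qed.
Let mhat : measurable_fun (setT : set (measurableTypeR R)) hat.
Proof. exact: measurable_rho_hat. Qed.

Let half : R := 2^-1 * expR (- 0).
Let halfE : half = 2^-1. Proof. by rewrite /half oppr0 expR0 mulr1. Qed.

Let f y := (half%:E * rel_kinetic (rho0 y) (n0 y) (0 / hat y)%R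
  + rel_pot k gamma (rho0 y) (hat y))%E.

Let mf : measurable_fun (setT : set (measurableTypeR R)) f.
Proof.
apply: emeasurable_funD; last exact: measurable_rel_pot.
apply: emeasurable_funM => //; apply: measurable_rel_kinetic => //.
by apply: measurable_funM => //; exact: measurable_inv.
Qed.

Let hat_gt0 y : 0 < hat y.
Proof. by rewrite /rho_hat; case: ifP => _; apply: lt_le_trans l0 _. Qed.

Let f_ge0 y : 0 <= rho0 y -> (0 <= f y)%E.
Proof.
move=> r0; rewrite /f (rel_pot_fin k gamma1 r0 (ltW (hat_gt0 y)) (fun _ => hat_gt0 y)).
apply: adde_ge0; last first.
  rewrite lee_fin; exact: (rel_pot_ge0 k0 gamma1 r0 (ltW (hat_gt0 y)) (fun _ => hat_gt0 y)).
apply: mule_ge0; first by rewrite lee_fin halfE.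
by rewrite /rel_kinetic; case: ifP => // _; rewrite lee_fin mulr_ge0// sqr_ge0.
Qed.

Let f_integrable : mu.-integrable setT f.
Proof.
apply/integrableP; split => //; apply: le_lt_trans E0_fin.
rewrite le_eqVlt; apply/orP; left; apply/eqP.
apply: ae_eq_integral => //; first exact: measurableT_comp.
by apply: (ae_mono _ (ws_rho0_ge0 sol)) => y r0 _; rewrite gee0_abs// f_ge0.
Qed.

Lemma physical0_ae : {ae mu, forall y, 0 <= rho0 y /\ (rho0 y = 0 -> n0 y = 0)}.
Proof.
have h := integrable_ae measurableT f_integrable.
apply: (ae_mono _ (ae_and (ws_rho0_ge0 sol) h)) => y [r0 /(_ I) fy]; split => //.
have half0 : 0 < half by rewrite halfE.
have fy' : (f y < +oo)%E by rewrite ltey_eq fy.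
exact: (vacuum_momentum half0 r0 fy').
Qed.

Let F y : R := half * K y + (pot k gamma (rho0 y) - dpot k gamma (hat y) * rho0 y
  + pressure k gamma (hat y)).

Let mK : measurable_fun (setT : set (measurableTypeR R)) K.
Proof. by apply: measurable_funM; [exact: measurable_funX|exact: measurable_inv]. Qed.

Let mrel r : measurable_fun (setT : set (measurableTypeR R)) r ->
  measurable_fun (setT : set (measurableTypeR R))
    (fun y => pot k gamma (rho0 y) - dpot k gamma (r y) * rho0 y + pressure k gamma (r y)).
Proof.
move=> mr; apply: measurable_funD; last exact: measurable_comp_pressure.
apply: measurable_funB; first exact: measurable_comp_pot.
by apply: measurable_funM => //; exact: measurable_comp_dpot.
Qed.

Let F_integrable : mu.-integrable setT (EFin \o F).
Proof.
have mF : measurable_fun (setT : set (measurableTypeR R)) F.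
  by apply: measurable_funD; [exact: measurable_funM|exact: mrel].
apply/integrableP; split; first exact/measurable_EFinP.
case/integrableP : f_integrable => _; apply: le_lt_trans.
rewrite le_eqVlt; apply/orP; left; apply/eqP.
apply: ae_eq_integral => //.
- by apply: measurableT_comp => //; exact/measurable_EFinP.
- exact: measurableT_comp.
apply: (ae_mono _ physical0_ae) => y [r0 rn] _; congr abse.
rewrite /f rel_kinetic_fin// (rel_pot_fin k gamma1 r0 (ltW (hat_gt0 y)) (fun _ => hat_gt0 y)).
by rewrite -EFinM -EFinD /= /F mul0r; congr EFin; rewrite /K; ring.
Qed.

Let e y : R := half * K y + H y.

(** Passing from rho_hat to rho_oo changes the density by a term affine in rho0 and supported in
    [-L, L], where rho0 is integrable. Finite entropy with respect to rho_hat thus carries over. *)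
Let e_integrable : mu.-integrable setT (EFin \o e).
Proof.
have [P P0 hP] := continuous_bounded L pinf_cont.
pose C1 := `|dpot k gamma rhom| + `|dpot k gamma rhop| + W.
pose C2 := `|pressure k gamma rhom| + `|pressure k gamma rhop| + P.
pose D y : R := (dpot k gamma (hat y) - dpot k gamma (roo y)) * rho0 y +
  (pressure k gamma (roo y) - pressure k gamma (hat y)).
have W0 : 0 <= W by exact: le_trans (normr_ge0 _) (w_bound 0).
have mL : measurable (`[- L, L]%classic : set (measurableTypeR R)) by exact: measurable_itv.
have iG : mu.-integrable setT (EFin \o ((fun y => C1 * `|rho0 y| + C2) \_ `[- L, L])).
  have i1 := integrable_abse (integrable_rho0 sol L).
  have i2 := integrable_RD mL (integrable_RZ mL C1 i1) (integrable_RZ mL C2 (@one_itv R L)).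
  have := (integrable_mkcond _ mL).1 i2.
  by apply: eq_integrable => // y _; rewrite /= !patchE; case: ifP => //= _; rewrite mulr1.
have iD : mu.-integrable setT (EFin \o D).
  apply: (integrable_ae_le measurableT _ iG).
    apply: measurable_funD.
      by apply: measurable_funM => //; apply: measurable_funB; exact: measurable_comp_dpot.
    by apply: measurable_funB; exact: measurable_comp_pressure.
  apply: aeW => y _; rewrite patchE; case: ifPn => [|/negP].
    rewrite inE/= in_itv/= -ler_norml => yL.
    apply: (le_trans (ler_normD _ _)); rewrite normrM; apply: lerD.
      rewrite ler_wpM2r//; apply: (le_trans (ler_normB _ _)); apply: lerD => //.
      by rewrite /rho_hat; case: ifP => _; rewrite ?lerDl ?lerDr.
    rewrite distrC; apply: (le_trans (ler_normB _ _)); apply: lerD; last exact: hP.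
    by rewrite /rho_hat; case: ifP => _; rewrite ?lerDl ?lerDr.
  rewrite inE/= in_itv/= -ler_norml => /negP; rewrite -ltNge ltr_normr => yL.
  have -> : D y = 0; last by rewrite normr0.
  suff E : roo y = hat y by rewrite /D E !subrr mul0r addr0.
  case/orP : yL => h; rewrite /rho_hat.
    by rewrite roo_right// ifF//; apply/negbTE; rewrite -leNgt (ltW (lt_trans L0 h)).
  by rewrite roo_left; [rewrite ifT// -oppr_gt0 (lt_trans L0)|rewrite ltrNr].
have := integrable_RD measurableT F_integrable iD.
by apply: eq_integrable => // y _ /=; rewrite /e /F /D /H; congr EFin; ring.
Qed.

Lemma entropy0_bounds : {ae mu, forall y, 0 <= K y /\ 0 <= H y}.
Proof.
apply: (ae_mono _ physical0_ae) => y [r0 rn]; split.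
  by rewrite mulr_ge0 ?sqr_ge0// invr_ge0.
exact: (rel_pot_ge0 k0 gamma1 r0 (roo_ge0 y) (roo_gt0 y)).
Qed.

Lemma kin0_integrable : mu.-integrable setT (EFin \o K).
Proof.
apply: (integrable_ae_le measurableT mK (integrable_RZ measurableT 2 e_integrable)).
apply: (ae_mono _ entropy0_bounds) => y [K0 H0] _; rewrite ger0_norm// /e halfE; lra.
Qed.

Lemma pot0_integrable : mu.-integrable setT (EFin \o H).
Proof.
apply: (integrable_ae_le measurableT (mrel mroo) e_integrable).
apply: (ae_mono _ entropy0_bounds) => y [K0 H0] _; change (`|H y| <= e y); rewrite (ger0_norm H0) /e halfE; lra.
Qed.

Lemma rel_entropy0E : rel_entropy k gamma 0%R rho0 n0 roo (cst 0%R) =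
  (\int[mu]_y (2^-1 * K y + H y))%:E.
Proof.
have := EFin_Rintegral measurableT e_integrable; rewrite /e halfE => <-.
apply: ae_eq_integral => //.
- apply: emeasurable_funD; last exact: measurable_rel_pot.
  apply: emeasurable_funM => //; apply: measurable_rel_kinetic => //.
  by apply: measurable_funM => //; exact: measurable_inv.
- have := measurable_int _ e_integrable; rewrite /e halfE; exact.
apply: (ae_mono _ physical0_ae) => y [r0 rn] _.
rewrite rel_kinetic_fin// (rel_pot_fin k gamma1 r0 (roo_ge0 y) (roo_gt0 y)).
by rewrite -EFinM -EFinD /= -/half halfE mul0r; congr EFin; rewrite /K /H; ring.
Qed.

End time_zero.

(** * Integrability of the relative entropy gap *)

(** In the bound E (1 + H + K) the first term uses integrability of E, the other two its
    boundedness; this is why the envelope must have both properties. *)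
Lemma integrable_dominated d (T : measurableType d) (R : realType)
    (nu : {measure set T -> \bar R}) (D : set T) (mD : measurable D)
    (F E H K : T -> R) (A B : R) :
  measurable_fun D F -> 0 <= A -> nu.-integrable D (EFin \o E) ->
  nu.-integrable D (EFin \o H) -> nu.-integrable D (EFin \o K) ->
  {ae nu, forall x, D x -> [/\ 0 <= E x <= B, 0 <= H x, 0 <= K x &
    `|F x| <= A * (E x * (1 + H x + K x))]} ->
  nu.-integrable D (EFin \o F).
Proof.
move=> mF A0 iE iH iK h.
have iHK := integrable_RZ mD (A * B) (integrable_RD mD iH iK).
apply: (integrable_ae_le mD mF (integrable_RD mD (integrable_RZ mD A iE) iHK)).
apply: (ae_mono _ h) => x {}h Dx; have [/andP[E0 EB] H0 K0 FA] := h Dx.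
apply: (le_trans FA); rewrite -mulrA -mulrDr ler_wpM2l// -addrA mulrDr mulr1 lerD2l.
by rewrite ler_wpM2r// addr_ge0.
Qed.

Section gap_integrability.
Context {R : realType}.
Local Notation mu := (@lebesgue_measure R).
Local Notation plane := (measurableTypeR R * measurableTypeR R)%type.
Local Notation mu2 := (mu \x mu)%E.
Variables (alpha k gamma rhom rhop L l : R) (roo : R -> R) (rho0 n0 : R -> R).
Variables (rho n rhob nb : R * R -> R).
Hypotheses (k0 : 0 < k) (gamma1 : 1 <= gamma).
Hypotheses (rhom0 : 0 <= rhom) (rhop0 : 0 <= rhop).
Hypothesis roo_C1 : C1 roo.
Hypothesis roo_ge0 : forall y, 0 <= roo y.
Hypothesis w_C1 : C1 (dpot k gamma \o roo).
Hypothesis roo_right : forall y, L < y -> roo y = rhop.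
Hypothesis roo_left : forall y, y < - L -> roo y = rhom.
Hypothesis l0 : 0 < l.
Hypothesis rhob_ge : forall p, closed_half p -> l <= rhob p.
Hypothesis rhob_C0 : {within closed_half, continuous rhob}.
Hypothesis nb_C0 : {within closed_half, continuous nb}.
Hypothesis y_rhob : Linfloc_L1_Linf (fun p => p.2 * (rhob p - rho_hat rhom rhop p.2)).
Hypothesis y_nb : Linfloc_L1_Linf (fun p => p.2 * nb p).
Hypothesis sol : weak_solution alpha k gamma rho0 n0 rho n.
Hypothesis rhob_reg : reg rhob (Dtau rhob) (Dy rhob).
Hypothesis nb_reg : reg nb (Dtau nb) (Dy nb).

Local Notation w := (dpot k gamma \o roo).
Local Notation pinf := (pressure k gamma \o roo).
Local Notation V := (velocity rhob nb).
Local Notation beta := (beta k gamma rhob nb w).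
Local Notation kappa := (kappa k gamma rhob pinf).
Local Notation gap := (gap k gamma rhob nb w pinf).
Local Notation env := (envelope rhom rhop L rhob nb).
Local Notation K := (kin_density rho n).
Local Notation H := (pot_density k gamma rho roo).

Hypothesis iK : forall T, mu2.-integrable (strip T) (EFin \o K).
Hypothesis iH : forall T, mu2.-integrable (strip T) (EFin \o H).

(** The flux of the gap without its part -(y / 2) gap, which is not dominated by the envelope and is
    treated separately in [cutoff_limit]. *)
Definition tail_flux (p : R * R) : R :=
  beta p * n p - expR (- p.1) * V p * (n p ^+ 2 / rho p)
  - V p * (pressure k gamma (rho p) - pressure k gamma (rhob p)).
(** The difference between rho |n / rho - V|^2 and n^2 / rho. *)
Definition friction_gap (p : R * R) : R := - 2 * V p * n p + rho p * V p ^+ 2.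

Let mo := @measurable_open_half R.
Let rhop_ge : l <= rhop.
Proof. exact: (rhop_ge rhob_ge rhob_C0 y_rhob). Qed.
Let rhom_ge : l <= rhom.
Proof. exact: (rhom_ge rhob_ge rhob_C0 y_rhob). Qed.
Let roo_gt0 := roo_gt0 k0 roo_C1 roo_ge0 w_C1 roo_right l0 rhop_ge.

Lemma pointwise_bounds (T : R) : exists B, exists2 C : R, 0 <= C &
  forall p, 0 <= p.1 <= T -> forall r m, 0 <= r -> (r = 0 -> m = 0) ->
    let h := pot k gamma r - w p.2 * r + pinf p.2 in
    [/\ 0 <= env p <= B, 0 <= h, 0 <= m ^+ 2 / r &
    [/\ `|- expR (- p.1) * V p * m + beta p * r + kappa p| <= C * (env p * (1 + h + m ^+ 2 / r)),
      `|beta p * m - expR (- p.1) * V p * (m ^+ 2 / r)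
        - V p * (pressure k gamma r - pressure k gamma (rhob p))|
        <= C * (env p * (1 + h + m ^+ 2 / r)) &
      `|- 2 * V p * m + r * V p ^+ 2| <= C * (env p * (1 + h + m ^+ 2 / r))]].
Proof.
have [u [lu [B B0 hB]]] := envelope_bounds k0 gamma1 rhom0 rhop0 roo_C1 roo_ge0 w_C1
  roo_right roo_left l0 rhob_ge rhob_C0 nb_C0 y_rhob y_nb T.
have [W W0 hW] := w_bounded w_C1 roo_right roo_left.
have [C C0 hC] := flux_bounds k0 gamma1 l0 lu W0.
(* [flux_bounds] is applied with d = B env, which by [envelope_bounds] dominates all deviations of
   the background. *)
exists B, (C * B); first exact: mulr_ge0.
move=> p pT r m r0 rm h.
have [[ru nu eB] [b1 b2 b3]] := hB p pT.
have h0 : 0 <= h by exact: (rel_pot_ge0 k0 gamma1 r0 (roo_ge0 _) (roo_gt0 _)).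
have e0 : 0 <= env p by exact: envelope_ge0.
have k2 : 0 <= m ^+ 2 / r by rewrite mulr_ge0 ?sqr_ge0// invr_ge0.
have rlu : l <= rhob p <= u by rewrite ru rhob_ge//; case/andP: pT.
have E01 : 0 <= expR (- p.1) <= 1.
  by rewrite expR_ge0 -expR0 ler_expR oppr_le0; case/andP: pT.
have [q1 q2 q3 _] := hC r m (rhob p) (nb p) (w p.2) (pinf p.2) (expR (- p.1)) (B * env p)
  r0 rm rlu nu (hW _) (pressure_ge0 gamma k0 _) E01 b1 b2 b3 h0.
split => //; first by rewrite e0.
by rewrite -!(mulrA B) !(mulrA C B) in q1 q2 q3; split.
Qed.

Let good T : {ae mu2, forall p, strip T p -> 0 <= p.1 <= T /\
  (0 <= rho p /\ (rho p = 0 -> n p = 0))}.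
Proof.
by apply: (ae_mono _ (physical_ae sol)) => p h [p0 pT]; rewrite (ltW p0) pT; split; last exact: h.
Qed.

Lemma balance_strip (T : R) : [/\ mu2.-integrable (strip T) (EFin \o gap rho n),
  mu2.-integrable (strip T) (EFin \o tail_flux) &
  mu2.-integrable (strip T) (EFin \o friction_gap)].
Proof.
have [B [C C0 hC]] := pointwise_bounds T.
have ms := @measurable_strip R T.
have mS := fun (F : R * R -> R) (mF : measurable_fun (open_half : set plane) F) =>
  measurable_funS mo (@strip_open R T) mF.
have ie := envelope_strip L y_rhob y_nb T.
have mV := measurable_V rhob_reg nb_reg l0 rhob_ge.
have mrho := measurable_rho sol; have mn := measurable_n sol; have mk := measurable_kin sol.
have mE := @measurable_exp_fst R.
have mrhob := measurable_rhob rhob_reg.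
have mw : measurable_fun (open_half : set plane) (fun p => w p.2).
  by apply: measurable_snd_fun; apply: continuous_measurable_fun; exact: (w_continuous w_C1).
have mpinf : measurable_fun (open_half : set plane) (fun p => pinf p.2).
  apply: (@measurable_snd_fun R pinf); apply: measurable_comp_pressure.
  by apply: continuous_measurable_fun; exact: (roo_continuous roo_C1).
have mbeta : measurable_fun (open_half : set plane) beta.
  apply: measurable_funD => //; apply: measurable_funB; last exact: measurable_comp_dpot.
  apply: measurable_funM; last exact: measurable_funX.
  exact: measurable_funM.
have mkappa : measurable_fun (open_half : set plane) kappa.
  by apply: measurable_funB => //; exact: measurable_comp_pressure.
have mEV : measurable_fun (open_half : set plane) (fun p => expR (- p.1) * V p).
  exact: measurable_funM.
split.
- apply: (integrable_dominated (A := C) (B := B) ms _ C0 ie (iH T) (iK T)).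
    apply: mS; apply: measurable_funD => //; apply: measurable_funD; last exact: measurable_funM.
    apply: measurable_funM => //; apply: measurable_funM => //.
    exact: measurableT_comp.
  apply: (ae_mono _ (good T)) => p h /h[pT [r0 rn]].
  by have [? ? ? []] := hC p pT _ _ r0 rn.
- apply: (integrable_dominated (A := C) (B := B) ms _ C0 ie (iH T) (iK T)).
    apply: mS; apply: measurable_funB.
      by apply: measurable_funB; exact: measurable_funM.
    apply: measurable_funM => //; apply: measurable_funB; exact: measurable_comp_pressure.
  apply: (ae_mono _ (good T)) => p h /h[pT [r0 rn]].
  by have [? ? ? []] := hC p pT _ _ r0 rn.
- apply: (integrable_dominated (A := C) (B := B) ms _ C0 ie (iH T) (iK T)).
    apply: mS; apply: measurable_funD.
      by apply: measurable_funM => //; exact: measurable_funM.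
    by apply: measurable_funM => //; exact: measurable_funX.
  apply: (ae_mono _ (good T)) => p h /h[pT [r0 rn]].
  by have [? ? ? []] := hC p pT _ _ r0 rn.
Qed.

(** The trace at time 0 is the pointwise limit of the measurable slices at times 1 / (m + 1). *)
Lemma reg_measurable0 c ct cy : @reg R c ct cy ->
  measurable_fun (setT : set (measurableTypeR R)) (fun y => c (0, y)).
Proof.
move=> creg; have [mc _ _] := reg_measurable creg; have [_ _ c0 _] := creg.
have s0 m : 0 < m.+1%:R^-1 :> R by rewrite invr_gt0.
have sc : (fun m => m.+1%:R^-1 : R) @ \oo --> 0^'+.
  move=> A [e /= e0 eA]; have /cvgrPdist_lt/(_ e e0) := @cvg_harmonic R.
  by apply: filterS => m h; apply: eA.
apply: (measurable_fun_cvg (h := fun m y => c (m.+1%:R^-1, y))).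
  by move=> m; exact: (measurable_half_section mc).
by move=> y _; exact: (cvg_comp _ _ sc (c0 y)).
Qed.

Hypothesis phys0 : {ae mu, forall y, 0 <= rho0 y /\ (rho0 y = 0 -> n0 y = 0)}.
Hypothesis iK0 : mu.-integrable setT (EFin \o kin_density0 rho0 n0).
Hypothesis iH0 : mu.-integrable setT (EFin \o pot_density0 k gamma rho0 roo).

Lemma gap_zero :
  mu.-integrable setT (EFin \o (fun y => gap (fun p => rho0 p.2) (fun p => n0 p.2) (0, y))).
Proof.
have [B [C C0 hC]] := pointwise_bounds 0.
have ie := envelope_zero L rhob_C0 nb_C0 y_rhob y_nb.
have mrho0 : measurable_fun (setT : set (measurableTypeR R)) rho0 by have [] := ws_rho0_L1loc sol.
have mn0 : measurable_fun (setT : set (measurableTypeR R)) n0 by have [] := ws_n0_L1loc sol.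
have mr := reg_measurable0 rhob_reg; have mnb := reg_measurable0 nb_reg.
have mV : measurable_fun (setT : set (measurableTypeR R)) (fun y => V (0, y)).
  by apply: measurable_funM => //; exact: measurable_inv.
have mroo : measurable_fun (setT : set (measurableTypeR R)) roo.
  by apply: continuous_measurable_fun; exact: (roo_continuous roo_C1).
have mw : measurable_fun (setT : set (measurableTypeR R)) w by exact: measurable_comp_dpot.
have mdr : measurable_fun (setT : set (measurableTypeR R)) (fun y => dpot k gamma (rhob (0, y))).
  exact: measurable_comp_dpot.
have mc (c : R) : measurable_fun (setT : set (measurableTypeR R)) (cst c).
  exact: measurable_cst.
have mb : measurable_fun (setT : set (measurableTypeR R)) (fun y => beta (0, y)).
  have m1 := measurable_funM (mc (2^-1 * expR (- 0))) (measurable_funX 2 mV).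
  exact: (measurable_funD (measurable_funB m1 mdr) mw).
have mk : measurable_fun (setT : set (measurableTypeR R)) (fun y => kappa (0, y)).
  by apply: measurable_funB; exact: measurable_comp_pressure.
have mg := measurable_funD (measurable_funD (measurable_funM
  (measurable_funM (mc (- expR (- 0))) mV) mn0) (measurable_funM mb mrho0)) mk.
apply: (integrable_dominated (A := C) (B := B) measurableT mg C0 ie iH0 iK0).
apply: (ae_mono _ phys0) => y [r0 rn] _.
have h : 0 <= (0 : R, y).1 <= 0 by rewrite /= lexx.
by have [? ? ? []] := hC (0, y) h _ _ r0 rn.
Qed.

End gap_integrability.

(** * The relative entropy inequality *)

Lemma compact_support_bound (R : realType) (f : R -> R) : compact_support f ->
  exists N : R, forall t, N <= `|t| -> f t = 0.
Proof.
move=> /compact_bounded[M [_ hM]]; exists (`|M| + 2) => t Nt.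
apply/eqP/negPn/negP => ft.
have MM : M < `|M| + 1 by rewrite (le_lt_trans (ler_norm M))// ltrDl.
have ct : closure [set x | f x != 0] t by exact: subset_closure.
have := hM _ MM t ct; rewrite /= leNgt => /negP; apply.
by apply: lt_le_trans Nt; rewrite ltrD2l (ltr_nat R 1 2).
Qed.

Theorem theorem3p14 (R : realType) (alpha k gamma rhom rhop : R)
    (rho0 n0 : R -> R) (rho n rhob nb : R * R -> R)
    (alpha_ge0 : 0 <= alpha) (k_gt0 : 0 < k) (gamma_ge1 : 1 <= gamma)
    (rhom_ge0 : 0 <= rhom) (rhop_ge0 : 0 <= rhop)
    (sol : weak_solution alpha k gamma rho0 n0 rho n)
    (E0_fin : (rel_entropy k gamma 0%R rho0 n0 (rho_hat rhom rhop) (cst 0%R)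
                 < +oo)%E)
    (TRE : total_rel_entropy_condition alpha k gamma rhom rhop rho0 n0 rho n)
    (rhob_C1 : C1_on open_half rhob)
    (nb_C1 : C1_on open_half nb)
    (rhob_C0 : {within closed_half, continuous rhob})
    (nb_C0 : {within closed_half, continuous nb})
    (inf_rhob : (0 < ereal_inf [set (rhob p)%:E | p in closed_half])%E)
    (rhob_y : Linfloc_L1_Linf (Dy rhob))
    (nb_y : Linfloc_L1_Linf (Dy nb))
    (rhob_tau : Linfloc_L1_Linf (Dtau rhob))
    (nb_tau : Linfloc_L1_Linf (Dtau nb))
    (y_rhob : Linfloc_L1_Linf
                (fun p => p.2 * (rhob p - rho_hat rhom rhop p.2)))
    (y_nb : Linfloc_L1_Linf (fun p => p.2 * nb p))
    (phi : R -> R) (phi_C1c : C1_test_fun phi)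
    (phi_ge0 : forall t, 0 <= t -> 0 <= phi t)
    (rhs_exists : integral_exists
       (fun p => phi p.1 * xi alpha k gamma rhob nb rho n p)) :
  let mu := @lebesgue_measure R in
  let E t := rel_entropy k gamma t
               (fun y => rho (t, y)) (fun y => n (t, y))
               (fun y => rhob (t, y)) (fun y => nb (t, y)) in
  (\int[mu]_(t in `]0%R, +oo[)
     ((- derive1 phi t)%:E * E t
      + (phi t)%:E * (2^-1%:E * E t
          + alpha%:E * \int[mu]_y
              rel_kinetic (rho (t, y)) (n (t, y))
                          (nb (t, y) / rhob (t, y))))
   <= (phi 0)%:E * rel_entropy k gamma 0%R rho0 n0
                     (fun y => rhob (0%R, y)) (fun y => nb (0%R, y))
      + \int[mu]_(t in `]0%R, +oo[)
          ((phi t)%:E * \int[mu]_y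
             (xi alpha k gamma rhob nb rho n (t, y))%:E))%E.

Proof.
cbv zeta.
have [l l0 rhob_ge] : exists2 l : R, 0 < l & forall p, closed_half p -> l <= rhob p.
  have lb p : closed_half p -> (ereal_inf [set (rhob p)%:E | p in closed_half] <= (rhob p)%:E)%E.
    by move=> p0; apply: ereal_inf_lbound; exists p.
  move: inf_rhob lb; case: ereal_inf => [r| |]//.
    by rewrite lte_fin => r0 lb; exists r => // p /lb.
  by move=> _ lb; exists 1 => // p /lb.
have rhob_reg := C1_on_reg rhob_C1 rhob_C0 rhob_tau rhob_y.
have nb_reg := C1_on_reg nb_C1 nb_C0 nb_tau nb_y.
have rp := rhop_ge rhob_ge rhob_C0 y_rhob.
have rm := rhom_ge rhob_ge rhob_C0 y_rhob.
have [roo [roo_C1 roo0 w_C1 [L L0 [rooR rooL]] ineq]] := TRE.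
set w := dpot k gamma \o roo in w_C1 ineq.
have roo1 := roo_gt0 k_gt0 roo_C1 roo0 w_C1 rooR l0 rp.
have rooc := roo_continuous roo_C1.
have dw := w_derive w_C1.
have w'c : continuous (derive1 w) by case: w_C1.
have dpinf := pinf_derive k_gt0 gamma_ge1 roo_C1 roo0 w_C1 rooR l0 rp.
have pinfc : continuous (pressure k gamma \o roo).
  by move=> y; exact: derivable_cvg (dpinf y).
have [W W0 wW] := w_bounded w_C1 rooR rooL.
have [W' W'0 w'W] := w'_bounded w_C1 rooR rooL.
have w'0 := @w'_supp _ k gamma _ _ _ _ rooR rooL.
have phys0 := physical0_ae k_gt0 gamma_ge1 l0 rm rp sol E0_fin.
have iK0 := kin0_integrable k_gt0 gamma_ge1 l0 rm rp sol roo0 roo1 rooc pinfc rooR rooL L0 wW E0_fin.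
have iH0 := pot0_integrable k_gt0 gamma_ge1 l0 rm rp sol roo0 roo1 rooc pinfc rooR rooL L0 wW E0_fin.
have E0E := rel_entropy0E k_gt0 gamma_ge1 l0 rm rp sol roo0 roo1 rooc pinfc rooR rooL L0 wW E0_fin.
set E0 := (\int[_]_y _)%R in E0E.
rewrite E0E in ineq.
have iS := entropy_strip alpha_ge0 k_gt0 gamma_ge1 sol roo0 roo1 rooc w'c w'0 w'W ineq.
have iK := kin_strip alpha_ge0 k_gt0 gamma_ge1 sol roo0 roo1 rooc w'c w'0 w'W ineq.
have iH := pot_strip alpha_ge0 k_gt0 gamma_ge1 sol roo0 roo1 rooc w'c w'0 w'W ineq.
have iD := drift_strip sol rooc w'c w'0 w'W.
have sineq := @smooth_entropy_inequality _ _ _ _ _ _ _ _ _ _ _ _ _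
  alpha_ge0 k_gt0 gamma_ge1 sol roo0 roo1 rooc w'c w'0 w'W ineq.
pose e := entropy_density k gamma rho n roo; pose K := kin_density rho n.
pose D := drift rho n roo (derive1 w).
have mo := @measurable_open_half R.
have [phi1 /compact_support_bound[N phiN]] := phi_C1c.
have iaK T := integrable_RZ (@measurable_strip R T) alpha (iK T).
have I1 := C1_inequality iS iaK iD sineq phi1 phiN phi_ge0.
have [wphi wphi'] := C1_weight phi1 phiN.
pose g := gap k gamma rhob nb w (pressure k gamma \o roo) rho n.
pose g0 y := gap k gamma rhob nb w (pressure k gamma \o roo) (fun p => rho0 p.2) (fun p => n0 p.2) (0, y).
pose tf := tail_flux k gamma roo rho n rhob nb; pose fr := friction_gap rho n rhob nb.
pose x := xi alpha k gamma rhob nb rho n.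
have bal := balance_strip k_gt0 gamma_ge1 rhom_ge0 rhop_ge0 roo_C1 roo0 w_C1 rooR rooL l0
  rhob_ge rhob_C0 nb_C0 y_rhob y_nb sol rhob_reg nb_reg iK iH.
have ig T : ((@lebesgue_measure R) \x (@lebesgue_measure R))%E.-integrable (strip T) (EFin \o g) by have [] := bal T.
have itf T : ((@lebesgue_measure R) \x (@lebesgue_measure R))%E.-integrable (strip T) (EFin \o tf) by have [] := bal T.
have ifr T : ((@lebesgue_measure R) \x (@lebesgue_measure R))%E.-integrable (strip T) (EFin \o fr) by have [] := bal T.
have ig0 : (@lebesgue_measure R).-integrable setT (EFin \o g0).
  exact: (gap_zero k_gt0 gamma_ge1 rhom_ge0 rhop_ge0 roo_C1 roo0 w_C1 rooR rooL l0
  rhob_ge rhob_C0 nb_C0 y_rhob y_nb sol rhob_reg nb_reg phys0 iK0 iH0).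
have phys := physical_ae sol.
have dphi (t : R) : is_derive t 1 phi (derive1 phi t).
  by rewrite derive1E; apply: derivableP; case: phi1.
pose B p := 2^-1 * g p + alpha * fr p + D p.
have iB T : ((@lebesgue_measure R) \x (@lebesgue_measure R))%E.-integrable (strip T) (EFin \o B).
  have ms := @measurable_strip R T.
  exact: (integrable_RD ms (integrable_RD ms (integrable_RZ ms 2^-1 (ig T)) (integrable_RZ ms alpha (ifr T))) (iD T)).
(* Everything in phi' gap + phi source except phi xi; this part is integrable by the bounds on the
   gap. *)
pose A p := - (- derive1 phi p.1 * g p + phi p.1 * B p).
have iA : ((@lebesgue_measure R) \x (@lebesgue_measure R))%E.-integrable open_half (EFin \o A).
  have := integrable_RZ mo (-1) (integrable_RD mo (weight_integrable wphi' ig) (weight_integrable wphi iB)).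
  by apply: eq_integrable => // p _; rewrite /= /A mulN1r.
have mx : measurable_fun (open_half : set (measurableTypeR R * measurableTypeR R)) x.
  exact: (measurable_xi sol rhob_reg nb_reg l0 rhob_ge).
have mphi : measurable_fun (open_half : set (measurableTypeR R * measurableTypeR R)) (fun p => phi p.1).
  by apply: measurable_fst_fun; case: wphi.
have [iX XE] : ((@lebesgue_measure R) \x (@lebesgue_measure R))%E.-integrable open_half (EFin \o (fun p => phi p.1 * x p)) /\
    \int[((@lebesgue_measure R) \x (@lebesgue_measure R))%E]_(p in open_half) A p
    + \int[((@lebesgue_measure R) \x (@lebesgue_measure R))%E]_(p in open_half) (phi p.1 * x p)
    + \int[@lebesgue_measure R]_y (phi 0 * g0 y) = 0.
  (* Here X is phi xi. The existence of its integral in the extended sense enters at this point and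
     comes out as integrability. *)
  apply: (cutoff_limit iA (weight_integrable wphi itf) (weight_integrable wphi ig)
    (integrable_RZ measurableT (phi 0) ig0) _ rhs_exists).
    exact: measurable_funM.
  move=> chi M schi chiM; have [dchi schi'] := smooth_derive schi.
  have nv : {ae ((@lebesgue_measure R) \x (@lebesgue_measure R))%E, forall p, open_half p -> rho p = 0 -> n p = 0}.
    by apply: (ae_mono _ phys) => p h /h[].
  have phis t : Num.max N M <= t -> phi t = 0.
    by rewrite ge_max => /andP[Nt _]; apply: phiN; rewrite (le_trans Nt)// ler_norm.
  have chis y : Num.max N M <= `|y| -> chi y = 0.
    by rewrite ge_max => /andP[_ My]; exact: chiM.
  have [j1 j2] := cutoff_identity sol rhob_reg nb_reg l0 rhob_ge dw w'c rooc dpinf nv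
    dphi (proj2 phi1) phis dchi (smooth_continuous schi') chis.
  have EI p : derive1 phi p.1 * chi p.2 * g p
      + phi p.1 * chi p.2 * source alpha k gamma rho n rhob nb roo w (derive1 w) (pressure k gamma \o roo) p
      + phi p.1 * derive1 chi p.2 * flux k gamma rho n rhob nb w (pressure k gamma \o roo) p
    = chi p.2 * (A p + phi p.1 * x p) + derive1 chi p.2 * (phi p.1 * tf p - p.2 / 2 * (phi p.1 * g p)).
    rewrite /source /flux -/(g p) -/(x p) -/w /A /B /D /fr /tf /drift /friction_gap /tail_flux -/w.
    by ring.
  split.
    by apply: eq_integrable j1 => // p _ /=; rewrite EI.
  have -> : \int[((@lebesgue_measure R) \x (@lebesgue_measure R))%E]_(p in open_half) (chi p.2 * (A p + phi p.1 * x p)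
      + derive1 chi p.2 * (phi p.1 * tf p - p.2 / 2 * (phi p.1 * g p))) =
    \int[((@lebesgue_measure R) \x (@lebesgue_measure R))%E]_(p in open_half) (derive1 phi p.1 * chi p.2 * g p
      + phi p.1 * chi p.2 * source alpha k gamma rho n rhob nb roo w (derive1 w) (pressure k gamma \o roo) p
      + phi p.1 * derive1 chi p.2 * flux k gamma rho n rhob nb w (pressure k gamma \o roo) p).
    by apply: eq_Rintegral => p _; rewrite EI.
  rewrite -[RHS]j2; congr (_ + _); apply: eq_Rintegral => y _; rewrite /g0; ring.
(* Adding the gap turns the densities relative to (rho_oo, 0) into those relative to (rhob, nb). *)
pose F p := e p + g p; pose G p := alpha * (K p + fr p).
have iF T : ((@lebesgue_measure R) \x (@lebesgue_measure R))%E.-integrable (strip T) (EFin \o F).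
  exact: (integrable_RD (@measurable_strip R T) (iS T) (ig T)).
have iKf T : ((@lebesgue_measure R) \x (@lebesgue_measure R))%E.-integrable (strip T) (EFin \o (fun p => K p + fr p)).
  exact: (integrable_RD (@measurable_strip R T) (iK T) (ifr T)).
have iG T : ((@lebesgue_measure R) \x (@lebesgue_measure R))%E.-integrable (strip T) (EFin \o G).
  exact: (integrable_RZ (@measurable_strip R T) alpha (iKf T)).
pose f1 p := ((2^-1 * expR (- p.1))%:E * rel_kinetic (rho p) (n p) (nb p / rhob p)%R
  + rel_pot k gamma (rho p) (rhob p))%E.
pose f2 p := rel_kinetic (rho p) (n p) (nb p / rhob p).
have mrho := measurable_rho sol; have mn := measurable_n sol.
have mV := measurable_V rhob_reg nb_reg l0 rhob_ge.
have mrhob := measurable_rhob rhob_reg.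
have mf2 : measurable_fun (open_half : set (measurableTypeR R * measurableTypeR R)) f2.
  exact: measurable_rel_kinetic.
have mf1 : measurable_fun (open_half : set (measurableTypeR R * measurableTypeR R)) f1.
  apply: emeasurable_funD; last exact: measurable_rel_pot.
  apply: emeasurable_funM => //; apply/measurable_EFinP; apply: measurable_funM => //.
  exact: measurable_exp_fst.
have f1F : {ae ((@lebesgue_measure R) \x (@lebesgue_measure R))%E, forall p, open_half p -> f1 p = (F p)%:E}.
  apply: (ae_mono _ phys) => p + p0 => /(_ p0)[r0 rn].
  have rb0 : 0 < rhob p by rewrite (lt_le_trans l0)// rhob_ge//; exact: ltW.
  rewrite /f1 rel_kinetic_fin// (rel_pot_fin k gamma_ge1 r0 (ltW rb0) (fun=> rb0)).
  rewrite -EFinM -EFinD; congr EFin.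
  rewrite /F /e /g /entropy_density /kin_density /pot_density /gap /beta /kappa /velocity /w /=.
  by move: (nb p / rhob p) (n p ^+ 2 / rho p) => v q; field.
have f2F : {ae ((@lebesgue_measure R) \x (@lebesgue_measure R))%E, forall p, open_half p -> f2 p = (K p + fr p)%:E}.
  apply: (ae_mono _ phys) => p + p0 => /(_ p0)[r0 rn].
  rewrite /f2 rel_kinetic_fin//; congr EFin; rewrite /K /fr /kin_density /friction_gap /velocity.
  by ring.
have s1 := slice_integral mf1 f1F iF.
have s2 : {ae (@lebesgue_measure R), forall t, 0 < t -> (@lebesgue_measure R).-integrable setT (EFin \o (fun y => G (t, y))) /\
    (alpha%:E * \int[@lebesgue_measure R]_y f2 (t, y) = (\int[@lebesgue_measure R]_y G (t, y))%:E)%E}.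
  apply: (ae_mono _ (slice_integral mf2 f2F iKf)) => t h t0; have [j1 j2] := h t0.
  split; first exact: (integrable_RZ measurableT alpha j1).
  by rewrite j2 /G (RintegralZl _ measurableT j1).
have mJ : measurable_fun (`]0%R, +oo[%classic : set (measurableTypeR R))
    (fun t => alpha%:E * \int[@lebesgue_measure R]_y f2 (t, y))%E.
  by apply: emeasurable_funM => //; exact: (measurable_half_iter mf2).
have [_ LE] := weighted_iterated wphi' wphi (measurable_half_iter mf1) mJ iF iG s1 s2.
have RE := weighted_iterated1 (measurable_weight wphi) mx iX.
have TE : rel_entropy k gamma 0%R rho0 n0 (fun y => rhob (0%R, y)) (fun y => nb (0%R, y)) =
    (E0 + \int[@lebesgue_measure R]_y g0 y)%:E.
  have ie0 := integrable_RD measurableT (integrable_RZ measurableT 2^-1 iK0) iH0.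
  rewrite /E0 -(RintegralD measurableT ie0 ig0) -(EFin_Rintegral measurableT (integrable_RD measurableT ie0 ig0)).
  have [mrho0 _ _] := ws_rho0_L1loc sol; have [mn0 _ _] := ws_n0_L1loc sol.
  have mr := reg_measurable0 rhob_reg; have mnb := reg_measurable0 nb_reg.
  apply: ae_eq_integral => //.
  - apply: emeasurable_funD; last exact: measurable_rel_pot.
    apply: emeasurable_funM => //; apply: measurable_rel_kinetic => //.
    by apply: measurable_funM => //; exact: measurable_inv.
  - exact: measurable_int (integrable_RD measurableT ie0 ig0).
  apply: (ae_mono _ phys0) => y [r0 rn] _.
  have rb0 : 0 < rhob (0, y) by rewrite (lt_le_trans l0)// rhob_ge// /closed_half/=.
  rewrite rel_kinetic_fin// (rel_pot_fin k gamma_ge1 r0 (ltW rb0) (fun=> rb0)).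
  rewrite -EFinM -EFinD; congr EFin.
  rewrite /g0 /kin_density0 /pot_density0 /gap /beta /kappa /velocity /w /= oppr0 expR0.
  by move: (nb (0, y) / rhob (0, y)) (n0 y ^+ 2 / rho0 y) => v q; field.
rewrite TE [X in (_ <= _ + X)%E]RE -EFinM -EFinD.
apply: (@le_trans _ _ (\int[((@lebesgue_measure R) \x (@lebesgue_measure R))%E]_(p in open_half) (- derive1 phi p.1 * F p + phi p.1 * (2^-1 * F p + G p)))%:E).
  by rewrite -LE.
rewrite lee_fin.
have iA1 := integrable_RD mo (weight_integrable wphi' iS)
  (weight_integrable wphi (fun T => integrable_RD (@measurable_strip R T) (integrable_RZ (@measurable_strip R T) 2^-1 (iS T)) (iaK T))).
have iPD := weight_integrable wphi iD.
(* The left side splits into that of the total relative entropy condition, minus [A], minus phi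
   times the drift. The last cancels the drift on the right of the condition, and the balance of the
   gap replaces [A] by phi xi and the initial gap. *)
have -> : \int[((@lebesgue_measure R) \x (@lebesgue_measure R))%E]_(p in open_half) (- derive1 phi p.1 * F p + phi p.1 * (2^-1 * F p + G p)) =
   \int[((@lebesgue_measure R) \x (@lebesgue_measure R))%E]_(p in open_half) (- derive1 phi p.1 * e p + phi p.1 * (2^-1 * e p + alpha * K p))
   - \int[((@lebesgue_measure R) \x (@lebesgue_measure R))%E]_(p in open_half) A p - \int[((@lebesgue_measure R) \x (@lebesgue_measure R))%E]_(p in open_half) (phi p.1 * D p).
  rewrite -RintegralB// -RintegralB//; last exact: integrable_RB.
  by apply: eq_Rintegral => p _; rewrite /F /G /A /B; ring.
move: XE; rewrite (RintegralZl _ measurableT ig0) mulrDr => XE.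
move: I1; rewrite -/e -/K -/D => I1.
by move: XE I1; rewrite /e /K /D; lra.
Qed.
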